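(* Let $R>0$ and $\alpha>0$. For every $q,q'\in\mathbb{B}_R$, $$\int_0^{+\infty}A^{\alpha}_{R,slice}(t;q)\,\overline{A^{\alpha}_{R,slice}(t;q')}\,\frac{t^\alpha e^{-t}}{\Gamma(\alpha+1)}\,dt=K^{\alpha}_{R,slice}(q,q').$$
   Context: $\mathbb{H}$ is the algebra of quaternions, with conjugation $q\mapsto\overline q$ and modulus $|q|$; $\mathbb{S}=\{I\in\mathbb{H}: I^2=-1\}$; for $I\in\mathbb{S}$, $\mathbb{C}_I=\mathbb{R}+\mathbb{R}I$. $\mathbb{B}_R=\{q\in\mathbb{H}:|q|<R\}$ and $\mathbb{B}_{R,I}=\mathbb{B}_R\cap\mathbb{C}_I$. A real differentiable function $f:\mathbb{B}_R\to\mathbb{H}$ is (left) slice regular if for every $I\in\mathbb{S}$ its restriction $f_I$ to $\mathbb{B}_{R,I}$ has continuous partial derivatives and satisfies $\left(\frac{\partial}{\partial x}+I\frac{\partial}{\partial y}\right)f_I(x+yI)=0$. The slice hyperholomorphic Bergman space $A^{2,\alpha}_{slice}(\mathbb{B}_R)$ is the right $\mathbb{H}$-vector space of slice regular functions $f$ on $\mathbb{B}_R$ whose restriction to $\mathbb{B}_{R,I}$ is square integrable with respect to $d\lambda^\alpha_{I,R}(x+yI)=\frac{\alpha}{\pi R^2}\left(1-\frac{|x+yI|^2}{R^2}\right)^{\alpha-1}dx\,dy$ (the space does not depend on $I\in\mathbb{S}$). It is a right quaternionic Hilbert space with scalar product $\langle f,g\rangle_{\alpha,slice}=\int_{\mathbb{B}_{R,I}}\overline{f}\,g\,d\lambda^\alpha_{I,R}$,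 and a reproducing kernel Hilbert space: its reproducing kernel (the weighted Bergman kernel) $K^{\alpha}_{R,slice}$ is the unique function on $\mathbb{B}_R\times\mathbb{B}_R$ such that $K^{\alpha}_{R,slice}(\cdot,p)\in A^{2,\alpha}_{slice}(\mathbb{B}_R)$ for each $p$, $\overline{K^{\alpha}_{R,slice}(q,p)}=K^{\alpha}_{R,slice}(p,q)$, and $f(q)=\int_{\mathbb{B}_{R,I}}K^{\alpha}_{R,slice}(q,z)f(z)\,d\lambda^\alpha_{I,R}(z)$ for all $f\in A^{2,\alpha}_{slice}(\mathbb{B}_R)$, $q\in\mathbb{B}_R$ and $I\in\mathbb{S}$. The function $A^{\alpha}_{R,slice}$ on $\mathbb{R}^+\times\mathbb{B}_R$ is defined, for $q=x+yI_q$ with $x,y\in\mathbb{R}$, $I_q\in\mathbb{S}$, and any $J\in\mathbb{S}$ (the value does not depend on the choice of $J$), by $$A^{\alpha}_{R,slice}(t;x+yI_q)=\frac{1-I_qJ}{2}A^{\alpha}_{R,hol}(t;x+yJ)+\frac{1+I_qJ}{2}A^{\alpha}_{R,hol}(t;x-yJ),$$ where, for $z\in\mathbb{B}_{R,J}$, $A^{\alpha}_{R,hol}(t;z)=\exp\left(\frac{tz}{z-R}\right)\left(1-\frac{z}{R}\right)^{-\alpha-1}$ is computed in the complex plane $\mathbb{C}_J$ with the principal power. *)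

(* Defs.v *)
From HB Require Import structures.
From mathcomp Require Import all_boot all_order all_algebra.
From mathcomp Require Import all_classical all_reals all_analysis.
From mathcomp Require Import complex ring lra.
Set Implicit Arguments.
Unset Strict Implicit.
Unset Printing Implicit Defensive.
Import Order.TTheory GRing.Theory Num.Theory.
Import numFieldNormedType.Exports.
Local Open Scope classical_set_scope.
Local Open Scope ring_scope.
Local Open Scope complex_scope.

(* Quaternions a + b i + c j + d k are the row vectors (a, b, c, d); they
   inherit the finite-dimensional normed topology of 'rV[R]_4 and get the
   Hamilton product below.  The norm `|q| inherited from 'rV[R]_4 is the sup
   norm; the quaternionic modulus is [qmod]. *)
Definition quat (R : realType) : Type := 'rV[R]_4.

HB.instance Definition _ (R : realType) := NormedModule.copy (quat R) 'rV[R]_4.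

Section Quaternion.
Context {R : realType}.
Implicit Types p q : quat R.

Definition mkq (a b c d : R) : quat R := \row_(i < 4) nth 0 [:: a; b; c; d] i.
Definition qcoord q (i : nat) : R := q ord0 (inord i).

Lemma qcoordE a b c d i : (i < 4)%N -> qcoord (mkq a b c d) i = [:: a; b; c; d]`_i.
Proof. by move=> i4; rewrite /qcoord mxE inordK. Qed.

Lemma quatP p q : (forall i, (i < 4)%N -> qcoord p i = qcoord q i) -> p = q.
Proof.
move=> pq; apply/rowP => i; have := pq i (ltn_ord i).
by rewrite /qcoord inord_val.
Qed.

Lemma qcoordD p q i : qcoord (p + q) i = qcoord p i + qcoord q i.
Proof. by rewrite /qcoord mxE. Qed.

Lemma qcoordN p i : qcoord (- p) i = - qcoord p i.
Proof. by rewrite /qcoord mxE. Qed.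

Lemma qcoordZ (a : R) p i : qcoord (a *: p) i = a * qcoord p i.
Proof. by rewrite /qcoord mxE. Qed.

Lemma qcoord0 i : qcoord 0 i = 0.
Proof. by rewrite /qcoord mxE. Qed.

Definition qone : quat R := mkq 1 0 0 0.

Definition qmul p q : quat R :=
  let a := qcoord p in let b := qcoord q in
  mkq (a 0%N * b 0%N - a 1%N * b 1%N - a 2%N * b 2%N - a 3%N * b 3%N)
      (a 0%N * b 1%N + a 1%N * b 0%N + a 2%N * b 3%N - a 3%N * b 2%N)
      (a 0%N * b 2%N - a 1%N * b 3%N + a 2%N * b 0%N + a 3%N * b 1%N)
      (a 0%N * b 3%N + a 1%N * b 2%N - a 2%N * b 1%N + a 3%N * b 0%N).

Definition qcoords := (qcoordD, qcoordN, qcoordZ, qcoord0, qcoordE).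

Lemma qmulA : associative qmul.
Proof.
by move=> p q s; apply: quatP => -[|[|[|[|//]]]] _; rewrite !qcoords //=; ring.
Qed.

Lemma qmul1q : left_id qone qmul.
Proof.
by move=> p; apply: quatP => -[|[|[|[|//]]]] _; rewrite !qcoords //=; ring.
Qed.

Lemma qmulq1 : right_id qone qmul.
Proof.
by move=> p; apply: quatP => -[|[|[|[|//]]]] _; rewrite !qcoords //=; ring.
Qed.

Lemma qmulDl : left_distributive qmul +%R.
Proof.
by move=> p q s; apply: quatP => -[|[|[|[|//]]]] _; rewrite !qcoords //=; ring.
Qed.

Lemma qmulDr : right_distributive qmul +%R.
Proof.
by move=> p q s; apply: quatP => -[|[|[|[|//]]]] _; rewrite !qcoords //=; ring.
Qed.

Lemma qone_neq0 : qone != 0.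
Proof.
apply/eqP => /(congr1 (qcoord ^~ 0%N)); rewrite qcoordE // qcoord0 /= => /eqP.
by rewrite oner_eq0.
Qed.

HB.instance Definition _ := GRing.Zmodule_isNzRing.Build (quat R)
  qmulA qmul1q qmulq1 qmulDl qmulDr qone_neq0.

Lemma qscaleAl (a : R) p q : a *: (p * q) = a *: p * q.
Proof.
by apply: quatP => -[|[|[|[|//]]]] _; rewrite !qcoords //=; ring.
Qed.

Lemma qscaleAr (a : R) p q : a *: (p * q) = p * (a *: q).
Proof.
by apply: quatP => -[|[|[|[|//]]]] _; rewrite !qcoords //=; ring.
Qed.

HB.instance Definition _ := GRing.Lmodule_isLalgebra.Build R (quat R) qscaleAl.
HB.instance Definition _ := GRing.Lalgebra_isAlgebra.Build R (quat R) qscaleAr.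

Definition qconj q : quat R :=
  mkq (qcoord q 0%N) (- qcoord q 1%N) (- qcoord q 2%N) (- qcoord q 3%N).

Definition qmod q : R :=
  Num.sqrt (qcoord q 0%N ^+ 2 + qcoord q 1%N ^+ 2 + qcoord q 2%N ^+ 2 + qcoord q 3%N ^+ 2).

Definition qball (r : R) : set (quat R) := [set q | qmod q < r].

Definition qsphere : set (quat R) := [set I | I * I = -1].

(* x + y I *)
Definition qslice (I : quat R) (x y : R) : quat R := x *: (1 : quat R) + y *: I.

Definition qslice_disc (r : R) (I : quat R) : set (R * R) :=
  [set z | qball r (qslice I z.1 z.2)].

Definition qintegrable d (T : measurableType d)
    (mu : {measure set T -> \bar R}) (D : set T) (f : T -> quat R) :=
  forall i, (i < 4)%N -> mu.-integrable D (EFin \o (fun x => qcoord (f x) i)).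

Definition qintegral d (T : measurableType d)
    (mu : {measure set T -> \bar R}) (D : set T) (f : T -> quat R) : quat R :=
  let c i := \int[mu]_(x in D) qcoord (f x) i in mkq (c 0%N) (c 1%N) (c 2%N) (c 3%N).

End Quaternion.

Section SliceRegular.
Context {R : realType}.
Implicit Types (r alpha : R) (I : quat R) (f : quat R -> quat R).

Definition fslice f I (z : R * R) : quat R := f (qslice I z.1 z.2).

(* Functions on the ball are represented by total functions whose values
   outside the (open) ball are irrelevant. *)
Definition slice_regular r f :=
  (forall q, qball r q -> differentiable f q) /\
  (forall I, qsphere I -> forall z, qslice_disc r I z ->
    let fI : R^o * R^o -> quat R := fslice f I in
    let ex : R^o * R^o := (1, 0) in
    let ey : R^o * R^o := (0, 1) in
    [/\ derivable fI z ex /\ derivable fI z ey,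
        {for z, continuous ('D_ex fI)},
        {for z, continuous ('D_ey fI)} &
        'D_ex fI z + I * 'D_ey fI z = 0]).

Local Notation lebesgue2 := (@lebesgue_measure R \x @lebesgue_measure R)%E.

(* density of lambda^alpha_{I,r} with respect to dx dy *)
Definition bergman_weight r alpha I (z : R * R) : R :=
  alpha / (pi * r ^+ 2) *
  (1 - qmod (qslice I z.1 z.2) ^+ 2 / r ^+ 2) `^ (alpha - 1).

Definition bergman_space r alpha : set (quat R -> quat R) :=
  [set f | slice_regular r f /\
    forall I, qsphere I ->
      lebesgue2.-integrable (qslice_disc r I)
        (EFin \o (fun z => qmod (fslice f I z) ^+ 2 * bergman_weight r alpha I z))].

Definition is_bergman_kernel r alpha (K : quat R -> quat R -> quat R) :=
  [/\ forall p, qball r p -> bergman_space r alpha (K ^~ p),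
      forall q p, qball r q -> qball r p -> qconj (K q p) = K p q &
      forall f, bergman_space r alpha f ->
      forall q, qball r q -> forall I, qsphere I ->
        f q = qintegral lebesgue2 (qslice_disc r I)
          (fun z => bergman_weight r alpha I z *:
                    (K q (qslice I z.1 z.2) * fslice f I z))].

End SliceRegular.

Section ComplexFunctions.
Context {R : realType}.
Implicit Types z w : R[i].

Definition cexp z : R[i] :=
  let: x +i* y := z in (expR x * cos y) +i* (expR x * sin y).

(* principal argument, with values in ]-pi, pi] for w != 0 *)
Definition carg w : R :=
  let: x +i* y := w in
  let a := acos (x / Num.sqrt (x ^+ 2 + y ^+ 2)) in if 0 <= y then a else - a.

Definition clog w : R[i] :=
  let: x +i* y := w in ln (Num.sqrt (x ^+ 2 + y ^+ 2)) +i* carg w.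

Definition cpow w (s : R) : R[i] := cexp (s%:C * clog w).

Definition Gamma (a : R) : R :=
  \int[@lebesgue_measure R]_(t in `]0, +oo[) (t `^ (a - 1) * expR (- t)).

Definition A_hol (r alpha t : R) z : R[i] :=
  cexp (t%:C * z / (z - r%:C)) * cpow (1 - z / r%:C) (- alpha - 1).

(* the isomorphism of C onto the complex plane C_J *)
Definition emb (J : quat R) z : quat R := let: x +i* y := z in qslice J x y.

(* value at x + y I, computed from the plane C_J *)
Definition A_formula (r alpha t : R) (J I : quat R) (x y : R) : quat R :=
  2^-1 *: (1 - I * J) * emb J (A_hol r alpha t (x +i* y)) +
  2^-1 *: (1 + I * J) * emb J (A_hol r alpha t (x -i* y)).

Definition qvec (q : quat R) : quat R :=
  mkq 0 (qcoord q 1%N) (qcoord q 2%N) (qcoord q 3%N).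

Definition qi : quat R := mkq 0 1 0 0.

(* an I_q with q = Re q + |Im q| I_q; the choice is arbitrary for real q *)
Definition qunit (q : quat R) : quat R :=
  if qvec q == 0 then qi else (qmod (qvec q))^-1 *: qvec q.

(* [A_sliceE] shows that the choices of q = x + y I_q and J do not matter. *)
Definition A_slice (r alpha t : R) (q : quat R) : quat R :=
  A_formula r alpha t qi (qunit q) (qcoord q 0%N) (qmod (qvec q)).

Lemma qsphereP (I : quat R) : qsphere I <->
  qcoord I 0%N = 0 /\
  qcoord I 1%N ^+ 2 + qcoord I 2%N ^+ 2 + qcoord I 3%N ^+ 2 = 1.
Proof.
split=> [/= II|[I0 I1]].
  have H i : (i < 4)%N -> qcoord (I * I) i = qcoord (- (mkq 1 0 0 0)) i.
    by rewrite II.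
  have := (H 0%N isT, H 1%N isT, H 2%N isT, H 3%N isT).
  rewrite !qcoords //= => -[[[h0 h1] h2] h3].
  suff I0 : qcoord I 0%N = 0 by split=> //; move: h0; rewrite I0; lra.
  apply/eqP; apply: contraT => I0.
  have z (b : R) : qcoord I 0%N * b = 0 -> b = 0.
    by move/eqP; rewrite mulf_eq0 (negbTE I0) => /eqP.
  have I1 : qcoord I 1%N = 0 by apply: z; lra.
  have I2 : qcoord I 2%N = 0 by apply: z; lra.
  have I3 : qcoord I 3%N = 0 by apply: z; lra.
  by move: h0; rewrite I1 I2 I3; nra.
apply: quatP => i i4; rewrite -[1 in RHS]/(mkq 1 0 0 0).
by move: i i4 => [|[|[|[|//]]]] _; rewrite !qcoords //= I0; lra.
Qed.

Lemma conjc_cexp z : cexp (conjc z) = conjc (cexp z).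
Proof. by case: z => x y /=; rewrite cosN sinN mulrN. Qed.

Lemma conjc_clog w : 0 < complex.Re w -> clog (conjc w) = conjc (clog w).
Proof.
case: w => x y /= x0; rewrite sqrrN; congr (_ +i* _).
rewrite oppr_ge0; case: (ltgtP y 0) => [||->] //; rewrite ?opprK //.
by rewrite expr0n addr0 sqrtr_sqr gtr0_norm // divff ?gt_eqF // acos1 oppr0.
Qed.

Lemma conjc_cpow w s : 0 < complex.Re w -> cpow (conjc w) s = conjc (cpow w s).
Proof.
move=> w0; rewrite /cpow conjc_clog // -conjc_cexp.
by rewrite [conjc (_ * _)]rmorphM /= oppr0.
Qed.

Lemma conjc_A_hol (r alpha t x y : R) : 0 < r -> x < r ->
  A_hol r alpha t (x -i* y) = conjc (A_hol r alpha t (x +i* y)).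
Proof.
move=> r0 xr.
have cM : {morph @conjc R : a b / a * b} by exact: rmorphM.
have cB : {morph @conjc R : a b / a - b} by exact: rmorphB.
have cV : {morph @conjc R : a / a^-1} by exact: conjc_inv.
have zE : x -i* y = conjc (x +i* y) by [].
rewrite /A_hol cM -conjc_cexp -conjc_cpow.
  by rewrite !(cM, cB, cV) !conjc_real.
have rV : r / r ^+ 2 = r^-1 by rewrite expr2 invfM mulrA divff ?mul1r ?gt_eqF.
rewrite /= expr0n /= addr0 mul0r oppr0 mulr0 subr0 rV.
by rewrite subr_gt0 ltr_pdivrMr // mul1r.
Qed.

Lemma A_formulaE (r alpha t x y : R) (J I : quat R) :
  0 < r -> x < r -> qsphere J ->
  A_formula r alpha t J I x y = emb I (A_hol r alpha t (x +i* y)).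
Proof.
move=> r0 xr SJ; rewrite /A_formula conjc_A_hol //.
case: (A_hol _ _ _ _) => u v /=.
have JJ : J * J = - 1 by [].
rewrite /qslice -!scalerAl -scalerDr mulrBl mulrDl !mul1r !mulrDr scaleNr.
rewrite !mulrN -!scalerAr !mulr1 -mulrA JJ mulrN1 !scalerN.
rewrite opprK; move: (u *: 1) (v *: J) (u *: (I * J)) (v *: I) => a b c d.
by apply: quatP => i _; rewrite !(qcoordD, qcoordZ, qcoordN); lra.
Qed.

Lemma A_sliceE (r alpha t x y : R) (J I : quat R) :
  0 < r -> qsphere J -> qsphere I -> qball r (qslice I x y) ->
  A_slice r alpha t (qslice I x y) = A_formula r alpha t J I x y.
Proof.
move=> r0 SJ /[dup] SI /qsphereP[I0 I1] xyr.
have x0 : qcoord (qslice I x y) 0%N = x.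
  by rewrite /qslice -[1]/(mkq 1 0 0 0) !qcoords //= I0; lra.
have vE : qvec (qslice I x y) = y *: I.
  apply: quatP => i i4; rewrite /qvec /qslice -[1]/(mkq 1 0 0 0).
  by move: i i4 => [|[|[|[|//]]]] _; rewrite !qcoords //= ?I0; lra.
have mE : qmod (y *: I) = `|y|.
  rewrite /qmod !qcoords // I0 mulr0 expr0n add0r !exprMn -!mulrDr I1 mulr1.
  exact: sqrtr_sqr.
have xr : x < r.
  apply: le_lt_trans xyr; rewrite (le_trans (ler_norm x)) // -sqrtr_sqr.
  by rewrite ler_wsqrtr // x0 -!addrA lerDl !addr_ge0 ?sqr_ge0.
have Sqi : qsphere (qi : quat R).
  by apply/qsphereP; rewrite !qcoordE //=; split=> //; ring.
rewrite /A_slice x0 vE mE !A_formulaE // /qunit vE mE.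
have I_neq0 : I != 0.
  apply/eqP => IE; move: I1; rewrite IE !qcoord0 => /eqP.
  by rewrite expr0n !addr0 eq_sym oner_eq0.
rewrite scaler_eq0 (negbTE I_neq0) orbF.
have [y0|y0|->] := ltgtP y 0.
- rewrite ltr0_norm // (conjc_A_hol _ _ _ r0 xr).
  case: (A_hol _ _ _ _) => u v /=; rewrite /qslice invrN; congr (_ + _).
  by rewrite !scalerA; congr (_ *: _); field; rewrite lt_eqF.
- by rewrite gtr0_norm // scalerA mulVf ?gt_eqF // scale1r.
- rewrite normr0; have := @conjc_A_hol r alpha t x 0 r0 xr; rewrite oppr0.
  case: (A_hol _ _ _ _) => u v [] v0; rewrite /= /qslice.
  have -> : v = 0 by lra.
  by rewrite !scale0r.
Qed.

End ComplexFunctions.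

(* Main.v *)
Require Import Defs.
From mathcomp Require Import all_boot all_order all_algebra.
From mathcomp Require Import all_classical all_reals all_analysis.
From mathcomp Require Import measurable_realfun.
From mathcomp Require Import complex ring lra.

(** Write [M(a, b) = (1 - a b / r^2)^(-alpha-1)] and let [q = x + y I],
    [q' = x' + y' J] correspond to the complex numbers [z], [z']. Both sides of
    the identity are equal to
      [M(z, conj z') (1 - I J) / 2 + M(z, z') (1 + I J) / 2],
    the values of [M] being read in [C_I].

    The constants come from multiplying elements of two different slices: for
    [b] in [C_J], the product [a b] with [a] in [C_I] is
    [(a b) (1 - I J) / 2 + (a conj b) (1 + I J) / 2], where [b] has been carried
    over to [C_I] ([emb_mul_emb]). As [A(t; q)] lies in [C_I] and the conjugate of
    [A(t; q')] in [C_J], the left-hand side reduces to two scalar integrals,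
    in which [a = z] and [b] is [conj z'] or [z']. In each of them the exponents
    add up to [- s t] with
      [s = 1 - a / (a - r) - b / (b - r)],
      [s (1 - a / r) (1 - b / r) = 1 - a b / r^2],
    so the Gamma integral at the complex parameter [s] gives [M]
    ([cint_generating]). That integral is [Gamma(alpha+1) s^(-alpha-1)]
    ([cint_laplace]): deform [s] to [1] inside the right half-plane.

    The kernel is found from the monomials that it reproduces. Conjugating the
    reproducing formula of [q^n] shows that the moments of
    [K(., q')] against [conj z ^ n] on the slice [C_I] are the conjugates of
    [q'^n] ([kernel_moment]). By slice regularity every left [C_I]-linear
    component of [K(., q')] is holomorphic on that slice, and the weighted
    measure is invariant under rotations, which makes monomials orthogonal; hence
    the moments are the Taylor coefficients multiplied by the Beta moments of the
    weight ([moment_coef]). The function [M(., b)] has the moments [b^n], since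
    its Taylor coefficients and the Beta moments satisfy recurrences that
    compensate each other ([binom_coef_moment]). So the components of [K(., q')] are combinations of
    two such functions, one for [conj z'] and one for [z']
    ([determined_by_moments]), and this is the displayed formula
    ([kernel_formula]).

    The complex analysis rests on one tool, [cint_homotopy]: if the derivative
    of an integrand with respect to a parameter always has integral zero, the
    integral does not depend on the parameter. It gives the Cauchy formula, by
    shrinking the circle to a point, and the Gamma integral. Plane integrals of
    radial functions are reduced to the line by [radial_integral]. *)

Import Order.TTheory GRing.Theory Num.Theory.
Import numFieldNormedType.Exports.
Local Open Scope classical_set_scope.
Local Open Scope ring_scope.
Set Implicit Arguments.
Unset Strict Implicit.
Unset Printing Implicit Defensive.

Local Open Scope complex_scope.
Local Notation Re := (@complex.Re _).
Local Notation Im := (@complex.Im _).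

(** * Measurability of continuous functions, and exhaustion *)

Section Measurability.
Context {R : realType}.

Lemma continuous_at_measurable (A : set R) (f : R -> R) :
  measurable A -> (forall x, A x -> {for x, continuous f}) -> measurable_fun A f.
Proof.
move=> mA cf; apply: (measurability _ (RGenOpens.measurableE R)).
move=> _ [_ [a [b ->] <-]].
rewrite (_ : A `&` _ = A `&` (f @^-1` [set` `]a, b[])°).
  by apply: measurableI => //; apply: open_measurable; exact: open_interior.
apply/seteqP; split => x [Ax fx]; split => //; last exact: interior_subset.
by apply: (cf _ Ax); apply: open_nbhs_nbhs; split => //; exact: interval_open.
Qed.

(** Boxes with rational vertices form a countable base of the topology. *)
Lemma open_measurable_prod (U : set (R * R)) : open U -> measurable U.
Proof.
move=> oU.
pose box (p : (rat * rat) * (rat * rat)) : set (R * R) :=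
  `]ratr p.1.1, ratr p.1.2[%classic `*` `]ratr p.2.1, ratr p.2.2[%classic.
pose P := [set p | box p `<=` U].
rewrite (_ : U = \bigcup_(p in P) box p); last first.
  apply/seteqP; split => [[x y] Uxy|z [p Pp pz]]; last exact: Pp.
  have [e /= e0 eU] : exists2 e : R, 0 < e & ball (x, y) e `<=` U.
    by have /nbhs_ballP[e /= e0 eU] := open_nbhs_nbhs (conj oU Uxy); exists e.
  have bd (t : R) : exists q : rat * rat, ratr q.1 < t < ratr q.2 /\
      `]ratr q.1, ratr q.2[%classic `<=` ball t e.
    have [a] := @rat_in_itvoo R (t - e) t ltac:(lra).
    have [b] := @rat_in_itvoo R t (t + e) ltac:(lra).
    rewrite !in_itv/= => /andP[b1 b2] /andP[a1 a2].
    exists (a, b); split; first by rewrite a2.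
    move=> u; rewrite /= in_itv/= /ball/= => /andP[u1 u2].
    by rewrite ltr_distlC; apply/andP; split; lra.
  have [p [px pe]] := bd x; have [q [qx qe]] := bd y.
  exists (p, q).
    by move=> [u v] [/= /pe u1 /qe v1]; apply: eU.
  by split; rewrite /= in_itv.
rewrite bigcup_mkcond; apply: countable_bigcupT_measurable => [|p].
  exact: countableP.
by case: ifPn => // _; apply: measurableX; exact: measurable_itv.
Qed.

Lemma continuous_at_measurable_prod (A : set (R * R)) (f : R * R -> R) :
  measurable A -> (forall x, A x -> {for x, continuous f}) -> measurable_fun A f.
Proof.
move=> mA cf; apply: (measurability _ (RGenOpens.measurableE R)).
move=> _ [_ [a [b ->] <-]].
rewrite (_ : A `&` _ = A `&` (f @^-1` [set` `]a, b[])°).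
  apply: measurableI => //; apply: open_measurable_prod; exact: open_interior.
apply/seteqP; split => x [Ax fx]; split => //; last exact: interior_subset.
by apply: (cf _ Ax); apply: open_nbhs_nbhs; split => //; exact: interval_open.
Qed.

End Measurability.

Section Exhaustion.
Context d (T : measurableType d) {R : realType} (m : {measure set T -> \bar R}).

Lemma cvg_Rintegral_exhaust (D : set T) (E : (set T)^nat) (f : T -> R) :
  measurable D -> (forall n, measurable (E n)) -> (forall n, E n `<=` D) ->
  (forall x, D x -> \forall n \near \oo, E n x) ->
  m.-integrable D (EFin \o f) ->
  \int[m]_(x in E n) f x @[n --> \oo] --> \int[m]_(x in D) f x.
Proof.
move=> mD mE ED cE intf.
pose g n := (EFin \o f) \_ (E n).
have mf : measurable_fun D (EFin \o f) by exact: (measurable_int m).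
have [] := @dominated_convergence _ _ _ m D mD g (EFin \o f)
   (fun x => `|(EFin \o f) x|%E) _ mf _ _ _.
- move=> n; apply/(measurable_restrict _ (mE n) mD).
  by apply: measurable_funS mf => //; exact: subIsetl.
- apply/aeW => x Dx; apply: cvg_near_cst.
  by near=> n; rewrite /g patchE mem_set//; near: n; exact: cE.
- exact: integrable_abse.
- apply/aeW => x n Dx; rewrite /g patchE; case: ifPn => //= _.
  by rewrite normr0 lee_fin normr_ge0.
move=> _ _ h.
have -> : (fun n => \int[m]_(x in E n) f x) =
    (fun n => fine (\int[m]_(x in D) g n x)%E).
  apply/funext => n; rewrite /Rintegral -integral_mkcondr.
  by rewrite (_ : D `&` E n = E n)//; apply/setIidPr/ED.
apply: fine_cvg; rewrite /Rintegral fineK//.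
exact: integrable_fin_num.
Unshelve. all: by end_near. Qed.

End Exhaustion.

(** * Integrals that are constant along a homotopy *)

Lemma FTC2_everywhere {R : realType} (F f : R -> R) (a b : R) : a < b ->
  (forall x, a <= x <= b -> is_derive x 1 F (f x)) ->
  (forall x, a <= x <= b -> {for x, continuous f}) ->
  (\int[@lebesgue_measure R]_(x in `[a, b]) (f x)%:E = (F b - F a)%:E)%E.
Proof.
move=> ab dF cf.
have cF x : a <= x <= b -> {for x, continuous F}.
  move=> /dF dFx; apply/differentiable_continuous/derivable1_diffP.
  exact: ex_derive.
rewrite EFinB; apply: (continuous_FTC2 ab).
- apply: continuous_in_subspaceT => x; rewrite inE/= in_itv/=; exact: cf.
- split.
  + by move=> x; rewrite in_itv/= => /andP[ax xb]; apply: ex_derive; apply: dF; rewrite !ltW.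
  + apply: cvg_at_right_filter; apply: cF; by rewrite lexx ltW.
  + apply: cvg_at_left_filter; apply: cF; by rewrite lexx ltW.
- move=> x; rewrite in_itv/= => /andP[ax xb]; rewrite derive1E.
  by apply: derive_val; apply: dF; rewrite !ltW.
Qed.

Section Homotopy.
Context d (T : measurableType d) {R : realType}
  (m : {sigma_finite_measure set T -> \bar R}).
Local Notation mu := (@lebesgue_measure R).

(** Integrate [W] in both orders: along [D] the integrals vanish by
    hypothesis, and along the parameter the fundamental theorem of calculus
    gives [P 1 t - P 0 t]. *)
Lemma Rintegral_homotopy (D : set T) (P : R -> T -> R) (W : R * T -> R) :
  measurable D ->
  (mu \x m)%E.-integrable (`]0, 1[%classic `*` D) (EFin \o W) ->
  (forall t (s : R), D t -> 0 <= s <= 1 -> is_derive s 1 (P ^~ t) (W (s, t))) ->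
  (forall t (s : R), D t -> 0 <= s <= 1 -> {for s, continuous (fun s => W (s, t))}) ->
  (forall s : R, 0 < s < 1 -> (\int[m]_(t in D) (W (s, t))%:E = 0)%E) ->
  m.-integrable D (EFin \o P 0) -> m.-integrable D (EFin \o P 1) ->
  \int[m]_(t in D) P 1 t = \int[m]_(t in D) P 0 t.
Proof.
move=> mD iW dP cW W0 i0 i1.
pose g := (EFin \o W) \_ (`]0, 1[%classic `*` D).
have mX : measurable (`]0, 1[%classic `*` D : set (R * T)).
  by apply: measurableX.
have ig : (mu \x m)%E.-integrable setT g by rewrite -integrable_mkcond.
have := Fubini ig.
have gE s t : g (s, t) = if (s \in (`]0, 1[%classic : set R)) && (t \in D)
   then (W (s, t))%:E else 0%E by rewrite /g patchE in_setX.
rewrite (_ : (fun x => _) = cst 0%E); last first.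
  apply/funext => s /=; have [s01|s01] := boolP (s \in (`]0, 1[%classic : set R)).
    rewrite -[RHS](W0 s); last by move: s01; rewrite inE/= in_itv.
    rewrite [RHS]integral_mkcond; apply: eq_integral => t _.
    by rewrite gE s01 patchE.
  by apply: integral0_eq => t _; rewrite gE (negbTE s01).
rewrite integral0.
rewrite (_ : (fun y => _) = ((fun t => (P 1 t - P 0 t)%:E) \_ D)); last first.
  apply/funext => t /=; rewrite patchE; case: ifPn => tD; last first.
    by apply: integral0_eq => s _; rewrite gE (negbTE tD) andbF.
  have Dt : D t by rewrite inE in tD.
  have <- : (\int[mu]_(s in `[0%R, 1%R]) (W (s, t))%:E = (P 1 t - P 0 t)%:E)%E.
    apply: (@FTC2_everywhere _ (P ^~ t) (fun s => W (s, t))) => // s s01.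
      exact: dP.
    exact: cW.
  have mW : measurable_fun (`](0:R), (1:R)]%classic : set R) (fun s => (W (s, t))%:E).
    apply/measurable_EFinP; apply: continuous_at_measurable => [|s].
      exact: measurable_itv.
    by rewrite /= in_itv/= => /andP[s0 s1]; apply: cW => //; rewrite s1 ltW.
  rewrite -integral_itv_obnd_cbnd//.
  rewrite -integral_itv_bndo_bndc//; last first.
    by apply: measurable_funS mW => //; apply: subset_itvl; rewrite bnd_simp.
  rewrite [RHS]integral_mkcond; apply: eq_integral => s _.
  by rewrite gE tD andbT patchE.
rewrite -integral_mkcond => /esym e0.
have : \int[m]_(t in D) (P 1 t - P 0 t) = 0 by rewrite /Rintegral e0.
by rewrite RintegralB// => /subr0_eq.
Qed.

End Homotopy.

(** * Complex-valued functions of real parameters *)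

Section ComplexAlgebra.
Context {R : realType}.
Implicit Types z w : R[i].

Lemma complex_eqP z w : Re z = Re w -> Im z = Im w -> z = w.
Proof. by case: z => a b; case: w => c d /= -> ->. Qed.
Lemma complexRI z : z = Re z +i* Im z. Proof. by case: z. Qed.
Lemma cReD z w : Re (z + w) = Re z + Re w. Proof. by case: z; case: w. Qed.
Lemma cImD z w : Im (z + w) = Im z + Im w. Proof. by case: z; case: w. Qed.
Lemma cReN z : Re (- z) = - Re z. Proof. by case: z. Qed.
Lemma cImN z : Im (- z) = - Im z. Proof. by case: z. Qed.
Lemma cReM z w : Re (z * w) = Re z * Re w - Im z * Im w.
Proof. by case: z; case: w. Qed.
Lemma cImM z w : Im (z * w) = Re z * Im w + Im z * Re w.
Proof. by case: z; case: w. Qed.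
Lemma cReV z : Re z^-1 = Re z / (Re z ^+ 2 + Im z ^+ 2). Proof. by case: z. Qed.
Lemma cImV z : Im z^-1 = - Im z / (Re z ^+ 2 + Im z ^+ 2).
Proof. by case: z => a b /=; rewrite mulNr. Qed.
Lemma cRe0 : Re (0 : R[i]) = 0. Proof. by []. Qed.
Lemma cIm0 : Im (0 : R[i]) = 0. Proof. by []. Qed.
Lemma cRe1 : Re (1 : R[i]) = 1. Proof. by []. Qed.
Lemma cIm1 : Im (1 : R[i]) = 0. Proof. by []. Qed.
Lemma Re_real (x : R) : Re x%:C = x. Proof. by []. Qed.
Lemma Im_real (x : R) : Im x%:C = 0. Proof. by []. Qed.
Lemma cReJ z : Re (conjc z) = Re z. Proof. by case: z. Qed.
Lemma cImJ z : Im (conjc z) = - Im z. Proof. by case: z. Qed.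
Lemma cReC (a b : R) : Re (a +i* b) = a. Proof. by []. Qed.
Lemma cImC (a b : R) : Im (a +i* b) = b. Proof. by []. Qed.
Definition reim := (cReC, cImC, cReD, cImD, cReN, cImN, cReM, cImM, cRe0, cIm0, cRe1, cIm1,
  Re_real, Im_real, cReJ, cImJ).

Definition cmod z : R := Num.sqrt (Re z ^+ 2 + Im z ^+ 2).
Lemma cmodE z : cmod z = Num.sqrt (Re z ^+ 2 + Im z ^+ 2).
Proof. by []. Qed.
Lemma cmod_ge0 z : 0 <= cmod z.
Proof. exact: sqrtr_ge0. Qed.
Lemma cmod_sqr z : cmod z ^+ 2 = Re z ^+ 2 + Im z ^+ 2.
Proof. by rewrite cmodE sqr_sqrtr// addr_ge0// sqr_ge0. Qed.
Lemma cmod_eq0 z : (cmod z == 0) = (z == 0).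
Proof.
apply/eqP/eqP => [z0|->]; last by rewrite cmodE reim expr0n addr0 sqrtr0.
have /eqP := cmod_sqr z; rewrite z0 expr0n eq_sym paddr_eq0 ?sqr_ge0//.
rewrite !sqrf_eq0 => /andP[/eqP a0 /eqP b0]; exact: complex_eqP.
Qed.
Lemma cmod0 : cmod 0 = 0. Proof. by apply/eqP; rewrite cmod_eq0. Qed.
Lemma cmod_gt0 z : (0 < cmod z) = (z != 0).
Proof. by rewrite lt_def cmod_ge0 andbT cmod_eq0. Qed.
Lemma cmodM z w : cmod (z * w) = cmod z * cmod w.
Proof.
rewrite !cmodE -sqrtrM ?addr_ge0 ?sqr_ge0//; congr Num.sqrt.
by rewrite !reim; ring.
Qed.
Lemma cmodJ z : cmod (conjc z) = cmod z.
Proof. by rewrite !cmodE !reim sqrrN. Qed.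
Lemma cmod_real (x : R) : cmod x%:C = `|x|.
Proof. by rewrite cmodE reim expr0n addr0 sqrtr_sqr. Qed.
Lemma cmod1 : cmod 1 = 1. Proof. by rewrite -[1]/(1%:C) cmod_real normr1. Qed.
Lemma cmodV z : cmod z^-1 = (cmod z)^-1.
Proof.
have [->|z0] := eqVneq z 0.
  by rewrite invr0 cmod0 invr0.
have n0 : cmod z != 0 by rewrite cmod_eq0.
by apply: (mulfI n0); rewrite -cmodM !divff// cmod1.
Qed.
Lemma cmodX z n : cmod (z ^+ n) = cmod z ^+ n.
Proof. by elim: n => [|n IH]; rewrite ?cmod1// !exprS cmodM IH. Qed.
Lemma Re_le_cmod z : `|Re z| <= cmod z.
Proof.
by rewrite -sqrtr_sqr cmodE ler_wsqrtr// lerDl sqr_ge0.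
Qed.
Lemma Im_le_cmod z : `|Im z| <= cmod z.
Proof.
by rewrite -sqrtr_sqr cmodE ler_wsqrtr// lerDr sqr_ge0.
Qed.
Lemma cmod_le z : cmod z <= `|Re z| + `|Im z|.
Proof.
have h : cmod z ^+ 2 <= (`|Re z| + `|Im z|) ^+ 2.
  rewrite cmod_sqr sqrrD !real_normK ?num_real// lerD2r lerDl.
  by rewrite mulrn_wge0// mulr_ge0.
by move: h; rewrite ler_pXn2r// nnegrE ?cmod_ge0// addr_ge0.
Qed.
Lemma cmodN z : cmod (- z) = cmod z.
Proof. by rewrite !cmodE !reim !sqrrN. Qed.
Lemma le_cmodD z w : cmod (z + w) <= cmod z + cmod w.
Proof. by move: z w => [a b] [c d]; exact: (complex.le_normcD (a +i* b) (c +i* d)). Qed.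
Lemma conjcM z w : conjc (z * w) = conjc z * conjc w.
Proof. exact: rmorphM. Qed.
Lemma mulcJ z : z * conjc z = (cmod z ^+ 2)%:C.
Proof.
by apply: complex_eqP; rewrite !reim ?cmod_sqr; ring.
Qed.

Lemma ci_neq0 : ('i%C : R[i]) != 0.
Proof. by apply/eqP => /(congr1 Im)/eqP; rewrite !reim oner_eq0. Qed.
Lemma complex_neq0 (x : R) : x != 0 -> x%:C != 0 :> R[i].
Proof. by apply: contraNN => /eqP/(congr1 Re)/eqP. Qed.

End ComplexAlgebra.

Section PathCalculus.
Context {R : realType}.
Implicit Types (f g : R -> R[i]) (t : R) (d e : R[i]).

Definition cder f t d :=
  is_derive t 1 (Re \o f) (Re d) /\ is_derive t 1 (Im \o f) (Im d).

Lemma cder_eq f t d e : d = e -> cder f t d -> cder f t e.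
Proof. by move=> ->. Qed.

Lemma cder_ext f g t d : f =1 g -> cder f t d -> cder g t d.
Proof. by move=> /funext ->. Qed.

Lemma is_derive_eq' (f : R -> R) t (d e : R) :
  is_derive t 1 f d -> d = e -> is_derive t 1 f e.
Proof. by move=> ? <-. Qed.

Lemma cder_cst c t : cder (fun=> c) t 0.
Proof. by split; exact: is_derive_cst. Qed.

Lemma cder_real (f : R -> R) t (d : R) :
  is_derive t 1 f d -> cder (fun t => (f t)%:C) t d%:C.
Proof. by move=> fd; split => //; exact: is_derive_cst. Qed.

Lemma cderD f g t d e : cder f t d -> cder g t e ->
  cder (fun t => f t + g t) t (d + e).
Proof.
move=> [f1 f2] [g1 g2]; split.
  rewrite (_ : Re \o _ = (Re \o f) + (Re \o g)).
    by rewrite reim; exact: is_deriveD.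
  by apply/funext => x /=; rewrite reim.
rewrite (_ : Im \o _ = (Im \o f) + (Im \o g)).
  by rewrite reim; exact: is_deriveD.
by apply/funext => x /=; rewrite reim.
Qed.

Lemma cderM f g t d e : cder f t d -> cder g t e ->
  cder (fun t => f t * g t) t (d * g t + f t * e).
Proof.
move=> [f1 f2] [g1 g2]; split.
  rewrite (_ : Re \o _ = (Re \o f) * (Re \o g) - (Im \o f) * (Im \o g)).
    apply: is_derive_eq' (is_deriveB (is_deriveM f1 g1) (is_deriveM f2 g2)) _.
    by rewrite !reim /= /GRing.scale/=; ring.
  by apply/funext => x /=; rewrite reim.
rewrite (_ : Im \o _ = (Re \o f) * (Im \o g) + (Im \o f) * (Re \o g)).
  apply: is_derive_eq' (is_deriveD (is_deriveM f1 g2) (is_deriveM f2 g1)) _.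
  by rewrite !reim /= /GRing.scale/=; ring.
by apply/funext => x /=; rewrite reim.
Qed.

Lemma cderZ c f t d : cder f t d -> cder (fun t => c * f t) t (c * d).
Proof.
move=> fd; apply: cder_eq (cderM (cder_cst c t) fd).
by rewrite mul0r add0r.
Qed.

Lemma cderB f g t d e : cder f t d -> cder g t e ->
  cder (fun t => f t - g t) t (d - e).
Proof.
move=> fd gd; apply: (@cder_ext (fun t => f t + -1 * g t)).
  by move=> x; rewrite mulN1r.
apply: cder_eq (cderD fd (cderZ (-1) gd)); by rewrite mulN1r.
Qed.

Lemma cderX f t d n : cder f t d ->
  cder (fun t => f t ^+ n) t (n%:R * f t ^+ n.-1 * d).
Proof.
move=> fd; elim: n => [|n IH].
  by rewrite mul0r mul0r; exact: cder_cst.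
apply: (@cder_ext (fun t => f t * f t ^+ n)) => [x|]; first by rewrite exprS.
apply: cder_eq (cderM fd IH); case: n {IH} => [|n] /=.
  by rewrite expr0; ring.
by rewrite [in RHS]mulrS !exprS; ring.
Qed.

Lemma cder_line (z v : R[i]) : cder (fun t => z + v * t%:C) 0 v.
Proof.
apply: cder_eq (cderD (cder_cst z 0) (cderZ v (cder_real (is_derive_id (0 : R) 1)))).
by rewrite add0r mulr1.
Qed.

Lemma is_derive_continuous (f : R -> R) t (d : R) : is_derive t 1 f d ->
  {for t, continuous f}.
Proof.
move=> fd; apply/differentiable_continuous/derivable1_diffP.
exact: ex_derive.
Qed.

End PathCalculus.

Section ComplexContinuity.
Context {R : realType} {T : topologicalType}.
Implicit Types (f g : T -> R[i]) (t : T).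

Definition ccont f t :=
  {for t, continuous (Re \o f)} /\ {for t, continuous (Im \o f)}.

Lemma ccont_ext f g t : f =1 g -> ccont f t -> ccont g t.
Proof. by move=> /funext ->. Qed.

Lemma ccont_cst c t : ccont (fun=> c) t.
Proof. by split; exact: cst_continuous. Qed.

Lemma ccont_real (f : T -> R) t : {for t, continuous f} ->
  ccont (fun t => (f t)%:C) t.
Proof. by move=> cf; split => //; exact: cst_continuous. Qed.

Lemma ccontD f g t : ccont f t -> ccont g t -> ccont (fun t => f t + g t) t.
Proof.
move=> [f1 f2] [g1 g2]; split.
  rewrite (_ : Re \o _ = (fun x => (Re \o f) x + (Re \o g) x)).
    exact: continuousD.
  by apply/funext => x /=; rewrite reim.
rewrite (_ : Im \o _ = (fun x => (Im \o f) x + (Im \o g) x)).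
  exact: continuousD.
by apply/funext => x /=; rewrite reim.
Qed.

Lemma ccontM f g t : ccont f t -> ccont g t -> ccont (fun t => f t * g t) t.
Proof.
move=> [f1 f2] [g1 g2]; split.
  rewrite (_ : Re \o _ = (fun x => (Re \o f) x * (Re \o g) x -
     (Im \o f) x * (Im \o g) x)).
    by apply: continuousB; exact: continuousM.
  by apply/funext => x /=; rewrite reim.
rewrite (_ : Im \o _ = (fun x => (Re \o f) x * (Im \o g) x +
     (Im \o f) x * (Re \o g) x)).
  by apply: continuousD; exact: continuousM.
by apply/funext => x /=; rewrite reim.
Qed.

Lemma ccontB f g t : ccont f t -> ccont g t -> ccont (fun t => f t - g t) t.
Proof.
move=> cf cg; apply: (@ccont_ext (fun t => f t + -1 * g t)).
  by move=> x; rewrite mulN1r.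
exact (ccontD cf (ccontM (ccont_cst (-1) t) cg)).
Qed.

Lemma ccontX f t n : ccont f t -> ccont (fun t => f t ^+ n) t.
Proof.
move=> cf; elim: n => [|n IH]; first exact: ccont_cst.
by apply: (@ccont_ext (fun t => f t * f t ^+ n)); [move=> x; rewrite exprS|exact: ccontM].
Qed.

Lemma ccontV f t : f t != 0 -> ccont f t -> ccont (fun t => (f t)^-1) t.
Proof.
move=> f0 [f1 f2].
have n0 : (Re \o f) t * (Re \o f) t + (Im \o f) t * (Im \o f) t != 0.
  by rewrite -!expr2 -cmod_sqr expf_eq0/= cmod_eq0.
have cn : {for t, continuous (fun x => ((Re \o f) x * (Re \o f) x + (Im \o f) x * (Im \o f) x)^-1)}.
  by apply: continuousV => //; apply: continuousD; exact: continuousM.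
split.
  rewrite (_ : Re \o _ = (fun x => (Re \o f) x *
     ((Re \o f) x * (Re \o f) x + (Im \o f) x * (Im \o f) x)^-1)).
    exact: continuousM.
  by apply/funext => x; rewrite /= cReV.
rewrite (_ : Im \o _ = (fun x => - (Im \o f) x *
     ((Re \o f) x * (Re \o f) x + (Im \o f) x * (Im \o f) x)^-1)).
  by apply: continuousM => //; exact: continuousN.
by apply/funext => x; rewrite /= cImV.
Qed.

Lemma ccontJ f t : ccont f t -> ccont (fun t => conjc (f t)) t.
Proof.
move=> [f1 f2]; split.
  by rewrite (_ : Re \o _ = Re \o f)//; apply/funext => x /=; rewrite reim.
rewrite (_ : Im \o _ = - (Im \o f)); last by apply/funext => x /=; rewrite reim.
exact: continuousN.
Qed.

Definition plane (p : R * R) : R[i] := p.1 +i* p.2.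

(** The arguments of [phi] range over [R * R], the space on which plane
    integrals are taken, so that continuity yields measurability. *)
Definition ccontC (phi : R[i] -> R[i]) (z : R[i]) :=
  {for (Re z, Im z), continuous (Re \o phi \o plane)} /\
  {for (Re z, Im z), continuous (Im \o phi \o plane)}.

Lemma ccont_comp (phi : R[i] -> R[i]) g t :
  ccont g t -> ccontC phi (g t) -> ccont (fun t => phi (g t)) t.
Proof.
move=> [g1 g2] [c1 c2].
have cg : {for t, continuous (fun x => ((Re \o g) x, (Im \o g) x))}.
  exact: (cvg_pair g1 g2).
split.
  rewrite (_ : _ \o _ = (Re \o phi \o plane) \o
      (fun x => ((Re \o g) x, (Im \o g) x))).
    exact: (continuous_comp cg).
  by apply/funext => x /=; rewrite /plane/= -complexRI.
rewrite (_ : _ \o _ = (Im \o phi \o plane) \o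
      (fun x => ((Re \o g) x, (Im \o g) x))).
  exact: (continuous_comp cg).
by apply/funext => x /=; rewrite /plane/= -complexRI.
Qed.

End ComplexContinuity.

Lemma ccontCE {R : realType} (phi : R[i] -> R[i]) z :
  ccontC phi z = ccont (phi \o plane) (Re z, Im z).
Proof. by []. Qed.

Lemma ccont_plane {R : realType} (p : R * R) : ccont plane p.
Proof.
split.
  rewrite (_ : _ \o _ = fst); first exact: cvg_fst.
  by apply/funext => x.
rewrite (_ : _ \o _ = snd); first exact: cvg_snd.
by apply/funext => x.
Qed.

(** * Holomorphic functions, logarithm and powers *)

Section Holomorphic.
Context {R : realType}.
Implicit Types (z w : R[i]) (D : R[i] -> Prop) (phi : R[i] -> R[i]).

(** Complex differentiability in the form of a chain rule along differentiable
    paths: every derivative used below is taken with respect to a real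
    parameter, and holomorphic maps given in this way compose without any
    difference quotient. *)
Definition holo D phi phi' :=
  (forall (g : R -> R[i]) t d, D (g t) -> cder g t d ->
     cder (fun t => phi (g t)) t (phi' (g t) * d)) /\
  (forall z, D z -> ccontC phi z /\ ccontC phi' z).

Lemma holo_cst D c : holo D (fun=> c) (fun=> 0).
Proof.
split=> [g t d _ _|z _]; first by rewrite mul0r; exact: cder_cst.
by split; exact: ccont_cst.
Qed.

Lemma holo_id D : holo D id (fun=> 1).
Proof.
split=> [g t d _ gd|z _]; first by rewrite mul1r.
by split; [exact: ccont_plane|exact: ccont_cst].
Qed.

Lemma holoD D phi phi' psi psi' : holo D phi phi' -> holo D psi psi' ->
  holo D (fun z => phi z + psi z) (fun z => phi' z + psi' z).
Proof.
move=> [h1 h2] [k1 k2]; split=> [g t d Dg gd|z Dz].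
  by rewrite mulrDl; apply: cderD; [exact: h1|exact: k1].
have [a b] := h2 _ Dz; have [a' b'] := k2 _ Dz.
by split; exact: ccontD.
Qed.

Lemma holoZ D c phi phi' : holo D phi phi' ->
  holo D (fun z => c * phi z) (fun z => c * phi' z).
Proof.
move=> [h1 h2]; split=> [g t d Dg gd|z Dz].
  by rewrite -mulrA; apply: cderZ; exact: h1.
have [a b] := h2 _ Dz.
by split; apply: ccontM => //; exact: ccont_cst.
Qed.

Lemma holo_comp D E phi phi' psi psi' : holo D phi phi' -> holo E psi psi' ->
  (forall z, D z -> E (phi z)) ->
  holo D (fun z => psi (phi z)) (fun z => psi' (phi z) * phi' z).
Proof.
move=> [h1 h2] [k1 k2] DE; split=> [g t d Dg gd|z Dz].
  by rewrite -mulrA; apply: k1; [exact: DE|exact: h1].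
have [a b] := h2 _ Dz; have [a' b'] := k2 _ (DE _ Dz).
have zE : phi z = (phi \o plane) (Re z, Im z) by rewrite /= /plane/= -complexRI.
split.
  by apply: (@ccont_comp _ _ psi (phi \o plane)) => //; rewrite -zE.
apply: ccontM => //.
by apply: (@ccont_comp _ _ psi' (phi \o plane)) => //; rewrite -zE.
Qed.

Lemma cexpE z : cexp z = (expR (Re z) * cos (Im z)) +i* (expR (Re z) * sin (Im z)).
Proof. by case: z. Qed.

Lemma cexpD z w : cexp (z + w) = cexp z * cexp w.
Proof.
rewrite !cexpE; apply: complex_eqP; rewrite !reim expRD ?cosD ?sinD; ring.
Qed.

Lemma cexp0 : cexp (0 : R[i]) = 1.
Proof. by rewrite cexpE expR0 cos0 sin0 !mul1r. Qed.

Lemma cexpN z : cexp (- z) = (cexp z)^-1.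
Proof.
have h : cexp z * cexp (- z) = 1 by rewrite -cexpD subrr cexp0.
have n0 : cexp z != 0.
  by apply/eqP => e; move: h; rewrite e mul0r => /eqP; rewrite eq_sym oner_eq0.
by apply: (mulfI n0); rewrite h divff.
Qed.

Lemma cexp_neq0 z : cexp z != 0.
Proof.
apply/eqP => e; have := cexpD z (- z); rewrite subrr cexp0 e mul0r => /eqP.
by rewrite oner_eq0.
Qed.

Lemma cmod_cexp z : cmod (cexp z) = expR (Re z).
Proof.
rewrite cexpE cmodE !reim !exprMn -mulrDr cos2Dsin2 mulr1 sqrtr_sqr.
by rewrite ger0_norm ?expR_ge0.
Qed.

Lemma cexp_cder (g : R -> R[i]) t d : cder g t d ->
  cder (fun t => cexp (g t)) t (cexp (g t) * d).
Proof.
move=> [g1 g2].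
have e1 := is_derive1_comp (is_derive_expR _) g1.
have c1 := is_derive1_comp (is_derive_cos _) g2.
have s1 := is_derive1_comp (is_derive_sin _) g2.
split.
  rewrite (_ : _ \o _ = (expR \o (Re \o g)) * (cos \o (Im \o g))); last first.
    by apply/funext => x /=; rewrite cexpE.
  apply: is_derive_eq' (is_deriveM e1 c1) _.
  by rewrite cexpE !reim /GRing.scale/=; ring.
rewrite (_ : _ \o _ = (expR \o (Re \o g)) * (sin \o (Im \o g))); last first.
  by apply/funext => x /=; rewrite cexpE.
apply: is_derive_eq' (is_deriveM e1 s1) _.
by rewrite cexpE !reim /GRing.scale/=; ring.
Qed.

Lemma cont_comp (T : topologicalType) (f : R -> R) (g : T -> R) x :
  {for x, continuous g} -> {for g x, continuous f} -> {for x, continuous (f \o g)}.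
Proof. by move=> cg cf; exact: (continuous_comp cg). Qed.

Lemma cexp_ccont (T : topologicalType) (g : T -> R[i]) t :
  ccont g t -> ccont (fun t => cexp (g t)) t.
Proof.
move=> [g1 g2].
have e1 := cont_comp g1 (@continuous_expR R _).
have c1 := cont_comp g2 (@continuous_cos R _).
have s1 := cont_comp g2 (@continuous_sin R _).
split.
  rewrite (_ : _ \o _ = (fun x => (expR \o (Re \o g)) x * (cos \o (Im \o g)) x)).
    exact: continuousM.
  by apply/funext => x /=; rewrite cexpE.
rewrite (_ : _ \o _ = (fun x => (expR \o (Re \o g)) x * (sin \o (Im \o g)) x)).
  exact: continuousM.
by apply/funext => x /=; rewrite cexpE.
Qed.

Lemma holo_cexp D : holo D cexp cexp.
Proof.
split=> [g t d _|z _]; first exact: cexp_cder.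
by split; apply: cexp_ccont; exact: ccont_plane.
Qed.

(** A form of the principal logarithm of the right half-plane that has smooth
    coordinates; see [clogE]. *)
Definition Log w : R[i] := (ln (Re w ^+ 2 + Im w ^+ 2) / 2) +i* atan (Im w / Re w).

Definition right_half (w : R[i]) : Prop := 0 < Re w.

Lemma right_half_neq0 w : right_half w -> w != 0.
Proof. by move=> w0; apply/eqP => e; move: w0; rewrite e /right_half reim ltxx. Qed.

Lemma right_half_sqr_gt0 w : right_half w -> 0 < Re w ^+ 2 + Im w ^+ 2.
Proof. by move=> w0; rewrite ltr_pwDl ?exprn_gt0// sqr_ge0. Qed.

Lemma cos_sin_atan (y x : R) : 0 < x ->
  cos (atan (y / x)) = x / Num.sqrt (x ^+ 2 + y ^+ 2) /\
  sin (atan (y / x)) = y / Num.sqrt (x ^+ 2 + y ^+ 2).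
Proof.
move=> x0; have s0 : 0 < Num.sqrt (x ^+ 2 + y ^+ 2).
  by rewrite sqrtr_gt0 ltr_pwDl ?exprn_gt0// sqr_ge0.
have cE : cos (atan (y / x)) = x / Num.sqrt (x ^+ 2 + y ^+ 2).
  rewrite cos_atan (_ : 1 + _ = (x ^+ 2 + y ^+ 2) / x ^+ 2); last first.
    by field; rewrite gt_eqF.
  rewrite sqrtrM ?addr_ge0 ?sqr_ge0// sqrtrV ?sqr_ge0// sqrtr_sqr gtr0_norm//.
  by rewrite invfM invrK mulrC.
split => //.
have := atanK (y / x); rewrite /tan cE => h.
have c0 : x / Num.sqrt (x ^+ 2 + y ^+ 2) != 0 by rewrite gt_eqF// divr_gt0.
rewrite -[LHS](divfK c0) h; field.
by rewrite !gt_eqF.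
Qed.

(** On the right half-plane the arc cosine of [x / |w|] is the absolute value
    of the arc tangent of [y / x], both angles having the same cosine. *)
Lemma clogE w : right_half w -> clog w = Log w.
Proof.
case: w => x y; rewrite /right_half/= => x0.
have s0 : 0 < x ^+ 2 + y ^+ 2 by rewrite ltr_pwDl ?exprn_gt0// sqr_ge0.
rewrite /Log/=; congr (_ +i* _).
  by rewrite -[X in ln X / 2]sqr_sqrtr ?ltW// lnXn ?sqrtr_gt0// -[_ *+ 2]mulr_natr mulfK.
have [cE _] := cos_sin_atan y x0; rewrite -cE.
have := atan_gtNpi2 (y / x); have := atan_ltpi2 (y / x) => a1 a2.
have p0 := @pi_gt0 R.
case: leP => y0.
  have a0 : 0 <= atan (y / x).
    by rewrite -(@atan0 R); apply: le_atan; rewrite divr_ge0// ltW.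
  by rewrite cosK// in_itv/=; apply/andP; split => //; lra.
have a0 : atan (y / x) <= 0.
  by rewrite -(@atan0 R); apply: le_atan; rewrite pmulr_lle0 ?invr_gt0// ltW.
by rewrite cosKN ?opprK//; apply/andP; split => //; lra.
Qed.

Lemma cexp_Log w : right_half w -> cexp (Log w) = w.
Proof.
move=> w0; have s0 := right_half_sqr_gt0 w0; have [cE sE] := cos_sin_atan (Im w) w0.
rewrite cexpE /= cE sE.
have -> : expR (ln (Re w ^+ 2 + Im w ^+ 2) / 2) = Num.sqrt (Re w ^+ 2 + Im w ^+ 2).
  rewrite -[X in ln X](@sqr_sqrtr _ (Re w ^+ 2 + Im w ^+ 2)) ?ltW//.
  by rewrite lnXn ?sqrtr_gt0// -[_ *+ 2]mulr_natr mulfK// lnK// posrE sqrtr_gt0.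
by apply: complex_eqP => /=; field; rewrite gt_eqF// sqrtr_gt0.
Qed.

Lemma Im_Log_bound w : - (pi / 2) < Im (Log w) < pi / 2.
Proof. by rewrite atan_gtNpi2 atan_ltpi2. Qed.

Lemma Log_cder (g : R -> R[i]) t d : right_half (g t) -> cder g t d ->
  cder (fun t => Log (g t)) t ((g t)^-1 * d).
Proof.
move=> g0 [g1 g2]; have s0 := right_half_sqr_gt0 g0.
have r0 : Re (g t) != 0 by rewrite gt_eqF.
split.
  have n1 := is_deriveD (is_deriveM g1 g1) (is_deriveM g2 g2).
  have s0' : 0 < ((Re \o g) * (Re \o g) + (Im \o g) * (Im \o g)) t.
    by move: s0; rewrite !expr2.
  have l1 := is_derive1_comp (is_derive1_ln s0') n1.
  have l2 := is_deriveM l1 (is_derive_cst (2^-1 : R) t 1).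
  rewrite (_ : _ \o _ = (ln (R:=R) \o ((Re \o g) * (Re \o g) + (Im \o g) * (Im \o g))) * cst 2^-1).
    apply: is_derive_eq' l2 _.
    rewrite !reim cReV cImV /GRing.scale/= !fctE/=.
    move: s0; move: (Re (g t)) (Im (g t)) (Re d) (Im d) => a b u v s0.
    rewrite -!expr2.
    field.
    by rewrite gt_eqF.
  by apply/funext => x; rewrite /= !expr2.
have v1 := is_deriveM g2 (is_deriveV (f := Re \o g) r0 g1).
have a1 := is_derive1_comp (is_derive1_atan _) v1.
rewrite (_ : _ \o _ = atan \o ((Im \o g) * (fun y => ((Re \o g) y)^-1))).
  apply: is_derive_eq' a1 _.
  rewrite !reim cReV cImV /GRing.scale/= !fctE/=.
  move: s0 r0; move: (Re (g t)) (Im (g t)) (Re d) (Im d) => a b u v s0 r0.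
  field.
  by rewrite r0 gt_eqF.
by apply/funext => x.
Qed.

Lemma Log_ccont (T : topologicalType) (g : T -> R[i]) t : right_half (g t) ->
  ccont g t -> ccont (fun t => Log (g t)) t.
Proof.
move=> g0 [g1 g2]; have s0 := right_half_sqr_gt0 g0.
have r0 : Re (g t) != 0 by rewrite gt_eqF.
split.
  have n1 : {for t, continuous (fun x => (Re \o g) x * (Re \o g) x +
     (Im \o g) x * (Im \o g) x)} by apply: continuousD; exact: continuousM.
  have s0' : 0 < (Re \o g) t * (Re \o g) t + (Im \o g) t * (Im \o g) t.
    by move: s0; rewrite !expr2.
  have l1 := cont_comp n1 (continuous_ln s0').
  rewrite (_ : _ \o _ = (fun x => ln ((Re \o g) x * (Re \o g) x +
     (Im \o g) x * (Im \o g) x) * cst 2^-1 x)).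
    by apply: continuousM => //; exact: cst_continuous.
  by apply/funext => x; rewrite /= !expr2.
have v1 : {for t, continuous (fun x => (Im \o g) x * ((Re \o g) x)^-1)}.
  by apply: continuousM => //; exact: continuousV.
exact: (cont_comp v1 (@continuous_atan R _)).
Qed.

Lemma plane_ReIm z : plane (Re z, Im z) = z.
Proof. by rewrite /plane/= -complexRI. Qed.

Lemma holo_Log : holo right_half Log GRing.inv.
Proof.
split=> [g t d|z z0]; first exact: Log_cder.
split.
  apply: Log_ccont; last exact: ccont_plane.
  by rewrite plane_ReIm.
apply: ccontV; last exact: ccont_plane.
by rewrite plane_ReIm right_half_neq0.
Qed.

(** Half of the difference of the imaginary parts lies strictly between [- pi]
    and [pi], where the sine vanishes only at [0]. *)
Lemma cexp_inj_near z w : cexp z = cexp w -> `|Im z - Im w| < pi *+ 2 -> z = w.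
Proof.
move=> e lt; have : cexp (z - w) = 1 by rewrite cexpD cexpN e divff// cexp_neq0.
rewrite cexpE !reim => /[dup] /(congr1 Re) + /(congr1 Im); rewrite !reim.
move: lt; set x := Re z - Re w; set y := Im z - Im w => lt cE sE.
have ex0 := expR_gt0 x.
have s0 : sin y = 0 by apply/eqP; move/eqP: sE; rewrite mulf_eq0 gt_eqF.
have c1 : cos y = 1.
  have /eqP : cos y ^+ 2 = 1 by have := cos2Dsin2 y; rewrite s0 expr0n addr0.
  rewrite sqrf_eq1 => /orP[/eqP//|/eqP c]; move: cE; rewrite c; lra.
have x0 : x = 0 by move: cE; rewrite c1 mulr1 => /(congr1 (@ln R)); rewrite expRK ln1.
have h0 : sin (y / 2) = 0.
  have := cos_mulr2n (y / 2); rewrite -[_ *+ 2]mulr_natr divfK// c1 => h.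
  have := cos2Dsin2 (y / 2); move=> h2.
  apply/eqP; rewrite -sqrf_eq0; apply/eqP.
  move: h; rewrite mulr2n; lra.
have y0 : y = 0.
  have yb : -(pi *+ 2) < y < pi *+ 2 by rewrite -ltr_norml.
  have [yp|yn|//] := ltgtP y 0.
    have yi : 0 < - (y / 2) < pi.
      by move: yb; rewrite mulr2n => /andP[y1 y2]; apply/andP; split; lra.
    by have := sin_gt0_pi yi; rewrite sinN h0 oppr0 ltxx.
  have yi : 0 < y / 2 < pi.
    by move: yb; rewrite mulr2n => /andP[y1 y2]; apply/andP; split; lra.
  by have := sin_gt0_pi yi; rewrite h0 ltxx.
have xE : Re z = Re w by apply/eqP; rewrite -subr_eq0 -/x x0.
by apply: complex_eqP => //; apply/eqP; rewrite -subr_eq0 -/y y0.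
Qed.

(** The four arguments lie in [(- pi / 2, pi / 2)], so the two sides differ in
    their imaginary parts by less than [2 pi], and they have the same
    exponential. *)
Lemma Log_mul3 a b c d : right_half a -> right_half b -> right_half c ->
  right_half d -> a * b * c = d -> Log a + Log b + Log c = Log d.
Proof.
move=> a0 b0 c0 d0 e; apply: cexp_inj_near.
  by rewrite !cexpD !cexp_Log.
rewrite !cImD; have := Im_Log_bound a; have := Im_Log_bound b.
have := Im_Log_bound c; have := Im_Log_bound d => /andP[? ?] /andP[? ?] /andP[? ?] /andP[? ?].
by rewrite ltr_norml mulr2n; apply/andP; split; lra.
Qed.

Definition Pow w (s : R) : R[i] := cexp (s%:C * Log w).

Lemma cpowE w s : right_half w -> cpow w s = Pow w s.
Proof. by move=> w0; rewrite /cpow clogE. Qed.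

Lemma Pow_mul3 a b c d s : right_half a -> right_half b -> right_half c ->
  right_half d -> a * b * c = d -> Pow a s * Pow b s * Pow c s = Pow d s.
Proof.
by move=> a0 b0 c0 d0 e; rewrite /Pow -(Log_mul3 a0 b0 c0 d0 e) !mulrDr !cexpD.
Qed.

Lemma Pow1 s : Pow 1 s = 1.
Proof.
by rewrite /Pow /Log !reim expr1n expr0n addr0 ln1 !mul0r atan0 mulr0 cexp0.
Qed.

Lemma PowN w s : Pow w (- s) = (Pow w s)^-1.
Proof. by rewrite /Pow rmorphN mulNr cexpN. Qed.

Lemma holo_Pow s : holo right_half (Pow^~ s) (fun w => s%:C * Pow w s / w).
Proof.
have := holo_comp (holoZ s%:C holo_Log) (@holo_cexp (fun=> True)) (fun _ _ => I).
by congr holo; apply/funext => w; rewrite /Pow; ring.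
Qed.

End Holomorphic.

(** * Complex-valued integrals *)

Section ComplexIntegral.
Context d (T : measurableType d) {R : realType} (m : {measure set T -> \bar R}).
Implicit Types (D : set T) (f g : T -> R[i]).

Definition cmeasurable D f :=
  measurable_fun D (Re \o f) /\ measurable_fun D (Im \o f).

Definition cintegrable D f :=
  m.-integrable D (EFin \o (Re \o f)) /\ m.-integrable D (EFin \o (Im \o f)).

Definition cint D f : R[i] :=
  (\int[m]_(x in D) Re (f x)) +i* (\int[m]_(x in D) Im (f x)).

Lemma cint_eq D f g : (forall x, D x -> f x = g x) -> cint D f = cint D g.
Proof.
by move=> fg; rewrite /cint; congr (_ +i* _); apply: eq_Rintegral => x;
  rewrite inE => Dx; rewrite fg.
Qed.

Lemma integrable_ext D (f g : T -> R) : measurable D ->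
  (forall x, D x -> f x = g x) ->
  m.-integrable D (EFin \o f) -> m.-integrable D (EFin \o g).
Proof.
by move=> mD fg; apply: eq_integrable => // x; rewrite inE => Dx /=; rewrite fg.
Qed.

Lemma cintegrable_ext D f g : measurable D -> (forall x, D x -> f x = g x) ->
  cintegrable D f -> cintegrable D g.
Proof.
by move=> mD fg [f1 f2]; split;
  [apply: integrable_ext f1|apply: integrable_ext f2] => // x Dx /=; rewrite fg.
Qed.

Lemma cintegrableS D E f : measurable D -> measurable E -> E `<=` D ->
  cintegrable D f -> cintegrable E f.
Proof. by move=> mD mE ED [f1 f2]; split; apply: integrableS ED _. Qed.

Lemma rintegrableD D (f g : T -> R) : measurable D -> m.-integrable D (EFin \o f) ->
  m.-integrable D (EFin \o g) -> m.-integrable D (EFin \o (fun x => f x + g x)).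
Proof. by move=> mD f1 g1; exact: (integrableD mD f1 g1). Qed.

Lemma rintegrableZ D c (f : T -> R) : measurable D -> m.-integrable D (EFin \o f) ->
  m.-integrable D (EFin \o (fun x => c * f x)).
Proof. by move=> mD f1; exact: (integrableZl mD c f1). Qed.

Lemma rintegrableB D (f g : T -> R) : measurable D -> m.-integrable D (EFin \o f) ->
  m.-integrable D (EFin \o g) -> m.-integrable D (EFin \o (fun x => f x - g x)).
Proof. by move=> mD f1 g1; exact: (integrableB mD f1 g1). Qed.

Lemma cintegrableD D f g : measurable D -> cintegrable D f -> cintegrable D g ->
  cintegrable D (fun x => f x + g x).
Proof.
move=> mD [f1 f2] [g1 g2]; split.
  by apply: integrable_ext (rintegrableD mD f1 g1) => // x _ /=; rewrite reim.
by apply: integrable_ext (rintegrableD mD f2 g2) => // x _ /=; rewrite reim.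
Qed.

Lemma cintD D f g : measurable D -> cintegrable D f -> cintegrable D g ->
  cint D (fun x => f x + g x) = cint D f + cint D g.
Proof.
move=> mD [f1 f2] [g1 g2]; apply: complex_eqP; rewrite !reim.
  by rewrite -RintegralD//; apply: eq_Rintegral => x _; rewrite reim.
by rewrite -RintegralD//; apply: eq_Rintegral => x _; rewrite reim.
Qed.

Lemma cintegrableZ D c f : measurable D -> cintegrable D f ->
  cintegrable D (fun x => c * f x).
Proof.
move=> mD [f1 f2]; split.
  apply: integrable_ext (rintegrableB mD (rintegrableZ (Re c) mD f1)
     (rintegrableZ (Im c) mD f2)) => // x _ /=; by rewrite reim.
apply: integrable_ext (rintegrableD mD (rintegrableZ (Re c) mD f2)
   (rintegrableZ (Im c) mD f1)) => // x _ /=; by rewrite reim.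
Qed.

Lemma cintZ D c f : measurable D -> cintegrable D f ->
  cint D (fun x => c * f x) = c * cint D f.
Proof.
move=> mD [f1 f2]; apply: complex_eqP; rewrite !reim.
  rewrite -!RintegralZl// -RintegralB//; try exact: rintegrableZ.
  by apply: eq_Rintegral => x _; rewrite reim.
rewrite -!RintegralZl// -RintegralD//; try exact: rintegrableZ.
by apply: eq_Rintegral => x _; rewrite reim.
Qed.

Lemma cintegrableB D f g : measurable D -> cintegrable D f -> cintegrable D g ->
  cintegrable D (fun x => f x - g x).
Proof.
move=> mD fi gi; apply: (@cintegrable_ext _ (fun x => f x + -1 * g x)) => //.
  by move=> x _; rewrite mulN1r.
by apply: cintegrableD => //; exact: cintegrableZ.
Qed.

Lemma cintB D f g : measurable D -> cintegrable D f -> cintegrable D g ->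
  cint D (fun x => f x - g x) = cint D f - cint D g.
Proof.
move=> mD fi gi; rewrite -mulN1r -cintZ// -cintD//; last exact: cintegrableZ.
by apply: cint_eq => x _; rewrite mulN1r.
Qed.

Lemma integrable0 D : m.-integrable D (EFin \o (fun=> 0 : R)).
Proof.
rewrite (_ : EFin \o _ = cst 0%E)//.
exact: lebesgue_integrable.integrable0.
Qed.

Lemma cintegrable_sum D (F : nat -> T -> R[i]) N : measurable D ->
  (forall n, cintegrable D (F n)) ->
  cintegrable D (fun x => \sum_(n < N) F n x) /\
  cint D (fun x => \sum_(n < N) F n x) = \sum_(n < N) cint D (F n).
Proof.
move=> mD Fi; elim: N => [|N [IH1 IH2]].
  split.
    split; apply: integrable_ext (integrable0 D) => // x _ /=; by rewrite big_ord0.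
  rewrite big_ord0; apply: complex_eqP => /=.
    under eq_Rintegral => x _ do rewrite big_ord0.
    by rewrite /Rintegral integral0.
  under eq_Rintegral => x _ do rewrite big_ord0.
  by rewrite /Rintegral integral0.
split.
  apply: cintegrable_ext (cintegrableD mD IH1 (Fi N)) => // x _.
  by rewrite big_ord_recr.
rewrite big_ord_recr/= -IH2 -cintD//; apply: cint_eq => x _.
by rewrite big_ord_recr.
Qed.

Lemma cintegrable_dom D f (g : T -> R) : measurable D -> cmeasurable D f ->
  (forall x, D x -> cmod (f x) <= g x) -> m.-integrable D (EFin \o g) ->
  cintegrable D f.
Proof.
move=> mD [f1 f2] fg gi; split; apply: le_integrable gi => //.
- exact/measurable_EFinP.
- move=> x Dx /=; rewrite lee_fin (le_trans (Re_le_cmod _))//.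
  by rewrite (le_trans (fg _ Dx))// ler_norm.
- exact/measurable_EFinP.
- move=> x Dx /=; rewrite lee_fin (le_trans (Im_le_cmod _))//.
  by rewrite (le_trans (fg _ Dx))// ler_norm.
Qed.

Lemma cmod_cint_le D f (g : T -> R) : measurable D -> cintegrable D f ->
  (forall x, D x -> cmod (f x) <= g x) -> m.-integrable D (EFin \o g) ->
  cmod (cint D f) <= 2 * \int[m]_(x in D) g x.
Proof.
move=> mD [f1 f2] fg gi; rewrite (le_trans (cmod_le _))//= mulrDl mul1r.
apply: lerD; (apply: le_trans; first by apply: le_normr_Rintegral => //).
  apply: le_Rintegral => //; first exact: (integrable_norm f1).
  by move=> x Dx; rewrite (le_trans (Re_le_cmod _))// fg.
apply: le_Rintegral => //; first exact: (integrable_norm f2).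
by move=> x Dx; rewrite (le_trans (Im_le_cmod _))// fg.
Qed.

Lemma cint_exhaust_eq0 D (E : (set T)^nat) f (u : nat -> R) : measurable D ->
  (forall n, measurable (E n)) -> (forall n, E n `<=` D) ->
  (forall x, D x -> \forall n \near \oo, E n x) ->
  cintegrable D f -> (forall n, cmod (cint (E n) f) <= u n) ->
  u n @[n --> \oo] --> (0 : R) -> cint D f = 0.
Proof.
move=> mD mE ED cE [i1 i2] le_u lim.
have aux (g : T -> R) : m.-integrable D (EFin \o g) ->
   (forall n, `|\int[m]_(x in E n) g x| <= u n) -> \int[m]_(x in D) g x = 0.
  move=> gi gu; have h := cvg_Rintegral_exhaust mD mE ED cE gi.
  have h0 : \int[m]_(x in E n) g x @[n --> \oo] --> (0 : R).
    apply/norm_cvg0P; apply: (@squeeze_cvgr _ _ _ _ (fun=> 0) u) => //.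
    - by apply: nearW => n; rewrite normr_ge0 gu.
    - exact: cvg_cst.
  by rewrite -(cvg_lim (@Rhausdorff R) h) (cvg_lim (@Rhausdorff R) h0).
apply: complex_eqP; apply: aux => // n.
  exact: le_trans (Re_le_cmod _) (le_u n).
exact: le_trans (Im_le_cmod _) (le_u n).
Qed.

End ComplexIntegral.

Section ComplexIntegralReal.
Context {R : realType}.
Local Notation mu := (@lebesgue_measure R).

Lemma ccont_cmeasurable (A : set R) (f : R -> R[i]) : measurable A ->
  (forall x, A x -> ccont f x) -> cmeasurable A f.
Proof.
move=> mA cf; split; apply: continuous_at_measurable => // x Ax;
 by have [] := cf _ Ax.
Qed.

Lemma ccont_cmeasurable_prod (A : set (R * R)) (f : R * R -> R[i]) : measurable A ->
  (forall x, A x -> ccont f x) -> cmeasurable A f.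
Proof.
move=> mA cf; split; apply: continuous_at_measurable_prod => // x Ax;
 by have [] := cf _ Ax.
Qed.

Lemma cintegrable_itv (a b : R) (f : R -> R[i]) :
  (forall x, a <= x <= b -> ccont f x) -> cintegrable mu `[a, b] f.
Proof.
move=> cf; split; apply: continuous_compact_integrable => //;
  try exact: segment_compact;
  apply: continuous_in_subspaceT => x; rewrite inE /= in_itv/= => ab;
  by have [] := cf _ ab.
Qed.

Lemma cFTC2 (F f : R -> R[i]) (a b : R) : a < b ->
  (forall x, a <= x <= b -> cder F x (f x)) ->
  (forall x, a <= x <= b -> ccont f x) ->
  cint mu `[a, b] f = F b - F a.
Proof.
move=> ab dF cf.
have e1 : (\int[mu]_(x in `[a, b]) ((Re \o f) x)%:E = (Re (F b) - Re (F a))%:E)%E.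
  apply: (@FTC2_everywhere _ (Re \o F) (Re \o f)) => // x ax.
    by have [] := dF _ ax.
  by have [] := cf _ ax.
have e2 : (\int[mu]_(x in `[a, b]) ((Im \o f) x)%:E = (Im (F b) - Im (F a))%:E)%E.
  apply: (@FTC2_everywhere _ (Im \o F) (Im \o f)) => // x ax.
    by have [] := dF _ ax.
  by have [] := cf _ ax.
by apply: complex_eqP; rewrite !reim /Rintegral ?e1 ?e2.
Qed.

End ComplexIntegralReal.

Section ComplexHomotopy.
Context d (T : measurableType d) {R : realType}
  (m : {sigma_finite_measure set T -> \bar R}).
Local Notation mu := (@lebesgue_measure R).

Lemma cint_homotopy (D : set T) (P : R -> T -> R[i]) (W : R * T -> R[i]) :
  measurable D ->
  cintegrable (mu \x m)%E (`]0, 1[%classic `*` D) W ->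
  (forall t (s : R), D t -> 0 <= s <= 1 -> cder (P ^~ t) s (W (s, t))) ->
  (forall t (s : R), D t -> 0 <= s <= 1 -> ccont (fun s => W (s, t)) s) ->
  (forall s : R, 0 < s < 1 -> cintegrable m D (fun t => W (s, t)) /\
     cint m D (fun t => W (s, t)) = 0) ->
  cintegrable m D (P 0) -> cintegrable m D (P 1) ->
  cint m D (P 1) = cint m D (P 0).
Proof.
move=> mD [iW1 iW2] dP cW W0 [i01 i02] [i11 i12].
apply: complex_eqP.
  apply: (@Rintegral_homotopy _ T R m D (fun s t => Re (P s t)) (Re \o W)) => //.
  - by move=> t s Dt s01; have [] := dP t s Dt s01.
  - by move=> t s Dt s01; have [] := cW t s Dt s01.
  - move=> s s01; have [[w1 _] /(congr1 Re)] := W0 s s01.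
    rewrite reim/= /Rintegral => e.
    by rewrite -[LHS]fineK ?integrable_fin_num// e.
apply: (@Rintegral_homotopy _ T R m D (fun s t => Im (P s t)) (Im \o W)) => //.
- by move=> t s Dt s01; have [] := dP t s Dt s01.
- by move=> t s Dt s01; have [] := cW t s Dt s01.
- move=> s s01; have [[_ w1] /(congr1 Im)] := W0 s s01.
  rewrite reim/= /Rintegral => e.
  by rewrite -[LHS]fineK ?integrable_fin_num// e.
Qed.

End ComplexHomotopy.

(** * Rotations of the plane preserve area *)

Section PlaneMeasure.
Context {R : realType}.
Local Notation mu := (@lebesgue_measure R).
Local Notation mu2 := (mu \x mu)%E.

Lemma measurable_shift (c : R) : measurable_fun [set: R] (fun x : R => x + c).
Proof. by apply: measurable_funD => //; exact: measurable_cst. Qed.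

Lemma lebesgue_shift (c : R) (A : set R) : measurable A ->
  mu [set x | A (x + c)] = mu A.
Proof.
move=> mA.
suff : pushforward mu ((fun x => x + c) : _ -> measurableTypeR R) A = mu A by [].
apply/esym/lebesgue_measure_unique => //=; first exact: measurable_shift.
move=> _ _ [[a b]] _ <-.
rewrite /pushforward (_ : _ @^-1` _ = `]a - c, b - c]%classic); last first.
  by apply/seteqP; split => x; rewrite /= !in_itv/= => /andP[? ?]; apply/andP; split; lra.
rewrite !lebesgue_measure_itv/= !lte_fin.
rewrite (_ : (a - c < b - c) = (a < b)); last by apply/idP/idP; lra.
by case: ifP => // _; rewrite -!EFinD; congr EFin; lra.
Qed.

Definition area_preserving (f : R * R -> R * R) :=
  measurable_fun setT f /\ forall A, measurable A -> mu2 (f @^-1` A) = mu2 A.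

Lemma area_preserving_comp f g : area_preserving f -> area_preserving g -> area_preserving (f \o g).
Proof.
move=> [mf fE] [mg gE]; split; first exact: measurableT_comp.
move=> A mA; rewrite comp_preimage gE ?fE//.
by rewrite -[X in measurable X]setTI; exact: mf.
Qed.

Lemma area_preserving_shear_y (c : R) : area_preserving (fun z => (z.1, z.2 + c * z.1)).
Proof.
have mf : measurable_fun setT (fun z : R * R => (z.1, z.2 + c * z.1)).
  apply/measurable_fun_pairP; split => /=; first exact: measurable_fst.
  apply: measurable_funD; first exact: measurable_snd.
  by apply: measurable_funM; [exact: measurable_cst|exact: measurable_fst].
split=> // A mA; rewrite /product_measure1; apply: eq_integral => x _ /=.
rewrite -(@lebesgue_shift (c * x) (xsection A x)); last exact: measurable_xsection.
by congr (mu _); apply/seteqP; split => y /=; rewrite /xsection/= !inE.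
Qed.

Lemma product_measure12E A : measurable A -> mu2 A = (mu \x^ mu)%E A.
Proof.
by move=> mA; apply: product_measure_unique => //= X Y mX mY; rewrite product_measure2E.
Qed.

Lemma area_preserving_shear_x (c : R) : area_preserving (fun z => (z.1 + c * z.2, z.2)).
Proof.
have mf : measurable_fun setT (fun z : R * R => (z.1 + c * z.2, z.2)).
  apply/measurable_fun_pairP; split => /=; last exact: measurable_snd.
  apply: measurable_funD; first exact: measurable_fst.
  by apply: measurable_funM; [exact: measurable_cst|exact: measurable_snd].
split=> // A mA; rewrite !product_measure12E//; last by rewrite -[X in measurable X]setTI; exact: mf.
rewrite /product_measure2; apply: eq_integral => y _ /=.
rewrite -(@lebesgue_shift (c * y) (ysection A y)); last exact: measurable_ysection.
by congr (mu _); apply/seteqP; split => x /=; rewrite /ysection/= !inE.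
Qed.

Definition rotation (t : R) (z : R * R) : R * R :=
  (cos t * z.1 - sin t * z.2, sin t * z.1 + cos t * z.2).

(** A rotation of angle [t] is a product of three shears, of slopes [- tan (t
    / 2)], [sin t] and [- tan (t / 2)], and shears preserve area by Fubini and
    translation invariance. The restriction on [t] keeps the tangent finite. *)
Lemma area_preserving_rotation (t : R) : 0 < t < pi -> area_preserving (rotation t).
Proof.
move=> /andP[t0 tpi]; set c := - tan (t / 2).
have c0 : cos (t / 2) != 0.
  by rewrite gt_eqF// cos_gt0_pihalf//; apply/andP; split; have := @pi_gt0 R; lra.
suff -> : rotation t = (fun z => (z.1 + c * z.2, z.2)) \o
    (fun z => (z.1, z.2 + sin t * z.1)) \o (fun z => (z.1 + c * z.2, z.2)).
  apply: area_preserving_comp; last exact: area_preserving_shear_x.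
  by apply: area_preserving_comp; [exact: area_preserving_shear_x|exact: area_preserving_shear_y].
have tE : t = (t / 2) *+ 2 by rewrite -mulr_natr divfK.
have sE : sin t = 2 * (cos (t / 2) * sin (t / 2)).
  by rewrite {1}tE sin_mulr2n mulr2n; ring.
have cE : cos t = 1 - 2 * sin (t / 2) ^+ 2.
  by rewrite {1}tE cos_mulr2n cos2sin2 mulr2n; ring.
apply/funext => -[x y]; rewrite /rotation/= sE cE /c /tan.
have := cos2Dsin2 (t / 2).
move: (cos (t / 2)) (sin (t / 2)) c0 => C S C0 CS.
congr (_, _); last by field.
apply/eqP; rewrite -subr_eq0; apply/eqP.
transitivity (y * (2 * S / C) * (1 - (C ^+ 2 + S ^+ 2))); first by field.
by rewrite CS subrr mulr0.
Qed.

Lemma area_preserving_integral (f : R * R -> R * R) (D : set (R * R)) (g : R * R -> R) :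
  area_preserving f -> measurable D -> f @^-1` D = D -> measurable_fun D g ->
  \int[mu2]_(z in D) g (f z) = \int[mu2]_(z in D) g z.
Proof.
move=> [mf fE] mD fD mg.
pose G := (EFin \o g) \_ D.
have mG : measurable_fun setT G.
  by apply/(measurable_restrictT _ mD)/measurable_EFinP.
have ge0 (H : R * R -> \bar R) : measurable_fun setT H -> (forall z, 0 <= H z)%E ->
    (\int[mu2]_z H (f z) = \int[mu2]_z H z)%E.
  move=> mH H0.
  pose T2 := (measurableTypeR R * measurableTypeR R)%type.
  have := @ge0_integral_pushforward _ _ T2 T2 R f mf
    (mu2 : {measure set T2 -> \bar R}) setT H measurableT mH (fun z _ => H0 z).
  rewrite preimage_setT => <-; apply: eq_measure_integral => A mA _.
  exact: fE.
rewrite /Rintegral; congr fine.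
transitivity (\int[mu2]_z G (f z))%E.
  rewrite integral_mkcond; apply: eq_integral => z _; rewrite /G !patchE.
  by have -> : (f z \in D) = (z \in f @^-1` D) by []; rewrite fD.
transitivity (\int[mu2]_z G z)%E; last by rewrite [RHS]integral_mkcond.
rewrite [LHS]integralE [RHS]integralE; congr (_ - _)%E.
  rewrite -[RHS]ge0; first by apply: eq_integral => z _; rewrite !funeposE.
    exact: measurable_funepos.
  by move=> z; exact: funepos_ge0.
rewrite -[RHS]ge0; first by apply: eq_integral => z _; rewrite !funenegE.
  exact: measurable_funeneg.
by move=> z; exact: funeneg_ge0.
Qed.

End PlaneMeasure.

(** * Area of discs *)

Section DiscArea.
Context {R : realType}.
Local Notation mu := (@lebesgue_measure R).
Local Notation mu2 := (mu \x mu)%E.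

Lemma cos2x (x : R) : cos (2 * x) = 2 * cos x ^+ 2 - 1.
Proof. by rewrite mulr_natl cos_mulr2n mulr2n; ring. Qed.

(** Substitute [x = s sin t]. *)
Lemma half_disc_integral (s : R) : 0 < s ->
  (\int[mu]_(x in `[(- s)%R, s]) (2 * Num.sqrt (s ^+ 2 - x ^+ 2))%:E = (pi * s ^+ 2)%:E)%E.
Proof.
move=> s0; have p0 := @pi_gt0 R.
pose F (t : R) := s * sin t.
pose G (x : R) := 2 * Num.sqrt (s ^+ 2 - x ^+ 2).
have dF (t : R) : is_derive t 1 F (s * cos t).
  have := is_deriveM (is_derive_cst s t 1) (is_derive_sin t).
  move=> h; apply: is_derive_eq' h _; by rewrite /GRing.scale/= mulr0 addr0.
have F1 : derive1 F = (fun t => s * cos t).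
  by apply/funext => t; rewrite derive1E; apply: derive_val; exact: dF.
have cF' : continuous (fun t : R => s * cos t).
  move=> t; apply: continuousM; first exact: cst_continuous.
  exact: continuous_cos.
have cF : continuous F by move=> t; apply: is_derive_continuous; exact: dF.
have Fb : F (pi / 2) = s by rewrite /F sin_pihalf mulr1.
have Fa : F (- (pi / 2)) = - s by rewrite /F sinN sin_pihalf mulrN1.
have := @integration_by_substitution_increasing R F G (- (pi / 2)) (pi / 2).
rewrite Fa Fb F1 => -> //.
- transitivity (\int[mu]_(x in `[(- (pi / 2))%R, (pi / 2)%R])
     (s ^+ 2 * (1 + cos (2 * x)))%:E)%E.
    apply: eq_integral => t; rewrite inE/= in_itv/= => tb; congr EFin.
    rewrite fctE/= /G /F exprMn -{1}[s ^+ 2]mulr1 -mulrBr -cos2sin2.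
    rewrite sqrtrM ?sqr_ge0// !sqrtr_sqr (ger0_norm (ltW s0)) ger0_norm ?cos_ge0_pihalf//.
    by rewrite cos2x; ring.
  pose H (x : R) := s ^+ 2 * (x + sin x * cos x).
  transitivity ((H (pi / 2) - H (- (pi / 2)))%:E).
    apply: (@FTC2_everywhere _ H (fun x => s ^+ 2 * (1 + cos (2 * x)))).
  + lra.
  + move=> x _.
    have h1 := is_deriveD (is_derive_id x 1) (is_deriveM (is_derive_sin x) (is_derive_cos x)).
    have h2 := is_deriveM (is_derive_cst (s ^+ 2) x 1) h1.
    apply: is_derive_eq' h2 _.
    rewrite /GRing.scale/= mulr0 addr0 cos2x.
    have e := cos2Dsin2 x.
    have -> : sin x * - sin x = cos x ^+ 2 - 1 by rewrite -e; ring.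
    ring.
  + move=> x _; apply: continuousM; first exact: cst_continuous.
    apply: continuousD; first exact: cst_continuous.
    apply: cont_comp; last exact: continuous_cos.
    by apply: continuousM => //; exact: cst_continuous.
  rewrite /H cosN sinN cos_pihalf !mulr0 !addr0; congr EFin; field.
- lra.
- lra.
- by move=> x y xI yI xy; rewrite /F ltr_pM2l// ltr_sin//; move: xI yI; rewrite !in_itv.
- by apply/cvg_ex; eexists; apply: cvg_at_right_filter; exact: cF'.
- by apply/cvg_ex; eexists; apply: cvg_at_left_filter; exact: cF'.
- split.
  + by move=> x _; apply: ex_derive; exact: dF.
  + by apply: cvg_at_right_filter; exact: cF.
  + by apply: cvg_at_left_filter; exact: cF.
- apply: continuous_subspaceT => x.
  apply: (@continuousM _ _ (fun=> 2) (fun x : R => Num.sqrt (s ^+ 2 - x ^+ 2)) x); first exact: cst_continuous.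
  apply: cont_comp; last exact: sqrt_continuous.
  apply: continuousB; first exact: cst_continuous.
  exact: exprn_continuous.
Qed.

Lemma disc_area (u : R) : 0 <= u ->
  mu2 [set z | z.1 ^+ 2 + z.2 ^+ 2 <= u] = (pi * u)%:E.
Proof.
move=> u0.
have secE (x : R) : mu (xsection [set z | z.1 ^+ 2 + z.2 ^+ 2 <= u] x) =
    (2 * Num.sqrt (u - x ^+ 2))%:E.
  have [ux|xu] := ltP u (x ^+ 2).
    rewrite (_ : xsection _ _ = set0) ?measure0.
      by rewrite ler0_sqrtr ?mulr0// subr_le0 ltW.
    apply/seteqP; split => // y; rewrite /xsection/= inE/=.
    by move=> h; have := sqr_ge0 y; lra.
  rewrite (_ : xsection _ _ =
      `[(- Num.sqrt (u - x ^+ 2))%R, Num.sqrt (u - x ^+ 2)]%classic).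
    rewrite lebesgue_measure_itv/= lte_fin.
    have s0 := sqrtr_ge0 (u - x ^+ 2).
    case: ltP => h; first by rewrite -EFinD; congr EFin; lra.
    by congr EFin; lra.
  apply/seteqP; split => y; rewrite /xsection/= inE/= in_itv/= -ler_norml.
    move=> h; rewrite -sqrtr_sqr ler_wsqrtr//; lra.
  rewrite -[X in X <= _]ger0_norm ?normr_ge0// => h.
  have : `|y| ^+ 2 <= Num.sqrt (u - x ^+ 2) ^+ 2.
    by rewrite ler_pXn2r// ?nnegrE ?sqrtr_ge0//; rewrite normr_id in h.
  by rewrite sqr_sqrtr ?subr_ge0// real_normK ?num_real//; lra.
transitivity (\int[mu]_x (2 * Num.sqrt (u - x ^+ 2))%:E)%E.
  by apply: eq_integral => x _; rewrite /= secE.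
move: u0; rewrite le_eqVlt => /predU1P[<-|u0].
  rewrite mulr0; apply: integral0_eq => x _; congr EFin.
  by rewrite ler0_sqrtr ?mulr0// sub0r oppr_le0 sqr_ge0.
have s0 : 0 < Num.sqrt u by rewrite sqrtr_gt0.
have := half_disc_integral s0; rewrite sqr_sqrtr ?ltW// => <-.
rewrite [RHS]integral_mkcond; apply: eq_integral => x _; rewrite patchE.
case: ifPn => //; rewrite notin_setE/= in_itv/= => h.
rewrite ler0_sqrtr ?mulr0// subr_le0 leNgt; apply/negP => xu; apply: h.
rewrite -ler_norml -sqrtr_sqr ler_wsqrtr// ltW//.
Qed.

Definition sqnorm (z : R * R) : R := z.1 ^+ 2 + z.2 ^+ 2.

Lemma sqnorm_ge0 z : 0 <= sqnorm z.
Proof. by rewrite addr_ge0// sqr_ge0. Qed.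

Lemma measurable_sqnorm : measurable_fun setT (sqnorm : _ -> measurableTypeR R).
Proof.
apply: measurable_funD; apply: measurable_funX.
  exact: measurable_fst.
exact: measurable_snd.
Qed.

Lemma disc_measurable (u : R) : measurable [set z | sqnorm z <= u].
Proof.
rewrite (_ : [set _ | _] = sqnorm @^-1` `]-oo, u]); last first.
  by apply/seteqP; split => z /=; rewrite in_itv.
by rewrite -[X in measurable X]setTI; apply: measurable_sqnorm => //; exact: measurable_itv.
Qed.

Lemma annulus_area (a b : R) : 0 <= a -> a <= b ->
  mu2 [set z | a < sqnorm z <= b] = (pi * (b - a))%:E.
Proof.
move=> a0 ab.
rewrite (_ : [set _ | _] = [set z | sqnorm z <= b] `\` [set z | sqnorm z <= a]).
  rewrite measureD//=; [|exact: disc_measurable|exact: disc_measurable|].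
    rewrite (_ : _ `&` _ = [set z | sqnorm z <= a]).
      by rewrite !disc_area ?(le_trans a0)// -EFinB mulrBr.
    by apply/seteqP; split => z /= => [[]//|h]; split => //; exact: le_trans ab.
  by rewrite disc_area ?(le_trans a0)// ltry.
apply/seteqP; split => z /=.
  by move=> /andP[h1 h2]; split => //; apply/negP; rewrite -ltNge.
by move=> [h1 /negP]; rewrite -ltNge => ->.
Qed.

End DiscArea.

(** * Radial integration *)

Section RadialIntegral.
Context {R : realType}.
Local Notation mu := (@lebesgue_measure R).
Local Notation mu2 := (mu \x mu)%E.

(** The image of the plane measure under the squared norm, divided by [pi],
    agrees with length on the intervals of the nonnegative half-line, by
    [disc_area]. Length on the negative half-line is added to it so that the
    uniqueness of Lebesgue measure on the whole line applies. *)
Lemma radial_measure (A : set R) : measurable A -> A `<=` `[0, +oo[ ->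
  mu2 (@sqnorm R @^-1` A) = (pi%:E * mu A)%E.
Proof.
move=> mA A0.
have piV0 : 0 <= (pi : R)^-1 by rewrite invr_ge0 pi_ge0.
pose T2 := (measurableTypeR R * measurableTypeR R)%type.
pose m1 : {measure set (measurableTypeR R) -> \bar R} :=
  mscale (NngNum piV0) (pushforward (mu2 : {measure set T2 -> \bar R}) (sqnorm : T2 -> measurableTypeR R)).
pose N : set R := [set x | x < 0].
have NE : N = `]-oo, (0:R)[%classic by apply/seteqP; split => x; rewrite /N/= in_itv.
have mN : measurable N by rewrite NE; exact: measurable_itv.
pose m := measure_add (m1 (@measurable_sqnorm R)) (mrestr mu mN).
have mE X : m X = ((pi^-1)%:E * mu2 (@sqnorm R @^-1` X) + mu (X `&` N))%E.
  by rewrite /m measure_addE.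
have p0 := @pi_gt0 R.
have pV (x : R) : ((pi^-1)%:E * (pi * x)%:E = x%:E)%E.
  by rewrite -EFinM mulrA mulVf ?mul1r// gt_eqF.
have e : mu A = m A.
  apply: lebesgue_measure_unique => //.
  move=> _ [[a b]] _ <-.
  change (mu `]a, b]%classic = m `]a, b]%classic); rewrite mE.
  have [ba|ab] := leP b a.
    have -> : `]a, b]%classic = set0 :> set R by rewrite set_itv_ge// bnd_simp -leNgt.
    by rewrite preimage_set0 set0I !measure0 mule0 adde0.
  have muab : mu `]a, b]%classic = (b - a)%:E.
    by rewrite lebesgue_measure_itv/= lte_fin ab EFinB.
  have [b0|b0] := ltP b 0.
    rewrite (_ : _ @^-1` _ = set0); last first.
      apply/seteqP; split => // z; rewrite /= in_itv/= => /andP[_ zb].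
      by have := sqnorm_ge0 z; rewrite leNgt (le_lt_trans zb b0).
    rewrite measure0 mule0 add0e; congr (mu _); apply/esym/setIidl => x.
    by rewrite /= in_itv/= => /andP[_ xb]; exact: le_lt_trans b0.
  have [a0|a0] := leP 0 a.
    rewrite (_ : _ @^-1` _ = [set z | a < sqnorm z <= b]); last first.
      by apply/seteqP; split => z /=; rewrite in_itv.
    rewrite (annulus_area a0 (ltW ab)) pV (_ : _ `&` _ = set0) ?measure0 ?adde0//.
    apply/seteqP; split => // x []; rewrite /N/= in_itv/= => /andP[ax _] x0.
    by move: (lt_trans (le_lt_trans a0 ax) x0); rewrite ltxx.
  rewrite (_ : _ @^-1` _ = [set z | z.1 ^+ 2 + z.2 ^+ 2 <= b]); last first.
    apply/seteqP; split => z /=; rewrite in_itv/=; first by case/andP.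
    by move=> zb; rewrite zb andbT (lt_le_trans a0)// sqnorm_ge0.
  rewrite disc_area// pV.
  rewrite (_ : `]a, b]%classic `&` N = `]a, (0:R)[%classic); last first.
    apply/seteqP; split => x; rewrite /N/= !in_itv/=.
      by move=> [/andP[-> _] ->].
    by move=> /andP[ax x0]; rewrite ax x0 (le_trans (ltW x0)).
  by rewrite muab lebesgue_measure_itv/= lte_fin a0 -EFinB -EFinD; congr EFin; lra.
rewrite e mE (_ : A `&` N = set0) ?measure0 ?adde0.
  by rewrite muleA -EFinM divff ?mul1e// gt_eqF.
apply/seteqP; split => // x [/A0]; rewrite /N/= in_itv/= andbT => x0 /lt_geF.
by rewrite x0.
Qed.

Lemma radial_integral (D : set R) (h : R -> \bar R) : measurable D ->
  D `<=` `[0, +oo[ -> measurable_fun D h -> (forall x, D x -> 0 <= h x)%E ->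
  (\int[mu2]_(z in @sqnorm R @^-1` D) h (sqnorm z) = pi%:E * \int[mu]_(u in D) h u)%E.
Proof.
move=> mD D0 mh h0.
have pi0 : 0 <= (pi : R) by exact: pi_ge0.
pose T2 := (measurableTypeR R * measurableTypeR R)%type.
have := @ge0_integral_pushforward _ _ T2 (measurableTypeR R) R (@sqnorm R)
  (@measurable_sqnorm R) (mu2 : {measure set T2 -> \bar R}) D h mD mh.
move=> <-; last by move=> x; rewrite inE; exact: h0.
transitivity (\int[mscale (NngNum pi0) (mu : {measure set (measurableTypeR R) -> \bar R})]_(y in D) h y)%E.
  apply: eq_measure_integral; first exact: measurable_sqnorm.
  by move=> mf A mA AD; exact: (radial_measure mA (subset_trans AD D0)).
by rewrite ge0_integral_mscale.
Qed.

End RadialIntegral.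

(** * Beta moments *)

Section BetaMoments.
Context {R : realType}.
Local Notation mu := (@lebesgue_measure R).

Lemma is_derive_powR (a x : R) : 0 < x ->
  is_derive x 1 (fun y : R => y `^ a) (a * x `^ (a - 1)).
Proof.
move=> x0; have xI : x \in `]0, +oo[ by rewrite in_itv/= x0.
apply: DeriveDef; first exact: derivable_powR.
by rewrite -derive1E powR_derive1.
Qed.

Lemma continuous_powR (a x : R) : 0 < x -> {for x, continuous (fun y : R => y `^ a)}.
Proof. by move=> x0; apply: is_derive_continuous; exact: is_derive_powR. Qed.

Variables (c alpha : R).
Hypotheses (c0 : 0 < c) (alpha0 : 0 < alpha).

(** For [c = r^2], the density of the image of the weighted measure of the
    disc of radius [r] under the squared norm. *)
Definition beta_density (u : R) : R := alpha / c * (1 - u / c) `^ (alpha - 1).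
Local Notation g := beta_density.

(* The density may blow up at [c], so integrals over [[0, c[] are limits of
   integrals over [[0, b k]], where [b k] is such that
   [(1 - b k / c)^alpha = 1 / (k + 2)]. *)
Let e (k : nat) : R := (k.+2%:R^-1) `^ (alpha^-1).
Let b (k : nat) : R := c * (1 - e k).

Let k0 k : 0 < (k.+2%:R : R)^-1. Proof. by rewrite invr_gt0 ltr0n. Qed.
Let e_gt0 k : 0 < e k. Proof. exact: powR_gt0. Qed.
Let eK k : e k `^ alpha = k.+2%:R^-1.
Proof. by rewrite /e -powRrM mulVf ?gt_eqF// powRr1// ltW. Qed.
Let e_lt1 k : e k < 1.
Proof.
have <- : (1 : R) `^ (alpha^-1) = 1 by rewrite powR1.
rewrite /e gt0_ltr_powR ?invr_gt0 ?nnegrE ?ler01 ?(ltW (k0 k))//.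
by rewrite invf_lt1 ?ltr0n// ltr1n.
Qed.
Let b_gt0 k : 0 < b k. Proof. by rewrite mulr_gt0// subr_gt0. Qed.
Let b_ltc k : b k < c.
Proof. by rewrite /b -[ltRHS]mulr1 ltr_pM2l// gtrBl. Qed.
Let bE k : 1 - b k / c = e k.
Proof. by rewrite /b; field; rewrite gt_eqF. Qed.

Let b_cover u : 0 <= u < c -> \forall k \near \oo, `[0, b k]%classic u.
Proof.
move=> /andP[u0 uc].
have d0 : 0 < (1 - u / c) by rewrite subr_gt0 ltr_pdivrMr ?mul1r.
have p0 : 0 < (1 - u / c) `^ alpha by exact: powR_gt0.
near=> k; rewrite /= in_itv/= u0/=.
have h : e k <= 1 - u / c.
  rewrite leNgt; apply/negP => lt.
  have : (1 - u / c) `^ alpha < e k `^ alpha.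
    by rewrite gt0_ltr_powR ?nnegrE ?(ltW d0) ?(ltW (e_gt0 k)).
  rewrite eK ltNge; apply/negP; rewrite negbK.
  rewrite invf_ple ?posrE ?ltr0n//.
  near: k; exists (Num.truncn ((1 - u / c) `^ alpha)^-1) => // k /= hk.
  rewrite (le_trans (ltW (truncnS_gt _)))// ler_nat; exact: leq_trans hk _.
have -> : u = c * (1 - (1 - u / c)) by field; rewrite gt_eqF.
by rewrite ler_pM2l// lerD2l lerN2.
Unshelve. all: by end_near. Qed.

Let b_nd : nondecreasing_seq (fun k => `[0, b k]%classic : set R).
Proof.
move=> k l kl; apply/subsetPset => x; rewrite /= !in_itv/= => /andP[-> /=] xb.
apply: le_trans xb _; rewrite ler_pM2l// lerD2l lerN2.
rewrite ge0_ler_powR ?invr_ge0 ?(ltW alpha0) ?nnegrE ?(ltW (k0 _))//.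
by rewrite lef_pV2 ?posrE ?ltr0n// ler_nat !ltnS.
Qed.

Let b_sub k : `[0, b k]%classic `<=` (`[0, c[%classic : set R).
Proof.
by move=> x; rewrite /= !in_itv/= => /andP[-> /=] xb; exact: le_lt_trans (b_ltc k).
Qed.

Let bU : \bigcup_k `[0, b k]%classic = `[0, c[%classic :> set R.
Proof.
apply/seteqP; split => x; first by move=> [k _]; exact: b_sub.
rewrite /= in_itv/= => /b_cover[k _ /(_ k (leqnn k))]; by exists k.
Qed.

Lemma beta_density_gt0 u : u < c -> 0 < g u.
Proof.
move=> uc; rewrite mulr_gt0 ?divr_gt0// powR_gt0//.
by rewrite subr_gt0 ltr_pdivrMr ?mul1r.
Qed.

Let dpow u : u < c -> is_derive u 1 (fun u : R => (1 - u / c) `^ alpha) (- g u).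
Proof.
move=> uc; have h0 : 0 < 1 - u / c by rewrite subr_gt0 ltr_pdivrMr ?mul1r.
have dl : is_derive u 1 (fun u : R => 1 - u / c) (- c^-1).
  have := is_deriveB (is_derive_cst (1 : R) u 1) (is_deriveM (is_derive_id u 1) (is_derive_cst c^-1 u 1)).
  by move=> h; apply: is_derive_eq' h _; rewrite /GRing.scale/= mulr0 mulr1 !add0r.
have h := @is_derive1_comp R (fun y : R => y `^ alpha) (fun u : R => 1 - u / c)
  u _ _ (is_derive_powR alpha h0) dl.
apply: is_derive_eq' h _.
by rewrite /g; field; rewrite gt_eqF.
Qed.

Lemma continuous_beta_density u : u < c -> {for u, continuous g}.
Proof.
move=> uc; have h0 : 0 < 1 - u / c by rewrite subr_gt0 ltr_pdivrMr ?mul1r.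
apply: continuousM; first exact: cst_continuous.
apply: (@cont_comp R R (fun y : R => y `^ (alpha - 1)) (fun u : R => 1 - u / c)).
  apply: continuousB; first exact: cst_continuous.
  by apply: continuousM => //; exact: cst_continuous.
exact: continuous_powR.
Qed.

Let measurable_g : measurable_fun (`[0, c[%classic : set R) g.
Proof.
apply: continuous_at_measurable; first exact: measurable_itv.
by move=> x; rewrite /= in_itv/= => /andP[_ xc]; exact: continuous_beta_density.
Qed.

Lemma integral_beta_density : (\int[mu]_(u in `[0%R, c[) (g u)%:E = 1)%E.
Proof.
have h : (\int[mu]_(u in `[0%R, b i]) (g u)%:E @[i --> \oo] -->
    \int[mu]_(u in \bigcup_i `[0%R, b i]%classic) (g u)%:E)%E.
  apply: ge0_nondecreasing_set_cvg_integral => //.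
  - move=> k; apply/measurable_EFinP; apply: measurable_funS measurable_g.
      exact: measurable_itv.
    exact: b_sub.
  - move=> k x; rewrite /= in_itv/= => /andP[_ xb]; rewrite lee_fin ltW//.
    by apply: beta_density_gt0; exact: le_lt_trans (b_ltc k).
rewrite bU in h; move/cvg_lim : h => <- //; apply/cvg_lim => //.
have E k : (\int[mu]_(u in `[0%R, b k]) (g u)%:E = (1 - k.+2%:R^-1)%:E)%E.
  transitivity ((- (1 - b k / c) `^ alpha - - (1 - 0 / c) `^ alpha)%:E).
    apply: (@FTC2_everywhere _ (fun u => - (1 - u / c) `^ alpha)) => //.
    - move=> u /andP[_ ub]; apply: is_derive_eq' (is_deriveN (dpow (le_lt_trans ub (b_ltc k)))) _.
      by rewrite opprK.
    - by move=> u /andP[_ ub]; apply: continuous_beta_density; exact: le_lt_trans (b_ltc k).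
  by rewrite bE eK mul0r subr0 powR1 opprK addrC.
under eq_fun do rewrite E.
apply: cvg_EFin; first exact: nearW.
rewrite (_ : _ \o _ = (fun k => 1 - k.+2%:R^-1))//.
rewrite -[X in _ --> X]subr0; apply: cvgB; first exact: cvg_cst.
have := @cvg_harmonic R; rewrite -(cvg_shiftS (@harmonic R)).
by [].
Qed.

Lemma integrable_beta_moment n :
  mu.-integrable `[0, c[ (EFin \o (fun u => u ^+ n * g u)).
Proof.
have ig : mu.-integrable `[0, c[ (EFin \o g).
  apply/integrableP; split; first exact/measurable_EFinP.
  rewrite (_ : (\int[mu]_(x in _) _)%E = (\int[mu]_(u in `[0%R, c[) (g u)%:E)%E).
    by rewrite integral_beta_density ltry.
  apply: eq_integral => x; rewrite inE/= in_itv/= => /andP[_ xc].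
  by rewrite ger0_norm// ltW// beta_density_gt0.
have mD : measurable (`[0, c[%classic : set R) by exact: measurable_itv.
apply: (@le_integrable _ _ _ mu _ mD _ (EFin \o (fun u => c ^+ n * g u))).
- apply/measurable_EFinP; apply: measurable_funM => //.
- move=> x; rewrite /= in_itv/= => /andP[x0 xc]; rewrite lee_fin !normrM.
  rewrite ler_wpM2r// !normrX lerXn2r ?nnegrE//.
  by rewrite !ger0_norm// ltW.
- exact: rintegrableZ.
Qed.

Definition beta_moment n : R := \int[mu]_(u in `[0, c[) (u ^+ n * g u).

Lemma beta_moment0 : beta_moment 0 = 1.
Proof.
rewrite /beta_moment /Rintegral.
by under eq_integral do rewrite expr0 mul1r; rewrite integral_beta_density.
Qed.

(** The derivative of [u^(n+1) (1 - u/c)^alpha], which vanishes at both ends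
    of [[0, c]], is a combination of the two integrands. *)
Lemma beta_momentS n :
  (n.+1%:R + alpha) * beta_moment n.+1 = c * n.+1%:R * beta_moment n.
Proof.
pose F u := u ^+ n.+1 * (1 - u / c) `^ alpha.
pose f u := alpha^-1 * (c * n.+1%:R) * (u ^+ n * g u) -
            alpha^-1 * (n.+1%:R + alpha) * (u ^+ n.+1 * g u).
have powE u : u < c -> (1 - u / c) `^ alpha = (1 - u / c) * (c / alpha) * g u.
  move=> uc; have h0 : 0 < 1 - u / c by rewrite subr_gt0 ltr_pdivrMr ?mul1r.
  rewrite -(mulr_powRB1 (ltW h0) alpha0) /g.
  by field; rewrite !gt_eqF.
have dF u : u < c -> is_derive u 1 F (f u).
  move=> uc.
  have dX : is_derive u 1 (fun u : R => u ^+ n.+1) (n.+1%:R * u ^+ n).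
    have h := is_deriveX n.+1 (is_derive_id u (1 : R)).
    rewrite (_ : (fun u : R => u ^+ n.+1) = id ^+ n.+1); last first.
      by apply/funext => x; rewrite exprfctE.
    by apply: is_derive_eq' h _; rewrite /GRing.scale/= mulr1.
  apply: is_derive_eq' (is_deriveM dX (dpow uc)) _.
  rewrite /GRing.scale/= powE// /f !exprS.
  by field; rewrite !gt_eqF.
have cf u : u < c -> {for u, continuous f}.
  move=> uc; have cg := continuous_beta_density uc.
  have cm m : {for u, continuous (fun u : R => u ^+ m * g u)}.
    by apply: continuousM => //; exact: exprn_continuous.
  by apply: continuousB; apply: continuousM => //; exact: cst_continuous.
have mD : measurable (`[0, c[%classic : set R) by exact: measurable_itv.
have i1 : mu.-integrable `[0, c[ (EFin \o (fun u : R => alpha^-1 * (c * n.+1%:R) * (u ^+ n * g u))).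
  by apply: rintegrableZ => //; exact: integrable_beta_moment.
have i2 : mu.-integrable `[0, c[ (EFin \o (fun u : R => alpha^-1 * (n.+1%:R + alpha) * (u ^+ n.+1 * g u))).
  by apply: rintegrableZ => //; exact: integrable_beta_moment.
have fi : mu.-integrable `[0, c[ (EFin \o f).
  exact: rintegrableB.
have lim : \int[mu]_(u in `[0, b k]) f u @[k --> \oo] --> \int[mu]_(u in `[0, c[) f u.
  exact: cvg_Rintegral_exhaust.
have fE k : \int[mu]_(u in `[0, b k]) f u = (b k) ^+ n.+1 * k.+2%:R^-1.
  rewrite /Rintegral.
  have -> : (\int[mu]_(u in `[0%R, b k]) (f u)%:E = (F (b k) - F 0)%:E)%E.
    apply: FTC2_everywhere => // u /andP[_ ub].
      by apply: dF; exact: le_lt_trans (b_ltc k).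
    by apply: cf; exact: le_lt_trans (b_ltc k).
  by rewrite /= /F bE eK expr0n mul0r subr0.
have lim0 : \int[mu]_(u in `[0, b k]) f u @[k --> \oo] --> (0 : R).
  under eq_fun do rewrite fE.
  apply: (@squeeze_cvgr _ _ _ _ (fun=> 0) (fun k => c ^+ n.+1 * k.+2%:R^-1)).
  - near=> k; rewrite mulr_ge0 ?exprn_ge0 ?(ltW (b_gt0 k)) ?(ltW (k0 k))//=.
    by rewrite ler_wpM2r ?(ltW (k0 k))// lerXn2r ?nnegrE ?(ltW c0) ?(ltW (b_gt0 k)) ?(ltW (b_ltc k)).
  - exact: cvg_cst.
  - rewrite -[X in _ --> X](mulr0 (c ^+ n.+1)); apply: cvgM; first exact: cvg_cst.
    by have := @cvg_harmonic R; rewrite -(cvg_shiftS (@harmonic R)).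
have e0 : \int[mu]_(u in `[0, c[) f u = 0.
  by rewrite -(cvg_lim _ lim)// (cvg_lim _ lim0).
move: e0; rewrite /f RintegralB//.
rewrite !RintegralZl//; try exact: integrable_beta_moment.
rewrite -/(beta_moment n) -/(beta_moment n.+1) -!mulrA -mulrBr => /eqP.
rewrite mulf_eq0 invr_eq0 gt_eqF//= subr_eq0 => /eqP <-.
by rewrite mulrA.
Unshelve. all: by end_near. Qed.

End BetaMoments.

(** * The weighted measure of a disc *)

Section DiscIntegrals.
Context {R : realType}.
Local Notation mu := (@lebesgue_measure R).
Local Notation mu2 := (mu \x mu)%E.

Definition disc (s : R) : set (R * R) := [set z | sqnorm z < s ^+ 2].

Lemma discE s : disc s = @sqnorm R @^-1` `[0, s ^+ 2[.
Proof.
by apply/seteqP; split => z; rewrite /disc/= in_itv/= sqnorm_ge0.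
Qed.

Lemma measurable_disc s : measurable (disc s).
Proof.
rewrite discE -[X in measurable X]setTI; apply: measurable_sqnorm => //.
Qed.

Lemma subset_disc s s' : 0 <= s <= s' -> disc s `<=` disc s'.
Proof.
move=> /andP[s0 ss'] z; rewrite /disc/= => h; apply: lt_le_trans h _.
by rewrite lerXn2r// nnegrE// (le_trans s0).
Qed.

Lemma cmod_plane_sqr (z : R * R) : cmod (plane z) ^+ 2 = sqnorm z.
Proof. by rewrite cmod_sqr. Qed.

Lemma disc_cmod s (z : R * R) : 0 <= s -> disc s z <-> cmod (plane z) < s.
Proof.
move=> s0; rewrite /disc/= -cmod_plane_sqr.
by rewrite ltr_pXn2r ?nnegrE ?cmod_ge0.
Qed.

Lemma continuous_sqnorm (z : R * R) : {for z, continuous (@sqnorm R)}.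
Proof.
apply: continuousD; apply: (@cont_comp R _ (fun x : R => x ^+ 2)).
- exact: cvg_fst.
- exact: exprn_continuous.
- exact: cvg_snd.
- exact: exprn_continuous.
Qed.

Definition unit_circle (t : R) : R[i] := cexp (0 +i* t).
Local Notation e := unit_circle.

Lemma unit_circleE t : e t = cos t +i* sin t.
Proof. by rewrite /e cexpE !reim expR0 !mul1r. Qed.

Lemma unit_circleD s t : e (s + t) = e s * e t.
Proof.
rewrite /e -cexpD; congr cexp; apply: complex_eqP; rewrite !reim//.
by rewrite addr0.
Qed.

Lemma unit_circle0 : e 0 = 1. Proof. exact: cexp0. Qed.

Lemma unit_circleX t n : e t ^+ n = e (n%:R * t).
Proof.
elim: n => [|n IH]; first by rewrite mul0r unit_circle0.
by rewrite exprS IH -unit_circleD mulrS mulrDl mul1r.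
Qed.

Lemma unit_circleJ t : conjc (e t) = e (- t).
Proof. by rewrite !unit_circleE cosN sinN. Qed.

Lemma cmod_unit_circle t : cmod (e t) = 1.
Proof. by rewrite /e cmod_cexp reim expR0. Qed.

Lemma unit_circle_neq0 t : e t != 0. Proof. exact: cexp_neq0. Qed.

Lemma plane_rot t (z : R * R) : plane (rotation t z) = e t * plane z.
Proof.
rewrite unit_circleE; apply: complex_eqP; rewrite !reim /plane /rotation /=; ring.
Qed.

Lemma sqnorm_rot t (z : R * R) : sqnorm (rotation t z) = sqnorm z.
Proof. by rewrite -!cmod_plane_sqr plane_rot cmodM cmod_unit_circle mul1r. Qed.

Lemma disc_rot t s : rotation t @^-1` disc s = disc s.
Proof. by apply/seteqP; split => z; rewrite /disc/= sqnorm_rot. Qed.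

Lemma cint_rot t s (F : R * R -> R[i]) : 0 < t < pi -> cmeasurable (disc s) F ->
  cint mu2 (disc s) (fun z => F (rotation t z)) = cint mu2 (disc s) F.
Proof.
move=> t0 [m1 m2]; have mD := measurable_disc s.
by rewrite /cint; congr (_ +i* _);
  [apply: (@area_preserving_integral R (rotation t) (disc s) (fun z => Re (F z)))|
   apply: (@area_preserving_integral R (rotation t) (disc s) (fun z => Im (F z)))] => //;
  (exact: area_preserving_rotation || exact: disc_rot).
Qed.

Variables (r alpha : R).
Hypotheses (r0 : 0 < r) (alpha0 : 0 < alpha).

Definition weight (z : R * R) : R :=
  alpha / (pi * r ^+ 2) * (1 - sqnorm z / r ^+ 2) `^ (alpha - 1).

Let r2 : 0 < r ^+ 2. Proof. exact: exprn_gt0. Qed.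

Lemma weightE z : weight z = pi^-1 * beta_density (r ^+ 2) alpha (sqnorm z).
Proof.
rewrite /weight /beta_density [RHS]mulrA; congr (_ * _).
by rewrite invfM mulrCA.
Qed.

Lemma weight_gt0 z : disc r z -> 0 < weight z.
Proof.
move=> Dz; rewrite weightE mulr_gt0 ?invr_gt0 ?pi_gt0//.
exact: beta_density_gt0.
Qed.

Lemma continuous_weight z : disc r z -> {for z, continuous weight}.
Proof.
move=> Dz; rewrite (_ : weight = fun z => pi^-1 * beta_density (r ^+ 2) alpha (sqnorm z)).
  apply: continuousM; first exact: cst_continuous.
  apply: cont_comp; first exact: continuous_sqnorm.
  exact: continuous_beta_density.
by apply/funext => x; rewrite weightE.
Qed.

Lemma sqnorm_moment n :
  mu2.-integrable (disc r) (EFin \o (fun z => sqnorm z ^+ n * weight z)) /\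
  \int[mu2]_(z in disc r) (sqnorm z ^+ n * weight z) = beta_moment (r ^+ 2) alpha n.
Proof.
pose h (u : R) := (pi^-1 * (u ^+ n * beta_density (r ^+ 2) alpha u))%:E.
have ib := integrable_beta_moment r2 alpha0 n.
have mD : measurable (`[0, r ^+ 2[%classic : set R) by exact: measurable_itv.
have ib' : mu.-integrable `[0, r ^+ 2[ h by exact: rintegrableZ.
have e : (\int[mu2]_(z in disc r) (sqnorm z ^+ n * weight z)%:E =
    (beta_moment (r ^+ 2) alpha n)%:E)%E.
  transitivity (\int[mu2]_(z in @sqnorm R @^-1` `[0%R, (r ^+ 2)%R[) h (sqnorm z))%E.
    rewrite discE; apply: eq_integral => z _; rewrite /h weightE; congr EFin.
    by rewrite mulrCA.
  rewrite radial_integral//; last 3 first.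
  - by move=> x; rewrite /= !in_itv/= => /andP[->].
  - exact: measurable_int ib'.
  - move=> x; rewrite /= in_itv/= => /andP[x0 xr]; rewrite lee_fin.
    rewrite mulr_ge0 ?invr_ge0 ?pi_ge0// mulr_ge0 ?exprn_ge0//.
    by rewrite ltW// beta_density_gt0.
  have -> : (\int[mu]_(u in `[0%R, (r ^+ 2)%R[) h u = (pi^-1)%:E *
      \int[mu]_(u in `[0%R, (r ^+ 2)%R[) (u ^+ n * beta_density (r ^+ 2) alpha u)%:E)%E.
    by rewrite /h; under eq_integral do rewrite EFinM; rewrite integralZl.
  rewrite muleA -EFinM divff ?mul1e ?gt_eqF ?pi_gt0//.
  by rewrite /beta_moment /Rintegral fineK//; exact: integrable_fin_num.
split; last by rewrite /Rintegral e.
apply/integrableP; split.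
  apply/measurable_EFinP; apply: continuous_at_measurable_prod; first exact: measurable_disc.
  move=> z Dz; apply: continuousM; last exact: continuous_weight.
  by apply: (@cont_comp R _ (fun x : R => x ^+ n)); [exact: continuous_sqnorm|exact: exprn_continuous].
rewrite (_ : (\int[_]_(x in _) _)%E = (beta_moment (r ^+ 2) alpha n)%:E) ?ltry// -e.
apply: eq_integral => z; rewrite inE => Dz /=.
by rewrite ger0_norm// mulr_ge0 ?exprn_ge0 ?sqnorm_ge0// ltW// weight_gt0.
Qed.

Lemma beta_moment_gt0 n : 0 < beta_moment (r ^+ 2) alpha n.
Proof.
elim: n => [|n IH]; first by rewrite beta_moment0.
have h := beta_momentS r2 alpha0 n.
have p : 0 < (n.+1%:R : R) + alpha by rewrite addr_gt0.
by rewrite -(pmulr_rgt0 _ p) h !mulr_gt0// ltr0n.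
Qed.

Lemma integrable_weight : mu2.-integrable (disc r) (EFin \o weight).
Proof.
have [h _] := sqnorm_moment 0; apply: integrable_ext h; first exact: measurable_disc.
by move=> z _; rewrite mul1r.
Qed.

Lemma cintegrable_monomial s n m : 0 <= s <= r ->
  cintegrable mu2 (disc s)
    (fun z => conjc (plane z) ^+ n * plane z ^+ m * (weight z)%:C).
Proof.
move=> /andP[s0 sr]; set F := (fun z => _ : R[i]).
suff h : cintegrable mu2 (disc r) F.
  apply: cintegrableS h; [exact: measurable_disc|exact: measurable_disc|].
  by apply: subset_disc; rewrite s0.
apply: (@cintegrable_dom _ _ R mu2 (disc r) F (fun z => r ^+ (n + m) * weight z)).
- exact: measurable_disc.
- apply: ccont_cmeasurable_prod; first exact: measurable_disc.
  move=> z Dz; apply: ccontM; last by apply: ccont_real; exact: continuous_weight.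
  by apply: ccontM; apply: ccontX; [apply: ccontJ|]; exact: ccont_plane.
- move=> z Dz; rewrite !cmodM !cmodX cmodJ -exprD cmod_real.
  rewrite gtr0_norm ?weight_gt0// ler_wpM2r ?(ltW (weight_gt0 Dz))//.
  rewrite lerXn2r ?nnegrE ?cmod_ge0 ?(ltW r0)//.
  by apply/ltW/disc_cmod => //; exact: ltW.
- by apply: rintegrableZ; [exact: measurable_disc|exact: integrable_weight].
Qed.

(** For [k = |n - m|], the rotation of angle [pi / (2 k)] preserves the
    measure and multiplies the integrand by [i] or [- i]; so the integral is
    [i] or [- i] times itself. *)
Lemma monomial_orthogonal s n m : 0 <= s <= r -> n != m ->
  cint mu2 (disc s)
    (fun z => conjc (plane z) ^+ n * plane z ^+ m * (weight z)%:C) = 0.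
Proof.
move=> sr nm; set F := (fun z => _ : R[i]).
have iF : cintegrable mu2 (disc s) F by exact: cintegrable_monomial.
have mF : cmeasurable (disc s) F.
  by case: iF => i1 i2; split; apply/measurable_EFinP;
     [exact: measurable_int i1|exact: measurable_int i2].
have [k [k0 kE]] : exists k : nat, (0 < k)%N /\ ((n = m + k)%N \/ (m = n + k)%N).
  move: nm; rewrite neq_ltn => /orP[lt|lt].
    by exists (m - n)%N; rewrite subn_gt0; split => //; right; rewrite subnKC// ltnW.
  by exists (n - m)%N; rewrite subn_gt0; split => //; left; rewrite subnKC// ltnW.
have kR : 0 < (k%:R : R) by rewrite ltr0n.
have p0 := @pi_gt0 R.
(* the k-th power of the rotation by t is a quarter turn *)
pose t : R := pi / 2 / k%:R.
have t0 : 0 < t < pi.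
  rewrite /t divr_gt0 ?divr_gt0//= ltr_pdivrMr//.
  have : 1 <= (k%:R : R) by rewrite ler1n.
  by move=> k1; nra.
have kt : k%:R * t = pi / 2 by rewrite /t mulrC divfK ?gt_eqF.
have ek : e t ^+ k = 'i%C by rewrite unit_circleX kt unit_circleE cos_pihalf sin_pihalf.
have ekJ : e (- t) ^+ k = - 'i%C.
  by rewrite -unit_circleJ -rmorphXn /= ek; apply: complex_eqP; rewrite !reim ?oppr0.
have ee : e (- t) * e t = 1 by rewrite -unit_circleD addNr unit_circle0.
have [c cE c1] : exists2 c : R[i], e (- t) ^+ n * e t ^+ m = c & c != 1.
  case: kE => ->.
    exists (- 'i%C); last by apply/eqP => /(congr1 Re); rewrite !reim => /eqP; rewrite oppr0 eq_sym oner_eq0.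
    by rewrite exprD mulrAC -exprMn ee expr1n mul1r ekJ.
  exists 'i%C; last by apply/eqP => /(congr1 Re); rewrite !reim => /eqP; rewrite eq_sym oner_eq0.
  by rewrite exprD mulrA -exprMn ee expr1n mul1r ek.
have h := cint_rot t0 mF.
have : cint mu2 (disc s) (fun z => F (rotation t z)) = c * cint mu2 (disc s) F.
  transitivity (cint mu2 (disc s) (fun z => c * F z)); last first.
    exact (@cintZ _ _ R mu2 (disc s) c F (measurable_disc s) iF).
  apply: cint_eq => z _; rewrite /F plane_rot conjcM unit_circleJ !exprMn.
  rewrite (_ : weight (rotation t z) = weight z); last by rewrite /weight sqnorm_rot.
  by rewrite -cE; ring.
rewrite h => /eqP; rewrite -subr_eq0 -{1}[cint _ _ _]mul1r -mulrBl mulf_eq0.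
by rewrite subr_eq0 eq_sym (negbTE c1)/= => /eqP.
Qed.

End DiscIntegrals.

(** * Bounds on compact sets and geometric decay *)

Section CompactBounds.
Context {R : realType}.
Local Notation mu := (@lebesgue_measure R).

Lemma ccont_bounded (T : topologicalType) (K : set T) (f : T -> R[i]) :
  compact K -> (forall x, K x -> ccont f x) ->
  exists2 M, 0 <= M & forall x, K x -> cmod (f x) <= M.
Proof.
move=> cK cf.
have bnd (g : T -> R) : (forall x, K x -> {for x, continuous g}) ->
    exists M, forall x, K x -> `|g x| <= M.
  move=> cg; have cg' : {within K, continuous g}.
    by apply: continuous_in_subspaceT => x; rewrite inE; exact: cg.
  have [M [_ hM]] := compact_bounded (continuous_compact cg' cK).
  exists (M + 1) => x Kx; apply: hM; first by rewrite ltrDl.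
  by exists x.
have [M1 h1] := bnd (Re \o f) (fun x Kx => proj1 (cf x Kx)).
have [M2 h2] := bnd (Im \o f) (fun x Kx => proj2 (cf x Kx)).
exists (`|M1| + `|M2|); first by rewrite addr_ge0.
move=> x Kx; apply: le_trans (cmod_le _) _.
by apply: lerD; [apply: le_trans (h1 _ Kx) _|apply: le_trans (h2 _ Kx) _]; exact: ler_norm.
Qed.

Lemma cintegrable_rectangle (a b : R) (f : R * R -> R[i]) : a < b ->
  (forall s t, 0 <= s <= 1 -> a <= t <= b -> ccont f (s, t)) ->
  cintegrable (mu \x mu)%E (`]0, 1[%classic `*` `[a, b]%classic) f.
Proof.
move=> ab cf.
have mD : measurable (`]0, 1[%classic `*` `[a, b]%classic : set (R * R)).
  by apply: measurableX; exact: measurable_itv.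
have cK : compact (`[0, 1]%classic `*` `[a, b]%classic : set (R * R)).
  by apply: compact_setX; exact: segment_compact.
have [|M M0 hM] := ccont_bounded cK (f := f).
  by move=> [s t] [/=]; rewrite !in_itv/=; exact: cf.
have sub : (`]0, 1[%classic `*` `[a, b]%classic : set (R * R)) `<=` `[0, 1]%classic `*` `[a, b]%classic.
  move=> [s t] [/=]; rewrite !in_itv/= => /andP[s0 s1] ->; split => //=.
  by rewrite !ltW.
pose A1 : set R := `]0, 1[%classic.
pose A2 : set R := `[a, b]%classic.
have fin : ((mu \x mu)%E (A1 `*` A2) < +oo)%E.
  rewrite product_measure1E//; try exact: measurable_itv.
  change (mu A1 * mu A2 < +oo)%E.
  by rewrite /A1 /A2 !lebesgue_measure_itv/= !lte_fin ltr01 ab -!EFinB -!EFinM ltry.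
apply: (@cintegrable_dom _ _ R (mu \x mu)%E _ f (fun=> M) mD).
- apply: ccont_cmeasurable_prod => // -[s t] /sub[/=]; rewrite !in_itv/=; exact: cf.
- by move=> x /sub; exact: hM.
- apply: (@measurable_bounded_integrable _ _ R (mu \x mu)%E (fun=> M) _ mD).
  + exact: fin.
  + exact: measurable_cst.
  + by exists M; split; rewrite ?num_real// => y My x _; rewrite /= ger0_norm// ltW.
Qed.

Lemma geometric_le0 (x C q : R) : 0 <= q < 1 -> (forall N, x <= C * q ^+ N) -> x <= 0.
Proof.
move=> /andP[q0 q1] h.
have lim : C * q ^+ n @[n --> \oo] --> (0 : R).
  rewrite -[X in _ --> X](mulr0 C); apply: cvgM; first exact: cvg_cst.
  by apply: cvg_expr; rewrite ger0_norm.
rewrite leNgt; apply/negP => x0.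
have [n _ /(_ n (leqnn n))] := cvgr_lt (0 : R) lim x x0.
by rewrite /= ltNge h.
Qed.

Lemma geometric_eq0 (a : R[i]) (C q : R) : 0 <= q < 1 ->
  (forall N, cmod a <= C * q ^+ N) -> a = 0.
Proof.
move=> q01 h; apply/eqP; rewrite -cmod_eq0 eq_le cmod_ge0 andbT.
exact: geometric_le0 q01 h.
Qed.

End CompactBounds.

(** * Cauchy formula and Taylor expansion *)

Section Cauchy.
Context {R : realType}.
Local Notation mu := (@lebesgue_measure R).
Local Notation e := (@unit_circle R).
Local Notation tau := (pi *+ 2 : R).

Let tau0 : 0 < tau. Proof. by rewrite pmulrn_lgt0// pi_gt0. Qed.

Lemma cder_i (t : R) : cder (fun t : R => 0 +i* t) t 'i%C.
Proof. by split; rewrite reim; [exact: is_derive_cst|exact: is_derive_id]. Qed.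

Lemma cder_unit_circle (t : R) : cder e t ('i%C * e t).
Proof. by apply: cder_eq (cexp_cder (cder_i t)); rewrite mulrC. Qed.

Lemma ccont_unit_circle (T : topologicalType) (g : T -> R) x :
  {for x, continuous g} -> ccont (fun x => e (g x)) x.
Proof.
by move=> cg; apply: cexp_ccont; split => //; exact: cst_continuous.
Qed.

Lemma unit_circle_tau : e tau = 1.
Proof. by rewrite unit_circleE cos2pi sin2pi. Qed.

Definition circ (rho t : R) : R[i] := rho%:C * e t.

Lemma cmod_circ rho t : 0 < rho -> cmod (circ rho t) = rho.
Proof. by move=> r0; rewrite cmodM cmod_real cmod_unit_circle mulr1 gtr0_norm. Qed.

Lemma circ_neq0 rho t : 0 < rho -> circ rho t != 0.
Proof. by move=> r0; rewrite -cmod_gt0 cmod_circ. Qed.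

Lemma cder_circ rho t : cder (circ rho) t ('i%C * circ rho t).
Proof. by apply: cder_eq (cderZ _ (cder_unit_circle t)); rewrite mulrCA. Qed.

Lemma ccont_circ (T : topologicalType) rho (g : T -> R) x :
  {for x, continuous g} -> ccont (fun x => circ rho (g x)) x.
Proof.
by move=> cg; apply: ccontM; [exact: ccont_cst|exact: ccont_unit_circle].
Qed.

Lemma circ_tau rho : circ rho tau = circ rho 0.
Proof. by rewrite /circ unit_circle_tau unit_circle0. Qed.

(** The Cauchy kernel of the circle of radius [rho], with respect to the
    angle: [d zeta / (zeta - z) = i kappa rho z t dt] on [zeta = circ rho t].
    *)
Definition kappa rho (z : R[i]) (t : R) : R[i] := circ rho t / (circ rho t - z).

Lemma circ_sub_neq0 rho z t : cmod z < rho -> circ rho t - z != 0.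
Proof.
move=> zr; have r0 : 0 < rho by exact: le_lt_trans (cmod_ge0 _) zr.
rewrite subr_eq0; apply: contraTneq zr => <-.
by rewrite cmod_circ// ltxx.
Qed.

Lemma cmod_kappa_le rho z t : cmod z < rho ->
  cmod (kappa rho z t) <= rho / (rho - cmod z).
Proof.
move=> zr; have r0 : 0 < rho by exact: le_lt_trans (cmod_ge0 _) zr.
rewrite cmodM cmodV cmod_circ// ler_wpM2l ?(ltW r0)//.
have d0 : 0 < rho - cmod z by rewrite subr_gt0.
have h : rho - cmod z <= cmod (circ rho t - z).
  rewrite lerBlDr -{1}(cmod_circ t r0) -{1}[circ rho t](subrK z).
  exact: le_cmodD.
by rewrite lef_pV2 ?posrE// (lt_le_trans d0).
Qed.

Lemma ccont_kappa rho z (T : topologicalType) (g : T -> R) x : cmod z < rho ->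
  {for x, continuous g} -> ccont (fun x => kappa rho z (g x)) x.
Proof.
move=> zr cg; apply: ccontM; first exact: ccont_circ.
apply: ccontV; first exact: circ_sub_neq0.
by apply: ccontB; [exact: ccont_circ|exact: ccont_cst].
Qed.

Lemma kappa_geometric rho z t N : cmod z < rho ->
  kappa rho z t = \sum_(n < N) z ^+ n * (circ rho t)^-1 ^+ n +
    z ^+ N * (circ rho t)^-1 ^+ N * kappa rho z t.
Proof.
move=> zr; have r0 : 0 < rho by exact: le_lt_trans (cmod_ge0 _) zr.
have E0 := circ_neq0 t r0; have Ez := circ_sub_neq0 t zr.
elim: N => [|N IH]; first by rewrite big_ord0 !expr0 !mul1r add0r.
rewrite big_ord_recr/= -addrA {1}IH; congr (_ + _).
rewrite !exprS; rewrite /kappa.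
move: (z ^+ N) ((circ rho t)^-1 ^+ N) => a b.
by field; rewrite E0 Ez.
Qed.

(** Here [psi] need not be the boundary value of a holomorphic function: the
    expansion is that of the kernel. With [psi = 1] it evaluates [int_kappa],
    and with [psi] a holomorphic function it becomes the Taylor expansion. *)
Lemma geometric_expansion rho (psi : R -> R[i]) :
  (forall t, 0 <= t <= tau -> ccont psi t) -> 0 < rho ->
  exists2 M, 0 <= M & forall z N, cmod z < rho ->
   cmod (cint mu `[0, tau] (fun t => psi t * kappa rho z t) -
     \sum_(n < N) z ^+ n * cint mu `[0, tau] (fun t => psi t * (circ rho t)^-1 ^+ n))
   <= M * (rho / (rho - cmod z)) * (cmod z / rho) ^+ N.
Proof.
move=> cpsi r0.
have [|M M0 hM] := ccont_bounded (@segment_compact R 0 tau) (f := psi).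
  by move=> t; rewrite /= in_itv/=; exact: cpsi.
have mD : measurable (`[0, tau]%classic : set R) by exact: measurable_itv.
have cE n t : 0 <= t <= tau -> ccont (fun t => psi t * (circ rho t)^-1 ^+ n) t.
  move=> t0; apply: ccontM; first exact: cpsi.
  apply: ccontX; apply: ccontV; first exact: circ_neq0.
  exact: ccont_circ.
have iE n : cintegrable mu `[0, tau] (fun t => psi t * (circ rho t)^-1 ^+ n).
  by apply: cintegrable_itv => t; exact: cE.
exists (2 * (M * tau)); first by rewrite !mulr_ge0// ltW.
move=> z N zr.
have ck t : 0 <= t <= tau -> ccont (fun t => psi t * kappa rho z t) t.
  by move=> t0; apply: ccontM; [exact: cpsi|exact: ccont_kappa].
have ik : cintegrable mu `[0, tau] (fun t => psi t * kappa rho z t).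
  by apply: cintegrable_itv => t; exact: ck.
have [|iS SE] := @cintegrable_sum _ _ R mu `[0, tau]%classic
    (fun n t => z ^+ n * (psi t * (circ rho t)^-1 ^+ n)) N mD.
  by move=> n; apply: cintegrableZ.
have -> : \sum_(n < N) z ^+ n * cint mu `[0, tau] (fun t => psi t * (circ rho t)^-1 ^+ n) =
    cint mu `[0, tau] (fun t => \sum_(n < N) z ^+ n * (psi t * (circ rho t)^-1 ^+ n)).
  by rewrite SE; apply: eq_bigr => n _; rewrite cintZ.
rewrite -cintB//.
pose q := M * (rho / (rho - cmod z)) * (cmod z / rho) ^+ N.
have q0 : 0 <= q.
  rewrite mulr_ge0// ?exprn_ge0 ?divr_ge0 ?cmod_ge0 ?(ltW r0)//.
  by rewrite mulr_ge0// divr_ge0 ?subr_ge0 ?(ltW r0) ?(ltW zr).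
have qi : mu.-integrable `[0, tau] (EFin \o (fun=> q)).
  by apply: continuous_compact_integrable;
    [exact: segment_compact|apply: continuous_subspaceT => ?; exact: cst_continuous].
have iB : cintegrable mu `[0, tau] (fun t => psi t * kappa rho z t -
    \sum_(n < N) z ^+ n * (psi t * (circ rho t)^-1 ^+ n)) by exact: cintegrableB.
apply: le_trans; first apply: (cmod_cint_le (g := fun=> q)) => //.
  move=> t; rewrite /= in_itv/= => t0.
  rewrite (_ : _ - _ = psi t * (z ^+ N * (circ rho t)^-1 ^+ N * kappa rho z t)).
    have hk := cmod_kappa_le t zr; move: (kappa rho z t) hk => k hk.
    have -> : cmod (psi t * (z ^+ N * (circ rho t)^-1 ^+ N * k)) =
        cmod (psi t) * cmod k * (cmod z / rho) ^+ N.
      by rewrite cmodM cmodM cmodM !cmodX cmodV cmod_circ// exprMn; ring.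
    rewrite ler_wpM2r//; first by rewrite exprn_ge0// divr_ge0 ?cmod_ge0// ltW.
    by rewrite ler_pM ?cmod_ge0// hM//= in_itv.
  rewrite {1}(kappa_geometric t N zr) mulrDr.
  rewrite (_ : psi t * \sum_(n < N) _ = \sum_(n < N) z ^+ n * (psi t * (circ rho t)^-1 ^+ n)).
    by rewrite addrAC subrr add0r.
  by rewrite mulr_sumr; apply: eq_bigr => n _; rewrite mulrCA.
rewrite Rintegral_cst//.
have -> : fine (mu `[0, tau]) = tau.
  by rewrite lebesgue_measure_itv/= lte_fin tau0 sube0.
by rewrite /q le_eqVlt; apply/orP; left; apply/eqP; ring.
Qed.

End Cauchy.

Lemma ccont_precomp {R : realType} (T U : topologicalType) (h : T -> U)
    (f : U -> R[i]) x : {for x, continuous h} -> ccont f (h x) ->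
  ccont (fun x => f (h x)) x.
Proof.
move=> ch [c1 c2]; split.
  exact: (@continuous_comp _ _ _ h (Re \o f) x ch c1).
exact: (@continuous_comp _ _ _ h (Im \o f) x ch c2).
Qed.

Section CauchyFormula.
Context {R : realType}.
Local Notation mu := (@lebesgue_measure R).
Local Notation e := (@unit_circle R).
Local Notation tau := (pi *+ 2 : R).

Let tau0 : 0 < tau. Proof. by rewrite pmulrn_lgt0// pi_gt0. Qed.

Lemma circV rho (t : R) : (circ rho t)^-1 = (rho^-1)%:C * e (- t).
Proof.
rewrite /circ invfM -fmorphV; congr (_ * _).
apply: (mulfI (unit_circle_neq0 t)); rewrite divff ?unit_circle_neq0//.
by rewrite -unit_circleD subrr unit_circle0.
Qed.

Lemma cder_circV rho (t : R) :
  cder (fun t => (circ rho t)^-1) t (- 'i%C * (circ rho t)^-1).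
Proof.
apply: (@cder_ext _ (fun t => (rho^-1)%:C * e (- t))) => [x|]; first by rewrite circV.
rewrite circV mulrCA; apply: cderZ.
have ci : cder (fun t : R => 0 +i* (- t)) t (- 'i%C).
  split; rewrite reim/= ?oppr0; first exact: is_derive_cst.
  exact: is_deriveN.
by apply: cder_eq (cexp_cder ci); rewrite mulrC.
Qed.

Lemma int_circV rho n : 0 < rho ->
  cint mu `[0, tau] (fun t => (circ rho t)^-1 ^+ n) = if n == 0%N then tau%:C else 0.
Proof.
move=> r0; case: n => [|n].
  apply: complex_eqP; rewrite !reim/= Rintegral_cst//; last by rewrite mul0r.
  have -> : fine (mu `[0, tau]) = tau.
    by rewrite lebesgue_measure_itv/= lte_fin tau0 sube0.
  by rewrite mul1r.
have n0 : (n.+1%:R : R[i]) != 0 by rewrite pnatr_eq0.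
have i0 := @ci_neq0 R.
pose F t := - ('i%C * n.+1%:R)^-1 * (circ rho t)^-1 ^+ n.+1.
rewrite (@cFTC2 _ F) => //.
- by rewrite /F circ_tau subrr.
- move=> t _; apply: cder_eq (cderZ _ (cderX n.+1 (cder_circV rho t))).
  rewrite /= exprS; move: (_ ^+ n) => a; field.
  by rewrite circ_neq0 // i0 andbT -mulrS n0.
- move=> t _; apply: ccontX; apply: ccontV; first exact: circ_neq0.
  exact: ccont_circ.
Qed.

Lemma int_kappa rho z : cmod z < rho -> cint mu `[0, tau] (kappa rho z) = tau%:C.
Proof.
move=> zr; have r0 : 0 < rho by exact: le_lt_trans (cmod_ge0 _) zr.
have [|M M0 hM] := @geometric_expansion R rho (fun=> 1) _ r0.
  by move=> t _; exact: ccont_cst.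
apply/eqP; rewrite -subr_eq0; apply/eqP.
apply: (@geometric_eq0 _ _ (M * (rho / (rho - cmod z)) * (cmod z / rho)) (cmod z / rho)).
  by rewrite divr_ge0 ?cmod_ge0 ?(ltW r0)//= ltr_pdivrMr// mul1r.
move=> N; rewrite -[_ * (cmod z / rho) * _]mulrA -exprS.
apply: le_trans (hM z N.+1 zr).
rewrite le_eqVlt; apply/orP; left; apply/eqP; congr (cmod (_ - _)).
  by apply: cint_eq => t _; rewrite mul1r.
rewrite big_ord_recl expr0 mul1r big1 ?addr0.
  rewrite -[LHS](@int_circV rho 0%N r0).
  by apply: cint_eq => t _; rewrite mul1r.
move=> n _; rewrite -[RHS](mulr0 (z ^+ lift ord0 n)); congr (_ * _).
rewrite -[RHS](@int_circV rho (bump 0 n) r0).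
by apply: cint_eq => t _; rewrite mul1r.
Qed.

Variables (r : R) (phi phi' : R[i] -> R[i]).
Hypothesis hphi : holo (fun z => cmod z < r) phi phi'.

Lemma holo_ccont (T : topologicalType) (g : T -> R[i]) x : ccont g x ->
  cmod (g x) < r -> ccont (fun x => phi (g x)) x /\ ccont (fun x => phi' (g x)) x.
Proof.
move=> cg gr; have [c1 c2] := proj2 hphi _ gr.
by split; exact: ccont_comp.
Qed.

(** Shrink the circle to [z] along [gam (s, t) = z + s (circ rho t - z)]. The
    derivative of the integrand in [s] is itself a derivative in [t], of [phi
    (gam (s, t)) / (i s)], and so has integral zero over a full turn. *)
Lemma cauchy_formula rho z : cmod z < rho -> rho < r ->
  cint mu `[0, tau] (fun t => phi (circ rho t) * kappa rho z t) = tau%:C * phi z.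
Proof.
move=> zr rr; have r0 : 0 < rho by exact: le_lt_trans (cmod_ge0 _) zr.
pose gam (p : R * R) := z + p.1%:C * (circ rho p.2 - z).
pose P (s t : R) := phi (gam (s, t)) * kappa rho z t.
pose W (p : R * R) := phi' (gam p) * circ rho p.2.
have mD : measurable (`[0, tau]%classic : set R) by exact: measurable_itv.
have gr s t : 0 <= s <= 1 -> cmod (gam (s, t)) < r.
  move=> /andP[s0 s1]; apply: le_lt_trans rr.
  rewrite /gam/= (_ : _ + _ = (1 - s)%:C * z + s%:C * circ rho t); last first.
    by rewrite rmorphB/= rmorph1; ring.
  apply: le_trans (le_cmodD _ _) _; rewrite (cmodM s%:C) (cmodM (1 - s)%:C).
  rewrite !cmod_real cmod_circ// !ger0_norm ?subr_ge0//.
  rewrite [leRHS](_ : rho = (1 - s) * rho + s * rho); last by ring.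
  by rewrite lerD2r ler_wpM2l ?subr_ge0// ltW.
have cgam p : ccont gam p.
  apply: ccontD; first exact: ccont_cst.
  apply: ccontM; first by apply: ccont_real; exact: cvg_fst.
  by apply: ccontB; [apply: ccont_circ; exact: cvg_snd|exact: ccont_cst].
have cW s t : 0 <= s <= 1 -> ccont W (s, t).
  move=> s01; apply: ccontM; last by apply: ccont_circ; exact: cvg_snd.
  by have [] := holo_ccont (cgam (s, t)) (gr _ t s01).
have cpair1 (s t : R) : {for s, continuous (fun s => (s, t) : R * R)}.
  have c1 : {for s, continuous (fun s : R => s)} by exact: cvg_id.
  have c2 : {for s, continuous (fun s : R => t)} by exact: cvg_cst.
  exact: (cvg_pair c1 c2).
have cpair2 (s t : R) : {for t, continuous (fun t => (s, t) : R * R)}.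
  have c1 : {for t, continuous (fun t : R => t)} by exact: cvg_id.
  have c2 : {for t, continuous (fun t : R => s)} by exact: cvg_cst.
  exact: (cvg_pair c2 c1).
have cW1 s t : 0 <= s <= 1 -> ccont (fun s => W (s, t)) s.
  by move=> s01; exact: (ccont_precomp (cpair1 s t) (cW s t s01)).
have cW2 s t : 0 <= s <= 1 -> ccont (fun t => W (s, t)) t.
  by move=> s01; exact: (ccont_precomp (cpair2 s t) (cW s t s01)).
have cP s t : 0 <= s <= 1 -> ccont (P s) t.
  move=> s01; apply: ccontM; last exact: ccont_kappa.
  have cg : ccont (fun t => gam (s, t)) t.
    exact: (ccont_precomp (cpair2 s t) (cgam (s, t))).
  by have [] := holo_ccont cg (gr _ t s01).
have iP s : 0 <= s <= 1 -> cintegrable mu `[0, tau] (P s).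
  by move=> s01; apply: cintegrable_itv => t _; exact: cP.
transitivity (cint mu `[0, tau] (P 1)).
  by apply: cint_eq => t _; rewrite /P /gam mul1r addrC subrK.
transitivity (cint mu `[0, tau] (P 0)); last first.
  transitivity (cint mu `[0, tau] (fun t => phi z * kappa rho z t)).
    by apply: cint_eq => t _; rewrite /P /gam mul0r addr0.
  rewrite cintZ//; first by rewrite int_kappa// mulrC.
  by apply: cintegrable_itv => t _; exact: ccont_kappa.
apply: (@cint_homotopy _ _ R mu `[0, tau]%classic P W mD).
- by apply: cintegrable_rectangle => // s t s01 _; exact: cW.
- move=> t s _ s01.
  have dg : cder (fun s => gam (s, t)) s (circ rho t - z).
    have h : cder (fun s => z + s%:C * (circ rho t - z)) s
        (0 + (1%:C * (circ rho t - z) + s%:C * 0)).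
      apply: cderD; first exact: cder_cst.
      apply: cderM; last exact: cder_cst.
      by apply: cder_real; exact: is_derive_id.
    by move: h; rewrite mulr0 addr0 add0r mul1r.
  apply: cder_eq (cderM (proj1 hphi _ _ _ (gr s t s01) dg) (cder_cst _ s)).
  rewrite mulr0 addr0 /W /kappa; have := circ_sub_neq0 t zr => Ez.
  by rewrite -mulrA; congr (_ * _); rewrite mulrC divfK.
- by move=> t s _ s01; exact: cW1.
- move=> s /andP[s0 s1]; have s01 : 0 <= s <= 1 by rewrite !ltW.
  split; first by apply: cintegrable_itv => t _; exact: cW2.
  have i0 := @ci_neq0 R.
  have sC : (s%:C : R[i]) != 0 by apply: complex_neq0; rewrite gt_eqF.
  rewrite (@cFTC2 _ (fun t => ('i%C * s%:C)^-1 * phi (gam (s, t)))) => //.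
  + by rewrite /gam/= circ_tau subrr.
  + move=> t _.
    have dg : cder (fun t => gam (s, t)) t (s%:C * ('i%C * circ rho t)).
      apply: cder_eq (cderD (cder_cst z t) (cderZ s%:C (cderB (cder_circ rho t) (cder_cst z t)))).
      by rewrite add0r subr0.
    apply: cder_eq (cderZ _ (proj1 hphi _ _ _ (gr s t s01) dg)).
    rewrite /W/=; move: (phi' _) (circ rho t) => a b; field.
    by rewrite sC i0.
  + by move=> t _; exact: cW2.
- by apply: iP; rewrite lexx ler01.
- by apply: iP; rewrite lexx ler01.
Qed.

(** Cauchy integral for the [n]-th Taylor coefficient. The radius is kept as a
    parameter until [taylor_coef_indep]. *)
Definition taylor_coef rho n : R[i] :=
  (tau^-1)%:C * cint mu `[0, tau] (fun t => phi (circ rho t) * (circ rho t)^-1 ^+ n).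

Lemma taylor_bound rho : 0 < rho -> rho < r ->
  exists2 M, 0 <= M & forall z N, cmod z < rho ->
   cmod (phi z - \sum_(n < N) taylor_coef rho n * z ^+ n) <=
     M * (rho / (rho - cmod z)) * (cmod z / rho) ^+ N.
Proof.
move=> r0 rr.
have [|M M0 hM] := @geometric_expansion R rho (fun t => phi (circ rho t)) _ r0.
  move=> t _; have [] := @holo_ccont R (circ rho) t _ _ => //; last by rewrite cmod_circ.
  exact: ccont_circ.
exists (tau^-1 * M); first by rewrite mulr_ge0 ?invr_ge0 ?(ltW tau0).
move=> z N zr; have := hM z N zr; rewrite cauchy_formula//.
rewrite -!mulrA => /(ler_wpM2l (_ : 0 <= tau^-1)) h; apply: le_trans (h _).
  rewrite -[X in X * _](_ : cmod (tau^-1)%:C = tau^-1); last first.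
    by rewrite cmod_real ger0_norm// invr_ge0 ltW.
  rewrite -cmodM mulrBr mulrA -rmorphM/= mulVf ?gt_eqF// rmorph1 mul1r.
  rewrite le_eqVlt; apply/orP; left; apply/eqP; congr (cmod (_ - _)).
  by rewrite mulr_sumr; apply: eq_bigr => n _; rewrite /taylor_coef; ring.
by rewrite invr_ge0 ltW.
Qed.

End CauchyFormula.

(** * Taylor coefficients as weighted moments *)

Section MomentCoefficients.
Context {R : realType}.
Local Notation mu := (@lebesgue_measure R).
Local Notation mu2 := (mu \x mu)%E.
Local Notation tau := (pi *+ 2 : R).
Variables (r alpha : R).
Hypotheses (r0 : 0 < r) (alpha0 : 0 < alpha).
Local Notation w := (weight r alpha).
Local Notation D := (@disc R).

Definition monomial n m (z : R * R) : R[i] :=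
  conjc (plane z) ^+ n * plane z ^+ m * (w z)%:C.

(** The integrand is positive off the origin, so a zero integral would make an
    annulus negligible. *)
Lemma monomial_diag_neq0 n s : 0 < s <= r -> cint mu2 (D s) (monomial n n) != 0.
Proof.
move=> /andP[s0 sr]; apply/eqP => /(congr1 Re); rewrite !reim => e.
have mD := measurable_disc s.
have sub : D s `<=` D r by apply: subset_disc; rewrite sr ltW.
pose f z := sqnorm z ^+ n * w z.
have fE z : Re (monomial n n z) = f z.
  rewrite /monomial -exprMn mulrC [conjc _ * _]mulrC mulcJ cmod_plane_sqr.
  by rewrite -rmorphXn -rmorphM /= mulrC.
have fi : mu2.-integrable (D s) (EFin \o f).
  have [h _] := sqnorm_moment r0 alpha0 n.
  exact (@integrableS _ _ R mu2 (D r) (D s) (EFin \o f) (measurable_disc r) mD sub h).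
have f0 z : D s z -> 0 <= f z.
  move=> Dz; rewrite mulr_ge0 ?exprn_ge0 ?sqnorm_ge0// ltW// weight_gt0//.
  exact: sub.
have If0 : (\int[mu2]_(z in D s) `|(f z)%:E| = 0)%E.
  rewrite (_ : (\int[_]_(z in _) _ = \int[mu2]_(z in D s) (f z)%:E)%E); last first.
    by apply: eq_integral => z; rewrite inE => Dz; rewrite /= ger0_norm// f0.
  have : fine (\int[mu2]_(z in D s) (f z)%:E)%E = 0.
    by rewrite -[RHS]e /Rintegral; congr fine; apply: eq_integral => z _; rewrite fE.
  by move=> h; rewrite -[LHS]fineK ?h//; exact: integrable_fin_num fi.
have mf : measurable_fun (D s) (EFin \o f) by exact: measurable_int fi.
have [N [mN N0 subN]] := (@ae_eq_integral_abs _ _ R mu2 (D s) mD (EFin \o f) mf).1 If0.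
(* any annulus inside the disc that avoids the origin would do *)
pose A := [set z : R * R | s ^+ 2 / 4 < sqnorm z <= s ^+ 2 / 2].
have s2 : 0 < s ^+ 2 by rewrite exprn_gt0.
have AN : A `<=` N.
  move=> z /andP[z1 z2]; apply: subN => /=.
  have Dz : D s z by rewrite /disc/=; lra.
  move=> /(_ Dz)[] /eqP; rewrite gt_eqF// mulr_gt0//.
    by rewrite exprn_gt0//; lra.
  by apply: weight_gt0 => //; exact: sub.
have mA : mu2 A = (pi * (s ^+ 2 / 2 - s ^+ 2 / 4))%:E by apply: annulus_area; lra.
have A0 : mu2 A = 0%E.
  apply: (@subset_measure0 _ _ R mu2 A N) => //.
  rewrite /A (_ : [set _ | _] = [set z | sqnorm z <= s ^+ 2 / 2] `\` [set z | sqnorm z <= s ^+ 2 / 4]).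
    by apply: measurableD; exact: disc_measurable.
  apply/seteqP; split => z /=.
    by move=> /andP[h1 h2]; split => //; apply/negP; rewrite -ltNge.
  by move=> [h1 /negP]; rewrite -ltNge => ->.
move: A0; rewrite mA => -[] /eqP; rewrite gt_eqF// mulr_gt0 ?pi_gt0//; lra.
Qed.

Lemma monomial_diag n : cint mu2 (D r) (monomial n n) = (beta_moment (r ^+ 2) alpha n)%:C.
Proof.
have [_ h] := sqnorm_moment r0 alpha0 n.
have mE z : monomial n n z = (sqnorm z ^+ n * w z)%:C.
  by rewrite /monomial -exprMn [conjc _ * _]mulrC mulcJ cmod_plane_sqr -rmorphXn -rmorphM.
apply: complex_eqP; rewrite !reim -?h.
  by apply: eq_Rintegral => z _; rewrite mE.
under eq_Rintegral => z _ do rewrite mE Im_real.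
by rewrite /Rintegral integral0.
Qed.

Variables (phi phi' : R[i] -> R[i]).
Hypothesis hphi : holo (fun z => cmod z < r) phi phi'.
Hypothesis iphi : cintegrable mu2 (D r) (fun z => phi (plane z) * (w z)%:C).

Definition moment_integrand n (z : R * R) : R[i] :=
  conjc (plane z) ^+ n * (phi (plane z) * (w z)%:C).

Lemma ccont_phi z : D r z -> ccont (fun z => phi (plane z)) z.
Proof.
move=> Dz; have zr : cmod (plane z) < r by apply/disc_cmod => //; exact: ltW.
by have [] := holo_ccont hphi (ccont_plane z) zr.
Qed.

Lemma cintegrable_moment n : cintegrable mu2 (D r) (moment_integrand n).
Proof.
have [i1 i2] := iphi; have mD := measurable_disc r.
have cw : forall z, D r z -> ccont (fun z => (w z)%:C) z.
  by move=> z Dz; apply: ccont_real; exact: continuous_weight.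
pose g z := r ^+ n * (`|Re (phi (plane z) * (w z)%:C)| + `|Im (phi (plane z) * (w z)%:C)|).
have gi : mu2.-integrable (D r) (EFin \o g).
  apply: rintegrableZ => //; apply: rintegrableD => //.
    exact: (integrable_norm i1).
  exact: (integrable_norm i2).
apply: (@cintegrable_dom _ _ R mu2 (D r) _ g mD _ _ gi).
  apply: ccont_cmeasurable_prod => // z Dz; apply: ccontM.
    by apply: ccontX; apply: ccontJ; exact: ccont_plane.
  by apply: ccontM; [exact: ccont_phi|exact: cw].
move=> z Dz; rewrite /moment_integrand cmodM cmodX cmodJ /g.
apply: ler_pM; rewrite ?exprn_ge0 ?cmod_ge0//; last exact: cmod_le.
rewrite lerXn2r ?nnegrE ?cmod_ge0 ?(ltW r0)//.
by apply/ltW/disc_cmod => //; exact: ltW.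
Qed.

(** On a disc strictly inside that of radius [rho] the Taylor polynomials
    converge uniformly, at a geometric rate, and by orthogonality only the
    term of degree [n] contributes. *)
Lemma moment_coef_disc n rho s : 0 < s -> s < rho -> rho < r ->
  cint mu2 (D s) (moment_integrand n) =
  taylor_coef phi rho n * cint mu2 (D s) (monomial n n).
Proof.
move=> s0 sr rr; have rho0 : 0 < rho by exact: lt_trans sr.
have sr' : 0 <= s <= r by rewrite (ltW s0)/= ltW// (lt_trans sr).
have mD := measurable_disc s.
have sub : D s `<=` D r by exact: subset_disc.
have [M M0 hM] := taylor_bound hphi rho0 rr.
pose a := taylor_coef phi rho.
have im m := cintegrable_monomial r0 alpha0 n m sr'.
have iF : cintegrable mu2 (D s) (moment_integrand n).
  exact (@cintegrableS _ _ R mu2 (D r) (D s) _ (measurable_disc r) mD sub (cintegrable_moment n)).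
have iam m : cintegrable mu2 (D s) (fun z => a m * monomial n m z).
  exact (@cintegrableZ _ _ R mu2 (D s) (a m) _ mD (im m)).
have wi : mu2.-integrable (D s) (EFin \o w).
  exact (@integrableS _ _ R mu2 (D r) (D s) (EFin \o w) (measurable_disc r) mD sub (integrable_weight r0 alpha0)).
pose C := s ^+ n * (M * (rho / (rho - s))).
pose q := s / rho.
have q01 : 0 <= q < 1.
  by rewrite divr_ge0 ?(ltW s0) ?(ltW rho0)//= ltr_pdivrMr// mul1r.
have /andP[q0 q1] := q01.
pose V := \int[mu2]_(z in D s) w z.
apply/eqP; rewrite -subr_eq0; apply/eqP.
apply: (@geometric_eq0 _ _ (2 * (C * q ^+ n.+1 * V)) q) => // N.
have [iS SE] := @cintegrable_sum _ _ R mu2 (D s) (fun m z => a m * monomial n m z) (n.+1 + N) mD iam.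
have -> : a n * cint mu2 (D s) (monomial n n) =
    cint mu2 (D s) (fun z => \sum_(m < n.+1 + N) a m * monomial n m z).
  have nN : (n < n.+1 + N)%N by rewrite ltnS leq_addr.
  rewrite SE (bigD1 (Ordinal nN)) //= big1 ?addr0; last first.
    move=> m mn; transitivity (a m * cint mu2 (D s) (monomial n m)).
      exact (@cintZ _ _ R mu2 (D s) (a m) _ mD (im m)).
    rewrite monomial_orthogonal ?mulr0//.
    apply: contra mn => /eqP nm; apply/eqP/val_inj => /=.
    exact: esym.
  by rewrite (@cintZ _ _ R mu2 (D s) (a n) _ mD (im n)).
have <- := @cintB _ _ R mu2 (D s) _ _ mD iF iS.
pose g z := C * q ^+ (n.+1 + N) * w z.
have gi : mu2.-integrable (D s) (EFin \o g).
  exact (@rintegrableZ _ _ R mu2 (D s) _ w mD wi).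
have iB := @cintegrableB _ _ R mu2 (D s) _ _ mD iF iS.
apply: le_trans (@cmod_cint_le _ _ R mu2 (D s) _ g mD iB _ gi) _.
  move=> z Dz; have zs : cmod (plane z) < s by apply/disc_cmod => //; exact: ltW.
  have zr : cmod (plane z) < rho by exact: lt_trans sr.
  have w0 : 0 < w z by apply: weight_gt0 => //; exact: sub.
  have -> : moment_integrand n z - \sum_(m < n.+1 + N) a m * monomial n m z =
     conjc (plane z) ^+ n * (phi (plane z) - \sum_(m < n.+1 + N) a m * plane z ^+ m) * (w z)%:C.
    rewrite /moment_integrand mulrBr mulrBl; congr (_ - _); first by rewrite mulrA.
    rewrite mulr_sumr mulr_suml; apply: eq_bigr => m _.
    by rewrite /monomial; ring.
  rewrite cmodM cmodM cmodX cmodJ cmod_real (gtr0_norm w0) /g ler_wpM2r ?(ltW w0)//.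
  rewrite /C -[s ^+ n * _ * _]mulrA; apply: ler_pM; rewrite ?exprn_ge0 ?cmod_ge0//.
    by rewrite lerXn2r ?nnegrE ?cmod_ge0 ?(ltW s0) ?(ltW zs).
  apply: le_trans (hM _ _ zr) _.
  have d1 : 0 < rho - s by rewrite subr_gt0.
  have d2 : 0 < rho - cmod (plane z) by rewrite subr_gt0.
  apply: ler_pM.
  - by rewrite mulr_ge0// divr_ge0 ?(ltW rho0) ?(ltW d2).
  - by rewrite exprn_ge0// divr_ge0 ?cmod_ge0 ?(ltW rho0).
  - rewrite ler_wpM2l// ler_wpM2l ?(ltW rho0)// lef_pV2 ?posrE//.
    by rewrite lerB// ltW.
  - rewrite lerXn2r ?nnegrE ?divr_ge0 ?cmod_ge0 ?(ltW rho0) ?(ltW s0)//.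
    by rewrite ler_wpM2r ?invr_ge0 ?(ltW rho0) ?(ltW zs).
rewrite le_eqVlt; apply/orP; left; apply/eqP.
have -> : \int[mu2]_(z in D s) g z = C * q ^+ (n.+1 + N) * V.
  exact (@RintegralZl _ _ R mu2 (D s) w (C * q ^+ (n.+1 + N)) mD wi).
by rewrite exprD; ring.
Qed.

(** Both coefficients are read off the same moment over a smaller disc. *)
Lemma taylor_coef_indep n rho rho' : 0 < rho < r -> 0 < rho' < r ->
  taylor_coef phi rho n = taylor_coef phi rho' n.
Proof.
move=> /andP[h1 h2] /andP[h1' h2'].
pose s := Num.min rho rho' / 2.
have m0 : 0 < Num.min rho rho' by rewrite lt_min h1.
have s0 : 0 < s by rewrite divr_gt0.
have sm : s < Num.min rho rho' by rewrite /s; lra.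
have := sm; rewrite lt_min => /andP[s1 s2].
have sr : 0 < s <= r by rewrite s0/= ltW// (lt_trans s1).
apply: (mulIf (monomial_diag_neq0 n sr)).
transitivity (cint mu2 (D s) (moment_integrand n)).
  exact (esym (moment_coef_disc n s0 s1 h2)).
exact (moment_coef_disc n s0 s2 h2').
Qed.

(** Over the full disc the Taylor series need not converge in the weighted
    norm; the identity is instead obtained on the discs of radius [s k < r]
    and passes to the limit, both integrands being integrable. *)
Lemma moment_coef n rho : 0 < rho < r ->
  cint mu2 (D r) (moment_integrand n) =
  taylor_coef phi rho n * (beta_moment (r ^+ 2) alpha n)%:C.
Proof.
move=> rr; rewrite -monomial_diag; set a := taylor_coef phi rho n.
have mD := measurable_disc r.
have rr' : 0 <= r <= r by rewrite lexx ltW.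
have im := cintegrable_monomial r0 alpha0 n n rr'.
have iam : cintegrable mu2 (D r) (fun z => a * monomial n n z).
  exact (@cintegrableZ _ _ R mu2 (D r) a _ mD im).
pose G z := moment_integrand n z - a * monomial n n z.
have iG : cintegrable mu2 (D r) G.
  exact (@cintegrableB _ _ R mu2 (D r) _ _ mD (cintegrable_moment n) iam).
pose s (k : nat) : R := r - r * k.+2%:R^-1.
have s0 k : 0 < s k.
  by rewrite /s subr_gt0 gtr_pMr// invf_lt1 ?ltr0n// ltr1n.
have sr k : s k < r by rewrite /s gtrBl mulr_gt0// invr_gt0 ltr0n.
have sub k : D (s k) `<=` D r by apply: subset_disc; rewrite !ltW.
have G0 k : cint mu2 (D (s k)) G = 0.
  have mk := measurable_disc (s k).
  have i1 := @cintegrableS _ _ R mu2 (D r) (D (s k)) _ mD mk (sub k) (cintegrable_moment n).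
  have i2 := @cintegrableS _ _ R mu2 (D r) (D (s k)) _ mD mk (sub k) im.
  have i3 := @cintegrableZ _ _ R mu2 (D (s k)) a _ mk i2.
  rewrite (@cintB _ _ R mu2 (D (s k)) _ _ mk i1 i3).
  rewrite (@cintZ _ _ R mu2 (D (s k)) a _ mk i2).
  pose rk := (s k + r) / 2.
  have h1 : s k < rk by rewrite /rk; have := sr k; lra.
  have h2 : rk < r by rewrite /rk; have := sr k; lra.
  have h3 : 0 < rk < r by rewrite h2 andbT (lt_trans (s0 k)).
  rewrite /a (taylor_coef_indep n rr h3); apply/eqP; rewrite subr_eq0; apply/eqP.
  exact (moment_coef_disc n (s0 k) h1 h2).
have cover z : D r z -> \forall k \near \oo, D (s k) z.
  move=> /disc_cmod zr.
  have {}zr : cmod (plane z) < r by apply: zr; exact: ltW.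
  have lim : s k @[k --> \oo] --> r.
    rewrite -[X in _ --> X]subr0 /s; apply: cvgB; first exact: cvg_cst.
    rewrite -[X in _ --> X](mulr0 r); apply: cvgM; first exact: cvg_cst.
    by have := @cvg_harmonic R; rewrite -(cvg_shiftS (@harmonic R)).
  have [N _ hN] := cvgr_gt r lim _ zr; exists N => // k /hN zk.
  by apply/disc_cmod; first exact: ltW.
have cG0 : cint mu2 (D r) G = 0.
  apply: (@cint_exhaust_eq0 _ _ R mu2 (D r) (fun k => D (s k)) G (fun=> 0) mD
    (fun k => measurable_disc (s k)) sub cover iG) => [k|]; first by rewrite G0 cmod0.
  exact: cvg_cst.
apply/eqP; rewrite -subr_eq0; apply/eqP; rewrite -[RHS]cG0.
rewrite (@cintB _ _ R mu2 (D r) _ _ mD (cintegrable_moment n) iam).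
by rewrite (@cintZ _ _ R mu2 (D r) a _ mD im).
Qed.

End MomentCoefficients.

(** * The binomial kernel *)

Section BinomialKernel.
Context {R : realType}.
Local Notation mu := (@lebesgue_measure R).
Local Notation mu2 := (mu \x mu)%E.
Local Notation tau := (pi *+ 2 : R).
Variables (r alpha : R).
Hypotheses (r0 : 0 < r) (alpha0 : 0 < alpha).

Let tau0 : 0 < tau. Proof. by rewrite pmulrn_lgt0// pi_gt0. Qed.

Lemma right_half_1B (z : R[i]) : cmod z < 1 -> right_half (1 - z).
Proof.
move=> z1; rewrite /right_half !reim subr_gt0.
exact: le_lt_trans (ler_norm _) (le_lt_trans (Re_le_cmod z) z1).
Qed.

(** With [b = conj w / r^2] this is the weighted Bergman kernel of the complex
    disc of radius [r] at [w]. *)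
Definition binom_kernel (b z : R[i]) : R[i] := Pow (1 - z * b) (- alpha - 1).
Definition binom_kernel' (b z : R[i]) : R[i] :=
  (- alpha - 1)%:C * binom_kernel b z / (1 - z * b) * (- b).

Lemma holo_binom_kernel b : cmod b * r < 1 ->
  holo (fun z => cmod z < r) (binom_kernel b) (binom_kernel' b).
Proof.
move=> br.
have h1 : holo (fun z => cmod z < r) (fun z : R[i] => 1 + - b * z) (fun z => 0 + - b * 1).
  by apply: holoD; [exact: holo_cst|apply: holoZ; exact: holo_id].
have E z : 1 + - b * z = 1 - z * b by rewrite mulNr mulrC.
have := holo_comp h1 (holo_Pow (- alpha - 1)) _.
rewrite (_ : (fun z => Pow _ _) = binom_kernel b); last first.
  by apply/funext => z; rewrite /binom_kernel E.
rewrite (_ : (fun z => _ * _) = binom_kernel' b); last first.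
  by apply/funext => z; rewrite /binom_kernel' /binom_kernel E add0r mulr1.
apply => z zr; rewrite E; apply: right_half_1B; rewrite cmodM.
apply: le_lt_trans br; rewrite mulrC ler_wpM2l ?cmod_ge0// ltW//.
Qed.

Section Coefficients.
Variables (b : R[i]) (rho : R).
Hypotheses (br : cmod b * r < 1) (rr : 0 < rho < r).

Let rho0 : 0 < rho. Proof. by case/andP: rr. Qed.
Let rhor : rho < r. Proof. by case/andP: rr. Qed.
Local Notation a := (taylor_coef (binom_kernel b) rho).

Lemma binom_coef0 : a 0%N = 1.
Proof.
have [M M0 hM] := taylor_bound (holo_binom_kernel br) rho0 rhor.
have := hM 0 1%N; rewrite cmod0 mul0r expr1 mulr0 big_ord1 expr0 mulr1 => /(_ rho0) h.
have : cmod (binom_kernel b 0 - a 0%N) == 0 by rewrite eq_le h cmod_ge0.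
by rewrite cmod_eq0 subr_eq0 /binom_kernel mul0r subr0 Pow1 => /eqP.
Qed.

(** The coefficient form of the differential equation [(1 - b z) psi' = (alpha
    + 1) b psi]. *)
Lemma binom_coefS m : m.+1%:R * a m.+1 = (m.+1%:R + alpha%:C) * b * a m.
Proof.
have hpsi := holo_binom_kernel br.
pose E := circ rho; pose V t := (circ rho t)^-1.
pose psi t := binom_kernel b (E t).
have Er t : cmod (E t) < r by rewrite cmod_circ.
have E0 t : E t != 0 by exact: circ_neq0.
have w0 t : 1 - E t * b != 0.
  apply: right_half_neq0; apply: right_half_1B; rewrite cmodM; apply: le_lt_trans br.
  by rewrite mulrC ler_wpM2l ?cmod_ge0// ltW.
have cE t : ccont E t by exact: ccont_circ.
have cpsi t : ccont psi t by have [] := holo_ccont hpsi (cE t) (Er t).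
have cV n t : ccont (fun t => psi t * V t ^+ n) t.
  by apply: ccontM => //; apply: ccontX; exact: ccontV.
have iV n : cintegrable mu `[0, tau] (fun t => psi t * V t ^+ n).
  by apply: cintegrable_itv => t _; exact: cV.
have mD : measurable (`[0, tau]%classic : set R) by exact: measurable_itv.
pose c1 : R[i] := 'i%C * ((m.+1%:R + alpha%:C) * b); pose c2 : R[i] := 'i%C * m.+1%:R.
have dpsi t : cder psi t (binom_kernel' b (E t) * ('i%C * E t)).
  by apply: (proj1 hpsi) => //; exact: cder_circ.
have e : cint mu `[0, tau] (fun t => c1 * (psi t * V t ^+ m) - c2 * (psi t * V t ^+ m.+1)) = 0.
  (* a primitive with the same value at both ends of the turn *)
  rewrite (@cFTC2 _ (fun t => psi t * V t ^+ m.+1 * (1 - E t * b))) => //.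
  - by rewrite /psi /V /E circ_tau subrr.
  - move=> t _.
    have d1 := cderM (dpsi t) (cderX m.+1 (cder_circV rho t)).
    have d2 := cderB (cder_cst 1 t) (cderM (cder_circ rho t) (cder_cst b t)).
    apply: cder_eq (cderM d1 d2).
    rewrite /binom_kernel' -/(psi t) -/(E t) -/(V t) /=.
    have EV : E t * V t = 1 by rewrite divff.
    rewrite /c1 /c2 !exprS rmorphB rmorphN rmorph1 /=.
    move: (psi t) (V t ^+ m) (w0 t) (E0 t) => p v W0 EE0.
    rewrite /V -/(E t); move: (E t) W0 EE0 => X W0 X0.
    by field; rewrite X0 W0.
  - move=> t _; apply: ccontB; (apply: ccontM; first exact: ccont_cst); exact: cV.
have := e; rewrite cintB//; [|exact: cintegrableZ|exact: cintegrableZ].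
rewrite !cintZ// => /eqP; rewrite subr_eq0 => /eqP h.
apply: (mulfI (@ci_neq0 R)).
pose I n := cint mu `[0, tau] (fun t => psi t * V t ^+ n).
have aE n : a n = (tau^-1)%:C * I n by [].
rewrite !aE; move: h; rewrite -/(I m) -/(I m.+1) /c1 /c2 => h.
move: (tau^-1)%:C (I m) (I m.+1) h => k x y h.
transitivity (k * ('i%C * m.+1%:R * y)); first by ring.
by rewrite -h; ring.
Qed.

(** The recurrence [binom_coefS] and the recurrence [beta_momentS] compensate
    each other, leaving a factor [r^2 b] at each step. *)
Lemma binom_coef_moment n :
  a n * (beta_moment (r ^+ 2) alpha n)%:C = ((r ^+ 2)%:C * b) ^+ n.
Proof.
have r2 : 0 < r ^+ 2 by exact: exprn_gt0.
elim: n => [|n IH]; first by rewrite binom_coef0 beta_moment0// mul1r expr0.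
have n0 : (n.+1%:R : R[i]) != 0 by rewrite pnatr_eq0.
have na : (n.+1%:R + alpha%:C : R[i]) != 0.
  apply/eqP => /(congr1 Re)/eqP; rewrite -(rmorph_nat (real_complex R)) !reim gt_eqF//.
  by rewrite addr_gt0.
apply: (mulfI n0); apply: (mulfI na).
have hb : (n.+1%:R + alpha%:C) * (beta_moment (r ^+ 2) alpha n.+1)%:C =
    (r ^+ 2)%:C * n.+1%:R * (beta_moment (r ^+ 2) alpha n)%:C.
  rewrite -(rmorph_nat (real_complex R)) -rmorphD -rmorphM beta_momentS//.
  by rewrite !rmorphM.
rewrite (exprS ((r ^+ 2)%:C * b) n) -IH.
transitivity ((n.+1%:R * a n.+1) * ((n.+1%:R + alpha%:C) * (beta_moment (r ^+ 2) alpha n.+1)%:C)).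
  by ring.
by rewrite hb binom_coefS; ring.
Qed.

End Coefficients.

(** The moments give the Taylor coefficients, and these give the function on
    the whole disc. *)
Lemma determined_by_moments (phi phi' : R[i] -> R[i]) (l1 l2 b1 b2 : R[i]) :
  holo (fun z => cmod z < r) phi phi' ->
  cintegrable mu2 (disc r) (fun z => phi (plane z) * (weight r alpha z)%:C) ->
  cmod b1 * r < 1 -> cmod b2 * r < 1 ->
  (forall n, cint mu2 (disc r) (moment_integrand r alpha phi n) =
     l1 * ((r ^+ 2)%:C * b1) ^+ n + l2 * ((r ^+ 2)%:C * b2) ^+ n) ->
  forall z, cmod z < r -> phi z = l1 * binom_kernel b1 z + l2 * binom_kernel b2 z.
Proof.
move=> hphi iphi br1 br2 hm z zr.
pose rho := (cmod z + r) / 2.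
have z0 := cmod_ge0 z.
have zrho : cmod z < rho by rewrite /rho; lra.
have rho0 : 0 < rho by exact: le_lt_trans zrho.
have rhor : rho < r by rewrite /rho; lra.
have rr : 0 < rho < r by rewrite rho0.
have coefE n : taylor_coef phi rho n = l1 * taylor_coef (binom_kernel b1) rho n +
    l2 * taylor_coef (binom_kernel b2) rho n.
  have N0 : ((beta_moment (r ^+ 2) alpha n)%:C : R[i]) != 0.
    by apply: complex_neq0; rewrite gt_eqF// beta_moment_gt0.
  apply: (mulIf N0); rewrite -(moment_coef r0 alpha0 hphi iphi n rr) hm.
  rewrite -(binom_coef_moment br1 rr) -(binom_coef_moment br2 rr); ring.
have [M M0 hM] := taylor_bound hphi rho0 rhor.
have [M1 M10 hM1] := taylor_bound (holo_binom_kernel br1) rho0 rhor.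
have [M2 M20 hM2] := taylor_bound (holo_binom_kernel br2) rho0 rhor.
apply/eqP; rewrite -subr_eq0; apply/eqP.
pose K := rho / (rho - cmod z).
apply: (@geometric_eq0 _ _ (M * K + cmod l1 * (M1 * K) + cmod l2 * (M2 * K)) (cmod z / rho)).
  by rewrite divr_ge0 ?(ltW rho0)//= ltr_pdivrMr// mul1r.
move=> N.
set S := \sum_(n < N) taylor_coef phi rho n * z ^+ n.
set S1 := \sum_(n < N) taylor_coef (binom_kernel b1) rho n * z ^+ n.
set S2 := \sum_(n < N) taylor_coef (binom_kernel b2) rho n * z ^+ n.
have SE : S = l1 * S1 + l2 * S2.
  rewrite /S /S1 /S2 !mulr_sumr -big_split/=; apply: eq_bigr => n _.
  by rewrite coefE; ring.
rewrite (_ : _ - _ = (phi z - S) + (- (l1 * (binom_kernel b1 z - S1)) + - (l2 * (binom_kernel b2 z - S2)))); last first.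
  by rewrite SE; ring.
apply: le_trans (le_cmodD _ _) _; rewrite !mulrDl -addrA; apply: lerD; first exact: hM.
apply: le_trans (le_cmodD _ _) _; rewrite !cmodN !cmodM.
by apply: lerD; rewrite -[cmod _ * _ * _]mulrA ler_wpM2l ?cmod_ge0//; [exact: hM1|exact: hM2].
Qed.

End BinomialKernel.

(** * Integration over the half line *)

Section HalfLine.
Context {R : realType}.
Local Notation mu := (@lebesgue_measure R).

Definition half_line : set R := `]0, +oo[%classic.
Local Notation D := half_line.

Lemma half_lineE t : D t <-> 0 < t.
Proof. by rewrite /half_line/= in_itv/= andbT. Qed.

Lemma measurable_half_line : measurable D. Proof. exact: measurable_itv. Qed.

Lemma integrable_expRN c : 0 < c -> mu.-integrable D (EFin \o (fun t => expR (- (c * t)))).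
Proof.
move=> c0; have h := integrable_exponential_pdf c0.
have h1 : mu.-integrable D (EFin \o exponential_pdf c).
  exact (@integrableS _ _ R mu setT D (EFin \o exponential_pdf c) measurableT measurable_half_line (@subsetT _ D) h).
have e t : D t -> c^-1 * exponential_pdf c t = expR (- (c * t)).
  move=> /half_lineE t0; rewrite exponential_pdfE ?ltW//.
  by rewrite mulrA mulVf ?gt_eqF// mul1r mulNr.
exact (@integrable_ext _ _ R mu D _ _ measurable_half_line e
  (@rintegrableZ _ _ R mu D c^-1 _ measurable_half_line h1)).
Qed.

(** From [ln x <= x - 1] at [x = d t], where [d] is such that [a d <= c / 2].
    *)
Lemma powR_expR_le (a c t : R) : 0 <= a -> 0 < c -> 0 < t ->
  t `^ a * expR (- (c * t)) <=
  expR (- a - a * ln (c / (2 * (a + 1)))) * expR (- (c / 2 * t)).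
Proof.
move=> a0 c0 t0; set d := c / (2 * (a + 1)).
have a1 : 0 < a + 1 by rewrite ltr_wpDl.
have d0 : 0 < d by rewrite divr_gt0// mulr_gt0.
have dt : 0 < d * t by rewrite mulr_gt0.
rewrite /powR gt_eqF// -!expRD ler_expR.
have h : ln d + ln t <= d * t - 1.
  rewrite -lnM ?posrE//.
  have := @le_ln1Dx R (d * t - 1); rewrite (_ : 1 + (d * t - 1) = d * t); last by ring.
  by apply; lra.
have h2 : a * d * t <= c / 2 * t.
  apply: ler_wpM2r; first exact: ltW.
  rewrite /d.
  have -> : a * (c / (2 * (a + 1))) = c / 2 * (a / (a + 1)) by field; rewrite gt_eqF.
  rewrite -[leRHS]mulr1; apply: ler_wpM2l; first by rewrite divr_ge0 ?ltW.
  apply: ltW.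
  by rewrite ltr_pdivrMr// mul1r ltrDl.
have := ler_wpM2l a0 h; lra.
Qed.

Lemma continuous_powR_expR (a c t : R) : 0 < t ->
  {for t, continuous (fun t : R => t `^ a * expR (- (c * t)))}.
Proof.
move=> t0; apply: continuousM; first exact: continuous_powR.
apply: cont_comp; last exact: continuous_expR.
by apply: continuousN; apply: continuousM => //; exact: cst_continuous.
Qed.

Lemma integrable_powR_expR (a c : R) : 0 <= a -> 0 < c ->
  mu.-integrable D (EFin \o (fun t => t `^ a * expR (- (c * t)))).
Proof.
move=> a0 c0; have c2 : 0 < c / 2 by rewrite divr_gt0.
set K := expR (- a - a * ln (c / (2 * (a + 1)))).
apply: (@le_integrable _ _ R mu D measurable_half_line _ (EFin \o (fun t => K * expR (- (c / 2 * t))))).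
- apply/measurable_EFinP; apply: continuous_at_measurable; first exact: measurable_half_line.
  by move=> t /half_lineE; exact: continuous_powR_expR.
- move=> t /half_lineE t0; rewrite /= lee_fin !ger0_norm ?mulr_ge0 ?expR_ge0 ?powR_ge0//.
  exact: powR_expR_le.
- by apply: rintegrableZ; [exact: measurable_half_line|exact: integrable_expRN].
Qed.

Lemma integrable_snd (g : R -> R) : (forall t, D t -> 0 <= g t) ->
  mu.-integrable D (EFin \o g) ->
  (mu \x mu)%E.-integrable (`]0, 1[%classic `*` D) (EFin \o (fun p => g p.2)).
Proof.
move=> g0 gi; pose A : set R := `]0, 1[%classic.
have mA : measurable A by exact: measurable_itv.
have mD := measurable_half_line.
have mX : measurable (A `*` D) by exact: measurableX.
have mg : measurable_fun D g by apply/measurable_EFinP; exact: measurable_int gi.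
rewrite -/A.
pose f := (EFin \o (fun p : R * R => g p.2)) \_ (A `*` D).
suff fi : (mu \x mu)%E.-integrable setT f by move: fi; rewrite -integrable_mkcond.
have fE x y : f (x, y) = (if x \in A then ((EFin \o g) \_ D) y else 0)%E.
  by rewrite /f patchE in_setX patchE; case: (x \in A); case: (y \in D).
have mf : measurable_fun setT f.
  apply/(measurable_restrictT _ mX); apply/measurable_EFinP.
  apply: (measurable_comp (F := D)) => //; last exact: measurable_funS measurable_snd.
  by move=> _ [[x y] [_ /= Dy] <-].
apply: (iffRL (@integrable21ltyP _ _ _ _ R mu mu f mf)).
have gD : mu.-integrable setT ((EFin \o g) \_ D) by rewrite -integrable_mkcond.
have /integrableP[_] := gD.
rewrite (_ : (fun y => \int[mu]_x _)%E = (fun y => `|((EFin \o g) \_ D) y|%E))//.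
apply/funext => y.
transitivity (\int[mu]_(x in A) `|((EFin \o g) \_ D) y|)%E.
  rewrite [RHS]integral_mkcond; apply: eq_integral => x _.
  by rewrite fE [RHS]patchE; case: ifPn => // _ /=; rewrite normr0.
have muA : mu A = 1%E by rewrite /A lebesgue_measure_itv/= lte_fin ltr01 sube0.
apply: etrans (@integral_cst _ _ R mu A mA _) _.
by rewrite -[RHS]mule1; congr (_ * _)%E; exact: muA.
Qed.

End HalfLine.

(** * The Gamma integral at a complex parameter *)

Section GammaIntegral.
Context {R : realType}.
Local Notation mu := (@lebesgue_measure R).
Local Notation D := (@half_line R).

(** The integrand of [Gamma(a+1) z^(-a-1)]. *)
Definition laplace_integrand (a : R) (z : R[i]) (t : R) : R[i] :=
  (t `^ a)%:C * cexp (- (t%:C * z)).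
Local Notation G := laplace_integrand.

Lemma cmod_laplace_integrand a z t :
  cmod (G a z t) = t `^ a * expR (- (Re z * t)).
Proof.
rewrite /G cmodM cmod_real ger0_norm ?powR_ge0// cmod_cexp.
by congr (_ * expR _); rewrite !reim; ring.
Qed.

Lemma ccont_laplace_integrand (T : topologicalType) a (z : T -> R[i]) (t : T -> R) x :
  0 < t x -> {for x, continuous t} -> ccont z x ->
  ccont (fun x => G a (z x) (t x)) x.
Proof.
move=> t0 ct cz; apply: ccontM.
  apply: ccont_real; apply: (@cont_comp _ _ (fun t => t `^ a)) => //.
  exact: continuous_powR.
apply: cexp_ccont; apply: (@ccont_ext _ _ (fun x => -1 * ((t x)%:C * z x))).
  by move=> y; rewrite mulN1r.
apply: ccontM; first exact: ccont_cst.
by apply: ccontM => //; exact: ccont_real.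
Qed.

Lemma cintegrable_laplace a z : 0 <= a -> 0 < Re z -> cintegrable mu D (G a z).
Proof.
move=> a0 z0.
apply: (@cintegrable_dom _ _ R mu D _ (fun t => t `^ a * expR (- (Re z * t)))).
- exact: measurable_half_line.
- apply: ccont_cmeasurable; first exact: measurable_half_line.
  move=> t /half_lineE t0; apply: ccont_laplace_integrand => //.
  exact: ccont_cst.
- by move=> t _; rewrite cmod_laplace_integrand.
- exact: integrable_powR_expR.
Qed.

Lemma laplace_integrand_cder a z t : 0 < t ->
  cder (G (a + 1) z) t ((a + 1)%:C * G a z t - z * G (a + 1) z t).
Proof.
move=> t0.
have h1 : cder (fun t : R => (t `^ (a + 1))%:C) t ((a + 1) * t `^ a)%:C.
  apply: cder_real; apply: is_derive_eq' (is_derive_powR _ t0) _.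
  by rewrite addrK.
have h2 : cder (fun t : R => cexp (- (t%:C * z))) t (cexp (- (t%:C * z)) * (- z)).
  apply: cexp_cder; apply: (@cder_ext _ (fun t => - z * t%:C)).
    by move=> u; rewrite mulNr mulrC.
  apply: cder_eq (cderZ (- z) (cder_real (is_derive_id t 1))).
  by rewrite mulr1.
apply: cder_eq (cderM h1 h2).
by rewrite /G rmorphM/=; ring.
Qed.

(** The integrand is the derivative of [t^(a+1) exp (- z t)], which tends to
    [0] at both ends of the half-line. *)
Lemma cint_laplace_exact a z : 0 <= a -> 0 < Re z ->
  cint mu D (fun t => (a + 1)%:C * G a z t - z * G (a + 1) z t) = 0.
Proof.
move=> a0 z0; have mD : measurable D by exact: measurable_half_line.
have a1 : 0 <= a + 1 by rewrite addr_ge0.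
pose E n : set R := `[(n.+2%:R)^-1, n.+2%:R]%classic.
set K := expR (- (a + 1) - (a + 1) * ln (Re z / (2 * (a + 1 + 1)))).
have K0 : 0 <= K by exact: expR_ge0.
have i1 : cintegrable mu D (G a z) by exact: cintegrable_laplace.
have i2 : cintegrable mu D (G (a + 1) z) by exact: cintegrable_laplace.
have n0 n : 0 < (n.+2%:R : R) by rewrite ltr0n.
have ED n : E n `<=` D.
  move=> x; rewrite /E/= in_itv/= => /andP[x1 _]; apply/half_lineE.
  by apply: lt_le_trans x1; rewrite invr_gt0.
apply: (@cint_exhaust_eq0 _ _ R mu D E _ (fun n => (K * (2 / Re z) + 1) * n.+1%:R^-1)) => //.
- by move=> n; exact: measurable_itv.
- move=> x /half_lineE x0.
  have [N _ hN] := near_infty_natSinv_lt (PosNum x0).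
  have [M _ hM] := nbhs_infty_ger x.
  exists (maxn N M) => //= n /=; rewrite geq_max => /andP[Nn Mn].
  rewrite /E/= in_itv/=; apply/andP; split.
    apply: le_trans (ltW (hN n Nn)) => /=.
    by rewrite lef_pV2 ?posrE ?ltr0n// ler_nat.
  by apply: le_trans (hM n Mn) _; rewrite ler_nat -addn2 leq_addr.
- apply: (@cintegrableB _ _ R mu D) => //; exact: (@cintegrableZ _ _ R mu D).
- move=> n.
  have ab : (n.+2%:R)^-1 < n.+2%:R :> R.
    by apply: (@lt_trans _ _ 1); rewrite ?invf_lt1 ?ltr1n ?ltr0n.
  rewrite (cFTC2 ab (F := G (a + 1) z)); first last.
  + move=> x /andP[x1 _]; have x0 : 0 < x by apply: lt_le_trans x1; rewrite invr_gt0.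
    apply: ccontB; apply: ccontM; try exact: ccont_cst;
    by apply: ccont_laplace_integrand => //; exact: ccont_cst.
  + move=> x /andP[x1 _]; have x0 : 0 < x by apply: lt_le_trans x1; rewrite invr_gt0.
    exact: laplace_integrand_cder.
  rewrite (le_trans (le_cmodD _ _))// cmodN !cmod_laplace_integrand.
  have le1 : (n.+2%:R)^-1 <= (n.+1%:R)^-1 :> R.
    by rewrite lef_pV2 ?posrE ?ltr0n// ler_nat.
  rewrite mulrDl; apply: lerD.
    apply: le_trans (powR_expR_le a1 z0 (n0 n)) _; rewrite -/K -[leRHS]mulrA.
    apply: ler_wpM2l => //; apply: le_trans (_ : (2 / Re z) * (n.+2%:R)^-1 <= _); last first.
      by apply: ler_wpM2l => //; rewrite divr_ge0// ltW.
    have y0 : 0 < Re z / 2 * n.+2%:R by rewrite mulr_gt0 ?divr_gt0.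
    rewrite expRN (_ : 2 / Re z * _ = (Re z / 2 * n.+2%:R)^-1); last first.
      by field; rewrite gt_eqF ?gt_eqF.
    rewrite lef_pV2 ?posrE ?expR_gt0//.
    by apply: le_trans (expR_ge1Dx _); rewrite lerDr.
  rewrite mul1r; apply: le_trans le1.
  rewrite -[leRHS]mulr1; apply: ler_pM; rewrite ?powR_ge0 ?expR_ge0//.
    rewrite powRD ?(gt_eqF (invr_gt0 _ _))//; last first.
      by rewrite invr_eq0 pnatr_eq0 implybT.
    rewrite powRr1 ?invr_ge0// -[leRHS]mul1r; apply: ler_wpM2r; first by rewrite invr_ge0.
    rewrite [leRHS](_ : 1 = 1 `^ a); last by rewrite powR1.
    apply: ge0_ler_powR => //; rewrite ?nnegrE ?invr_ge0//.
    by rewrite invf_le1 ?ltr0n// (ler_nat _ 1).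
  rewrite -[leRHS]expR0 ler_expR oppr_le0 mulr_ge0// ?ltW// ?invr_gt0//.
rewrite -[X in _ --> X](mulr0 (K * (2 / Re z) + 1)).
apply: cvgM; first exact: cvg_cst.
exact: cvg_harmonic.
Qed.

End GammaIntegral.

Section ComplexGamma.
Context {R : realType}.
Local Notation mu := (@lebesgue_measure R).
Local Notation D := (@half_line R).
Local Notation G := laplace_integrand.
Variables (a : R) (s : R[i]).
Hypotheses (a0 : 0 <= a) (s0 : right_half s).

Let sg (tau : R) : R[i] := 1 + tau%:C * (s - 1).
Let k (z : R[i]) : R[i] := Pow z (a + 1) / z * (s - 1).
Let W (p : R * R) : R[i] :=
  k (sg p.1) * ((a + 1)%:C * G a (sg p.1) p.2 - sg p.1 * G (a + 1) (sg p.1) p.2).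

Lemma segment_right_half : exists2 m : R, 0 < m &
  forall tau, 0 <= tau <= 1 -> m <= Re (sg tau).
Proof.
exists (Num.min 1 (Re s)); first by rewrite lt_min ltr01.
move=> tau /andP[t0 t1]; rewrite /sg !reim.
have m1 : Num.min 1 (Re s) <= 1 by rewrite ge_min lexx.
have m2 : Num.min 1 (Re s) <= Re s by rewrite ge_min lexx orbT.
nra.
Qed.

Let ccont_k z : right_half z -> ccontC k z.
Proof.
move=> z0; have [_ hc] := holo_Pow (R := R) (a + 1); have [h _] := hc _ z0.
have zn0 : plane (Re z, Im z) != 0 :> R[i] by rewrite plane_ReIm right_half_neq0.
exact (ccontM (ccontM h (ccontV zn0 (ccont_plane (Re z, Im z))))
  (ccont_cst (s - 1) (Re z, Im z))).
Qed.

Let ccont_sg tau : ccont sg tau.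
Proof.
apply: ccontD; first exact: ccont_cst.
by apply: ccontM; [apply: ccont_real|exact: ccont_cst].
Qed.

Let cder_sg tau : cder sg tau (s - 1).
Proof.
apply: (@cder_ext _ (fun t => 1 + (s - 1) * t%:C)); first by move=> t; rewrite mulrC.
apply: cder_eq (cderD (cder_cst 1 tau) (cderZ (s - 1) (cder_real (is_derive_id tau 1)))).
by rewrite add0r mulr1.
Qed.

Let ccont_W (p : R * R) : 0 <= p.1 <= 1 -> 0 < p.2 -> ccont W p.
Proof.
move=> p1 p2; have [m m0 mle] := segment_right_half.
have sp : right_half (sg p.1) by apply: lt_le_trans (mle _ p1).
have c1 : ccont (fun p : R * R => sg p.1) p.
  split.
    by apply: (@cont_comp _ _ (Re \o sg) fst); [exact: cvg_fst|have [] := ccont_sg p.1].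
  by apply: (@cont_comp _ _ (Im \o sg) fst); [exact: cvg_fst|have [] := ccont_sg p.1].
have c2 : {for p, continuous (snd : R * R -> R)} by exact: cvg_snd.
have ck := ccont_comp c1 (ccont_k sp).
have cG b := @ccont_laplace_integrand R _ b (fun p : R * R => sg p.1) snd p p2 c2 c1.
exact (ccontM ck (ccontB (ccontM (ccont_cst (a + 1)%:C p) (cG a)) (ccontM c1 (cG (a + 1))))).
Qed.

Lemma cintegrable_homotopy_derivative : cintegrable (mu \x mu)%E (`]0, 1[%classic `*` D) W.
Proof.
have mD : measurable D by exact: measurable_half_line.
have [m m0 mle] := segment_right_half.
have I01 : compact (`[0, 1]%classic : set R) by exact: segment_compact.
have [|M M0 hM] := @ccont_bounded _ _ _ (fun t => k (sg t)) I01.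
  move=> t; rewrite /= in_itv/= => t01.
  exact (ccont_comp (ccont_sg t) (ccont_k (lt_le_trans m0 (mle _ t01)))).
have [|N N0 hN] := @ccont_bounded _ _ _ sg I01.
  by move=> t _.
pose g t := M * ((a + 1) * (t `^ a * expR (- (m * t))) + N * (t `^ (a + 1) * expR (- (m * t)))).
have a1 : 0 <= a + 1 by rewrite addr_ge0.
have gi : mu.-integrable D (EFin \o g).
  apply: (@rintegrableZ _ _ R mu D) => //; apply: (@rintegrableD _ _ R mu D) => //;
  by apply: (@rintegrableZ _ _ R mu D) => //; exact: integrable_powR_expR.
have g0 t : D t -> 0 <= g t.
  move=> _; rewrite /g; repeat (apply: mulr_ge0 => // || apply: addr_ge0 => // || exact: powR_ge0 || exact: expR_ge0).
have mX : measurable (`]0, 1[%classic `*` D : set (R * R)).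
  by apply: measurableX => //; exact: measurable_itv.
have gi2 := integrable_snd g0 gi.
apply: (@cintegrable_dom _ _ R (mu \x mu)%E _ W (fun p => g p.2) mX _ _ gi2).
  apply: (@ccont_cmeasurable_prod R _ W mX).
  move=> [t x] [/=]; rewrite in_itv/= => /andP[t0 t1] /half_lineE x0.
  by apply: ccont_W; rewrite //= !ltW.
move=> [t x] [/=]; rewrite in_itv/= => /andP[t0 t1] /half_lineE x0.
have t01 : 0 <= t <= 1 by rewrite !ltW.
have tI : (`[0, 1]%classic : set R) t by rewrite /= in_itv.
have le_exp b : x `^ b * expR (- (Re (sg t) * x)) <= x `^ b * expR (- (m * x)).
  apply: ler_wpM2l; first exact: powR_ge0.
  by rewrite ler_expR lerN2; apply: ler_wpM2r; [exact: ltW|exact: mle].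
rewrite /W/= cmodM /g; apply: ler_pM; rewrite ?cmod_ge0//; first exact: hM.
rewrite (le_trans (le_cmodD _ _))// cmodN (cmodM (a + 1)%:C) (cmodM (sg t)) !cmod_laplace_integrand.
rewrite cmod_real (ger0_norm a1); apply: lerD; first exact: ler_wpM2l.
by apply: ler_pM; rewrite ?cmod_ge0// ?mulr_ge0 ?powR_ge0 ?expR_ge0//; exact: hN.
Qed.

Let homotopy_algebra (p g z a1 x s1 : R[i]) : z != 0 ->
  a1 * p / z * s1 * g + p * (- x * g * s1) = p / z * s1 * (a1 * g - z * (x * g)).
Proof. by move=> z0; field. Qed.

(** Along the segment from [1] to [s] the derivative of [Pow sg (a+1) * G a
    sg] with respect to the position is a multiple of the integrand of
    [cint_laplace_exact], so the integral of this product stays equal to its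
    value at [1]. *)
Lemma cint_laplace : cint mu D (G a s) =
  (\int[mu]_(t in `]0, +oo[) (t `^ a * expR (- t)))%:C * Pow s (- a - 1).
Proof.
have mD : measurable D by exact: measurable_half_line.
have [m m0 mle] := segment_right_half.
have sg_rh t : 0 <= t <= 1 -> right_half (sg t) by move=> /mle; exact: lt_le_trans.
have sg1 : sg 1 = s by rewrite /sg mul1r addrC subrK.
have sg0 : sg 0 = 1 by rewrite /sg mul0r addr0.
pose P (t x : R) := Pow (sg t) (a + 1) * G a (sg t) x.
have iG z : right_half z -> cintegrable mu D (G a z) by exact: cintegrable_laplace.
have iP t : 0 <= t <= 1 -> cintegrable mu D (P t).
  by move=> t01; apply: (@cintegrableZ _ _ R mu D) => //; apply: iG; exact: sg_rh.
have h : cint mu D (P 1) = cint mu D (P 0).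
  apply: (@cint_homotopy _ _ R mu D P W mD).
  - exact: cintegrable_homotopy_derivative.
  - move=> x t /half_lineE x0 t01; have st := sg_rh _ t01.
    have sn0 := right_half_neq0 st.
    have [hP _] := holo_Pow (R := R) (a + 1).
    have d1 := hP _ _ _ st (cder_sg t).
    have d2 : cder (fun t => G a (sg t) x) t (- x%:C * G a (sg t) x * (s - 1)).
      have e : cder (fun t => cexp (- (x%:C * sg t))) t (cexp (- (x%:C * sg t)) * (- x%:C * (s - 1))).
        apply: cexp_cder; apply: (@cder_ext _ (fun t => - x%:C * sg t)).
          by move=> u; rewrite mulNr.
        exact: cderZ.
      apply: cder_eq (cderZ (x `^ a)%:C e); rewrite /G; ring.
    apply: cder_eq (cderM d1 d2); rewrite /W/k/=.
    have -> : G (a + 1) (sg t) x = x%:C * G a (sg t) x.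
      rewrite /G powRD; last by rewrite (gt_eqF x0) implybT.
      by rewrite powRr1 ?(ltW x0)// rmorphM/=; ring.
    exact: homotopy_algebra.
  - move=> x t /half_lineE x0 t01.
    have cp : {for t, continuous (fun t => (t, x) : R * R)}.
      have c1 : {for t, continuous (fun t : R => t)} by exact: cvg_id.
      have c2 : {for t, continuous (fun t : R => x)} by exact: cvg_cst.
      exact: (cvg_pair c1 c2).
    exact: (ccont_precomp cp (ccont_W (p := (t, x)) t01 x0)).
  - move=> t /andP[t0 t1]; have t01 : 0 <= t <= 1 by rewrite !ltW.
    have st := sg_rh _ t01.
    have a1 : 0 <= a + 1 by rewrite addr_ge0.
    have i1 : cintegrable mu D (fun x => (a + 1)%:C * G a (sg t) x - sg t * G (a + 1) (sg t) x).
      apply: (@cintegrableB _ _ R mu D) => //; apply: (@cintegrableZ _ _ R mu D) => //.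
        exact: iG.
      exact: cintegrable_laplace.
    split; first exact: (@cintegrableZ _ _ R mu D (k (sg t)) _ mD i1).
    rewrite /W/= (@cintZ _ _ R mu D (k (sg t)) _ mD i1) cint_laplace_exact//.
    by rewrite mulr0.
  - by apply: iP; rewrite lexx ler01.
  - by apply: iP; rewrite lexx ler01.
have rh1 : right_half (1 : R[i]) by rewrite /right_half reim ltr01.
move: h; rewrite /P (@cintZ _ _ R mu D _ _ mD (iG _ (sg_rh 1 _))) ?lexx ?ler01//.
rewrite (@cintZ _ _ R mu D _ _ mD (iG _ (sg_rh 0 _))) ?lexx ?ler01//.
rewrite sg1 sg0 Pow1 mul1r => h.
have e1 : cint mu D (G a 1) = (\int[mu]_(t in `]0, +oo[) (t `^ a * expR (- t)))%:C.
  apply: complex_eqP; rewrite !reim.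
    apply: eq_Rintegral => x _; rewrite /G mulr1.
    by rewrite cexpE !reim oppr0 cos0 sin0; ring.
  rewrite (@eq_Rintegral _ _ R mu D (cst 0)).
    by rewrite /Rintegral integral0.
  by move=> x _; rewrite /G mulr1 cexpE !reim oppr0 cos0 sin0/=; ring.
have ps : Pow s (a + 1) != 0 by exact: cexp_neq0.
have -> : - a - 1 = - (a + 1) by ring.
by rewrite PowN -e1 -h mulrC mulKf.
Qed.

End ComplexGamma.

(** * Integrals of products of generating functions *)

Section GeneratingFunction.
Context {R : realType}.
Local Notation mu := (@lebesgue_measure R).
Local Notation D := (@half_line R).
Local Notation G := laplace_integrand.

Lemma Gamma_gt0 (a : R) : 0 < a -> 0 < Gamma (a + 1).
Proof.
move=> a0; have mD : measurable D by exact: measurable_half_line.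
pose f (t : R) := t `^ a * expR (- t).
have f0 t : 0 <= f t by rewrite mulr_ge0 ?powR_ge0 ?expR_ge0.
have fi : mu.-integrable D (EFin \o f).
  apply: (@integrable_ext _ _ R mu D (fun t => t `^ a * expR (- (1 * t)))) => //.
    by move=> t _; rewrite mul1r.
  by apply: integrable_powR_expR => //; exact: ltW.
have GE : Gamma (a + 1) = \int[mu]_(t in D) f t by rewrite /Gamma addrK.
have mI : measurable (`[1, 2]%classic : set R) by exact: measurable_itv.
have ID : (`[1, 2]%classic : set R) `<=` D.
  by move=> t; rewrite /= in_itv/= => /andP[t1 _]; apply/half_lineE; lra.
have h : ((expR (- 2))%:E <= \int[mu]_(t in D) (f t)%:E)%E.
  apply: (@le_trans _ _ (\int[mu]_(t in `[1%R, 2%R]%classic) (f t)%:E)%E); last first.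
    apply: (@ge0_subset_integral _ _ R mu _ D mI mD) => //.
      exact: measurable_int fi.
    by move=> t _; rewrite lee_fin.
  have m12 : mu (`[1, 2]%classic : set R) = 1%E.
    by rewrite lebesgue_measure_itv/= lte_fin ltr1n -EFinB; congr EFin; ring.
  have e12 : (\int[mu]_(t in `[1%R, 2%R]%classic) (cst (expR (- 2))%:E t) = (expR (- 2))%:E)%E.
    apply: etrans (@integral_cst _ _ R mu _ mI _) _.
    by rewrite -[RHS]mule1; congr (_ * _)%E; exact: m12.
  rewrite -e12; apply: (@ge0_le_integral _ _ R mu _ mI).
  - by move=> t _; rewrite lee_fin expR_ge0.
  - exact: measurable_cst.
  - apply: (measurable_funS mD ID); exact: measurable_int fi.
  - move=> t; rewrite /= in_itv/= => /andP[t1 t2]; rewrite lee_fin /f.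
    rewrite -[leLHS]mul1r; apply: ler_pM; rewrite ?expR_ge0//.
      rewrite [leLHS](_ : 1 = 1 `^ a); last by rewrite powR1.
      apply: ge0_ler_powR; rewrite ?nnegrE//; first exact: ltW.
      exact: le_trans t1.
    by rewrite ler_expR lerN2.
have hf := @integrable_fin_num _ _ R mu D mD _ fi.
rewrite GE /Rintegral -lte_fin fineK//.
by apply: lt_le_trans h; rewrite lte_fin expR_gt0.
Qed.

(** With [w = 1 - z] the fraction is [1 / w - 1], and inversion maps the disc
    [|w - 1| < 1] onto the half-plane [Re > 1 / 2]. *)
Lemma Re_div_1B (z : R[i]) : cmod z < 1 -> - 2^-1 < Re (z / (1 - z)).
Proof.
move=> z1; have w0 := right_half_1B z1; set w := 1 - z in w0 *.
have wn0 := right_half_neq0 w0.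
have -> : z / w = w^-1 - 1.
  have -> : z = 1 - w by rewrite /w opprB addrC subrK.
  by field.
have n1 : cmod z ^+ 2 < 1 by rewrite expr_lt1// cmod_ge0.
move: n1; rewrite cmod_sqr => n1.
have ReV : Re w^-1 = Re w / (Re w ^+ 2 + Im w ^+ 2) by case: (w).
rewrite !reim ReV ltrBrDl (_ : 1 - 2^-1 = 2^-1 :> R); last by field.
have s0 : 0 < Re w ^+ 2 + Im w ^+ 2 by rewrite ltr_pwDl ?exprn_gt0// sqr_ge0.
rewrite ltr_pdivlMr//.
have e1 : Re w = 1 - Re z by rewrite /w !reim.
have e2 : Im w = - Im z by rewrite /w !reim sub0r.
by rewrite e1 e2; nra.
Qed.

Variables (r alpha : R) (a b : R[i]).
Hypotheses (r0 : 0 < r) (alpha0 : 0 < alpha) (ar : cmod a < r) (br : cmod b < r).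

Definition generating_integrand (t : R) : R[i] :=
  (t `^ alpha * expR (- t) / Gamma (alpha + 1))%:C *
  (A_hol r alpha t a * A_hol r alpha t b).

Let rn0 : r%:C != 0 :> R[i].
Proof. by apply: complex_neq0; rewrite gt_eqF. Qed.

Let cmod_div (z : R[i]) : cmod z < r -> cmod (z / r%:C) < 1.
Proof.
by move=> zr; rewrite cmodM cmodV cmod_real gtr0_norm// ltr_pdivrMr// mul1r.
Qed.

Let A : R[i] := a / r%:C.
Let B : R[i] := b / r%:C.
Let s : R[i] := 1 + A / (1 - A) + B / (1 - B).

Let A1 : cmod A < 1. Proof. exact: cmod_div. Qed.
Let B1 : cmod B < 1. Proof. exact: cmod_div. Qed.

Let s0 : right_half s.
Proof.
have := Re_div_1B A1; have := Re_div_1B B1.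
by rewrite /right_half /s !cReD cRe1; lra.
Qed.

Let c : R[i] := (Gamma (alpha + 1))^-1%:C * (Pow (1 - A) (- alpha - 1) * Pow (1 - B) (- alpha - 1)).

Let generating_integrandE t : generating_integrand t = c * G alpha s t.
Proof.
have nA := right_half_neq0 (right_half_1B A1); have nB := right_half_neq0 (right_half_1B B1).
rewrite /generating_integrand /A_hol !cpowE; try exact: right_half_1B.
rewrite -/A -/B /G /c.
have eA : t%:C * a / (a - r%:C) = - (t%:C * (A / (1 - A))).
  have -> : a = A * r%:C by rewrite /A divfK.
  have -> : A * r%:C - r%:C = - (r%:C * (1 - A)) by ring.
  by field; rewrite nA.
have eB : t%:C * b / (b - r%:C) = - (t%:C * (B / (1 - B))).
  have -> : b = B * r%:C by rewrite /B divfK.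
  have -> : B * r%:C - r%:C = - (r%:C * (1 - B)) by ring.
  by field; rewrite nB.
rewrite eA eB.
have -> : - (t%:C * s) = (- t)%:C + - (t%:C * (A / (1 - A))) + - (t%:C * (B / (1 - B))).
  by rewrite /s rmorphN/=; ring.
rewrite !cexpD.
have -> : cexp (- t)%:C = (expR (- t))%:C :> R[i].
  by rewrite cexpE !reim cos0 sin0 mulr1 mulr0.
rewrite !rmorphM/=; ring.
Qed.

Lemma cintegrable_generating : cintegrable mu D generating_integrand.
Proof.
have mD : measurable D by exact: measurable_half_line.
have i1 : cintegrable mu D (G alpha s) by apply: cintegrable_laplace => //; exact: ltW.
apply: (@cintegrable_ext _ _ R mu D _ _ mD _ (@cintegrableZ _ _ R mu D c _ mD i1)).
by move=> t _; rewrite generating_integrandE.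
Qed.

Lemma cint_generating :
  cint mu D generating_integrand = binom_kernel alpha (b / (r ^+ 2)%:C) a.
Proof.
have mD : measurable D by exact: measurable_half_line.
have i1 : cintegrable mu D (G alpha s) by apply: cintegrable_laplace => //; exact: ltW.
transitivity (cint mu D (fun t => c * G alpha s t)).
  by apply: cint_eq => t _; rewrite generating_integrandE.
rewrite (@cintZ _ _ R mu D c _ mD i1) cint_laplace//; last exact: ltW.
have nA := right_half_neq0 (right_half_1B A1); have nB := right_half_neq0 (right_half_1B B1).
have -> : \int[mu]_(t in `]0, +oo[) (t `^ alpha * expR (- t)) = Gamma (alpha + 1).
  by rewrite /Gamma addrK.
have AB1 : cmod (A * B) < 1.
  rewrite cmodM -[ltRHS]mulr1; apply: ltr_pM; rewrite ?cmod_ge0//.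
have E : (1 - A) * (1 - B) * s = 1 - A * B by rewrite /s; field; rewrite nA nB.
have := Pow_mul3 (- alpha - 1) (right_half_1B A1) (right_half_1B B1) s0 (right_half_1B AB1) E.
rewrite /binom_kernel (_ : a * (b / (r ^+ 2)%:C) = A * B); last first.
  by rewrite /A /B rmorphXn/=; field; rewrite rn0.
move=> <-; rewrite /c.
have g0 : (Gamma (alpha + 1))%:C != 0 :> R[i].
  by apply: complex_neq0; rewrite gt_eqF// Gamma_gt0.
have -> : (Gamma (alpha + 1))^-1%:C = ((Gamma (alpha + 1))%:C)^-1 by rewrite fmorphV.
by move: (Gamma _)%:C g0 => g g0; field.
Qed.

End GeneratingFunction.

(** * Slices of the quaternions *)

Section QuaternionSlices.
Context {R : realType}.
Implicit Types (p q I J : quat R) (z w : R[i]).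

Let oneE : (1 : quat R) = mkq 1 0 0 0. Proof. by []. Qed.

Let mulE p q : p * q = qmul p q. Proof. by []. Qed.

Lemma qcoordM p q : [/\
  qcoord (p * q) 0 = qcoord p 0 * qcoord q 0 - qcoord p 1 * qcoord q 1
    - qcoord p 2 * qcoord q 2 - qcoord p 3 * qcoord q 3,
  qcoord (p * q) 1 = qcoord p 0 * qcoord q 1 + qcoord p 1 * qcoord q 0
    + qcoord p 2 * qcoord q 3 - qcoord p 3 * qcoord q 2,
  qcoord (p * q) 2 = qcoord p 0 * qcoord q 2 - qcoord p 1 * qcoord q 3
    + qcoord p 2 * qcoord q 0 + qcoord p 3 * qcoord q 1 &
  qcoord (p * q) 3 = qcoord p 0 * qcoord q 3 + qcoord p 1 * qcoord q 2
    - qcoord p 2 * qcoord q 1 + qcoord p 3 * qcoord q 0].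
Proof. by rewrite mulE /qmul !qcoordE. Qed.

Lemma embE I z : emb I z = Re z *: 1 + Im z *: I.
Proof. by case: z. Qed.

Lemma qslice_emb I (z : R * R) : qslice I z.1 z.2 = emb I (plane z).
Proof. by []. Qed.

Lemma emb1 I : emb I 1 = 1.
Proof. by rewrite embE !reim scale1r scale0r addr0. Qed.

Lemma emb_i I : emb I 'i%C = I.
Proof. by rewrite embE !reim scale1r scale0r add0r. Qed.

Lemma embD I z w : emb I (z + w) = emb I z + emb I w.
Proof. by rewrite !embE !reim !scalerDl addrACA. Qed.

Lemma embZ I (x : R) z : emb I (x%:C * z) = x *: emb I z.
Proof. by rewrite !embE !reim !mul0r subr0 addr0 scalerDr !scalerA. Qed.

Section Slice.
Variables (I : quat R) (SI : qsphere I).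

Lemma embM z w : emb I (z * w) = emb I z * emb I w.
Proof.
rewrite !embE !reim mulrDl !mulrDr -!scalerAl -!scalerAr !mul1r !mulr1.
rewrite (_ : I * I = -1)//.
by apply: quatP => i _; rewrite !(qcoordD, qcoordN, qcoordZ); ring.
Qed.

Lemma embX z n : emb I (z ^+ n) = emb I z ^+ n.
Proof.
by elim: n => [|n IH]; rewrite ?expr0 ?emb1// !exprS embM IH.
Qed.

Lemma qconj_emb z : qconj (emb I z) = emb I (conjc z).
Proof.
have [I0 _] := (qsphereP I).1 SI; rewrite !embE !reim.
apply: quatP => -[|[|[|[|//]]]] _;
  by rewrite /qconj oneE !qcoords//= ?I0; ring.
Qed.

Lemma qmod_emb z : qmod (emb I z) = cmod z.
Proof.
have [I0 I1] := (qsphereP I).1 SI; rewrite embE /qmod cmodE oneE !qcoords//= I0.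
congr Num.sqrt; rewrite -[X in _ = _ + X]mulr1 -[X in _ = _ + _ * X]I1; ring.
Qed.

(** If a quaternion is multiplied on the left by [x + y I], its image is
    multiplied by [x + y i]: this functional turns left [C_I]-linear
    statements into complex ones. *)
Definition slice_part q : R[i] := qcoord q 0 +i* - qcoord (I * q) 0.

Lemma slice_partM z q : slice_part (emb I z * q) = z * slice_part q.
Proof.
have e1 : I * (emb I z * q) = Re z *: (I * q) - Im z *: q.
  rewrite mulrA embE mulrDr -!scalerAr mulr1 (_ : I * I = -1)// mulrDl.
  by rewrite -!scalerAl mulN1r scalerN.
have e2 : emb I z * q = Re z *: q + Im z *: (I * q).
  by rewrite embE mulrDl -!scalerAl mul1r.
rewrite /slice_part e1 e2; by apply: complex_eqP; rewrite !reim !(qcoordD, qcoordN, qcoordZ); ring.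
Qed.

Lemma slice_partD p q : slice_part (p + q) = slice_part p + slice_part q.
Proof. by apply: complex_eqP; rewrite /slice_part mulrDr !qcoordD !reim; ring. Qed.

Lemma slice_partZ (x : R) q : slice_part (x *: q) = x%:C * slice_part q.
Proof.
by apply: complex_eqP; rewrite /slice_part -scalerAr !qcoordZ !reim; ring.
Qed.

(** For [u] equal to [1], [- i], [- j], [- k] the real part of [p u] is a
    coordinate of [p]. *)
Lemma slice_part_inj p q :
  (forall u : quat R, slice_part (p * u) = slice_part (q * u)) -> p = q.
Proof.
move=> h; have h0 (u : quat R) : qcoord (p * u) 0 = qcoord (q * u) 0.
  by have /(congr1 Re) := h u; rewrite /slice_part !reim.
have c0 (u : quat R) : qcoord (u * mkq 1 0 0 0) 0 = qcoord u 0.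
  by have [-> _ _ _] := qcoordM u (mkq 1 0 0 0); rewrite !qcoordE//=; ring.
have c1 (u : quat R) : qcoord (u * mkq 0 (-1) 0 0) 0 = qcoord u 1.
  by have [-> _ _ _] := qcoordM u (mkq 0 (-1) 0 0); rewrite !qcoordE//=; ring.
have c2 (u : quat R) : qcoord (u * mkq 0 0 (-1) 0) 0 = qcoord u 2.
  by have [-> _ _ _] := qcoordM u (mkq 0 0 (-1) 0); rewrite !qcoordE//=; ring.
have c3 (u : quat R) : qcoord (u * mkq 0 0 0 (-1)) 0 = qcoord u 3.
  by have [-> _ _ _] := qcoordM u (mkq 0 0 0 (-1)); rewrite !qcoordE//=; ring.
apply: quatP => -[|[|[|[|//]]]] _; [rewrite -(c0 p) -(c0 q)|rewrite -(c1 p) -(c1 q)|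
  rewrite -(c2 p) -(c2 q)|rewrite -(c3 p) -(c3 q)]; exact: h0.
Qed.

(** Two slices do not commute; the constants [half_minus] and [half_plus]
    reduce a product across them to the slice of its left factor. *)
Definition half_minus J : quat R := 2^-1 *: (1 - I * J).
Definition half_plus J : quat R := 2^-1 *: (1 + I * J).

Lemma emb_mul_emb J z w : emb I z * emb J w =
  emb I (z * w) * half_minus J + emb I (z * conjc w) * half_plus J.
Proof.
rewrite !embM -!mulrA -mulrDr; congr (_ * _).
rewrite !embE !reim /half_minus /half_plus !mulrDl -!scalerAr -!scalerAl !mul1r !mulrDr.
rewrite !mulrN !mulr1 !mulrA (_ : I * I = -1)// mulN1r.
move: (I * J) => u; apply: quatP => i _; rewrite !(qcoordD, qcoordN, qcoordZ); by field.
Qed.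

End Slice.

Lemma qconjM p q : qconj (p * q) = qconj q * qconj p.
Proof.
by apply: quatP => -[|[|[|[|//]]]] _; rewrite /qconj !mulE /qmul !qcoords//=; ring.
Qed.

Lemma qconjZ (x : R) q : qconj (x *: q) = x *: qconj q.
Proof.
by apply: quatP => -[|[|[|[|//]]]] _; rewrite /qconj !qcoords//=; ring.
Qed.

Lemma qconjD p q : qconj (p + q) = qconj p + qconj q.
Proof.
by apply: quatP => -[|[|[|[|//]]]] _; rewrite /qconj !qcoords//=; ring.
Qed.

(** The complex number that represents [q] in the slice of [qunit q]; see
    [emb_slice_coord]. *)
Definition slice_coord q : R[i] := qcoord q 0 +i* qmod (qvec q).

Lemma qvec_sqr q : qmod (qvec q) ^+ 2 =
  qcoord q 1 ^+ 2 + qcoord q 2 ^+ 2 + qcoord q 3 ^+ 2.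
Proof.
rewrite /qmod sqr_sqrtr ?addr_ge0 ?sqr_ge0// /qvec !qcoordE//=; ring.
Qed.

Lemma qmod_slice_coord q : cmod (slice_coord q) = qmod q.
Proof.
rewrite cmodE !reim qvec_sqr /qmod; congr Num.sqrt; ring.
Qed.

Lemma qunit_neq0 q : qvec q != 0 -> qmod (qvec q) != 0.
Proof.
apply: contraNN => /eqP e; have := qvec_sqr q; rewrite e expr0n/= => h.
have s i := sqr_ge0 (qcoord q i).
have z i : (1 <= i <= 3)%N -> qcoord q i = 0.
  move: (s 1%N) (s 2%N) (s 3%N) => s1 s2 s3.
  by move: i => [//|[|[|[|//]]]] _; apply/eqP; rewrite -sqrf_eq0; apply/eqP;
    apply: le_anti; apply/andP; split; lra.
apply/eqP/quatP => -[|[|[|[|//]]]] _; rewrite /qvec qcoord0 qcoordE//= z//.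
Qed.

Lemma qsphere_qunit q : qsphere (qunit q).
Proof.
apply/qsphereP; rewrite /qunit; case: eqP => [_|/eqP v0].
  by rewrite /qi !qcoordE//=; split => //; ring.
have n0 := qunit_neq0 v0; rewrite !qcoordZ /qvec !qcoordE//= mulr0; split=> //.
rewrite -/(qvec q) !exprMn -!mulrDr -qvec_sqr exprVn mulVf//.
by rewrite sqrf_eq0.
Qed.

Lemma emb_slice_coord q : emb (qunit q) (slice_coord q) = q.
Proof.
rewrite embE !reim /qunit; case: eqP => [v0|/eqP v0].
  have -> : qmod (qvec q) = 0.
    by rewrite v0 /qmod !qcoord0 expr0n/= !addr0 sqrtr0.
  have h i : qcoord (qvec q) i = 0 by rewrite v0 qcoord0.
  have := (h 1%N, h 2%N, h 3%N); rewrite /qvec !qcoordE//= => -[[h1 h2] h3].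
  rewrite scale0r addr0; apply: quatP => -[|[|[|[|//]]]] _;
    by rewrite oneE !qcoords//= ?h1 ?h2 ?h3 ?mulr0 ?mulr1.
rewrite scalerA divff ?qunit_neq0// scale1r.
by apply: quatP => -[|[|[|[|//]]]] _; rewrite /qvec oneE !qcoords//=; ring.
Qed.

Lemma A_slice_emb (r alpha t : R) q : 0 < r -> qball r q ->
  A_slice r alpha t q = emb (qunit q) (A_hol r alpha t (slice_coord q)).
Proof.
move=> r0 qr; have S := qsphere_qunit q.
have Sqi : qsphere (qi : quat R).
  by apply/qsphereP; rewrite !qcoordE //=; split=> //; ring.
rewrite /A_slice A_formulaE//.
apply: le_lt_trans (ler_norm _) _; apply: le_lt_trans (Re_le_cmod (slice_coord q)) _.
by rewrite qmod_slice_coord.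
Qed.

End QuaternionSlices.

(** * Differentiation of quaternionic functions *)

Section RealFunctionals.
Context {R : realType}.
Implicit Types (q : quat R).

Definition real_linear (L : quat R -> R) :=
  forall (a : R) p q, L (a *: p + q) = a * L p + L q.

Lemma real_linear_coord i : real_linear (@qcoord R ^~ i).
Proof. by move=> a p q; rewrite qcoordD qcoordZ. Qed.

Lemma quat_basis q : q = qcoord q 0 *: mkq 1 0 0 0 + (qcoord q 1 *: mkq 0 1 0 0 +
  (qcoord q 2 *: mkq 0 0 1 0 + (qcoord q 3 *: mkq 0 0 0 1 + 0))).
Proof.
by apply: quatP => -[|[|[|[|//]]]] _; rewrite !qcoords//=; ring.
Qed.

Lemma real_linear_coords L : real_linear L -> exists c : R * R * R * R,
  forall q, L q = c.1.1.1 * qcoord q 0 + c.1.1.2 * qcoord q 1 +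
     c.1.2 * qcoord q 2 + c.2 * qcoord q 3.
Proof.
move=> hL; exists (L (mkq 1 0 0 0), L (mkq 0 1 0 0), L (mkq 0 0 1 0), L (mkq 0 0 0 1)).
have L0 : L 0 = 0.
  by have := hL 1 0 0; rewrite scaler0 addr0 mul1r => h; lra.
move=> q; rewrite {1}(quat_basis q) !hL L0/=; ring.
Qed.

Lemma continuous_qcoord i : continuous (@qcoord R ^~ i).
Proof. exact: coord_continuous. Qed.

Lemma differentiable_qcoord i q : differentiable (@qcoord R ^~ i : quat R -> R^o) q.
Proof.
exact: (@differentiable_coord _ _ _ (q : 'rV[R]_4) ord0 (inord i)).
Qed.

Lemma differentiable_coords (V : normedModType R) (f : V -> quat R) x :
  (forall i, (i < 4)%N -> differentiable (fun v => qcoord (f v) i : R^o) x) ->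
  differentiable f x.
Proof.
move=> df; rewrite (_ : f = fun v => qcoord (f v) 0 *: mkq 1 0 0 0 + (qcoord (f v) 1 *: mkq 0 1 0 0 +
  (qcoord (f v) 2 *: mkq 0 0 1 0 + (qcoord (f v) 3 *: mkq 0 0 0 1 + 0)))); last first.
  by apply/funext => v; exact: quat_basis.
have h i e : (i < 4)%N -> differentiable (fun v => qcoord (f v) i *: (e : quat R)) x.
  by move=> i4; apply: differentiableZl; exact: df.
by do 4 (apply: differentiableD; first exact: h); exact: differentiable_cst.
Qed.

Lemma differentiable_qpow n q : differentiable (fun q : quat R => q ^+ n) q.
Proof.
apply: differentiable_coords; elim: n => [|n IH] i i4.
  by rewrite (_ : (fun _ => _) = cst (qcoord (1 : quat R) i))//; exact: differentiable_cst.
have d j k : (j < 4)%N -> (k < 4)%N ->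
    differentiable (fun q : quat R => qcoord q j * qcoord (q ^+ n) k : R^o) q.
  move=> j4 k4; apply: differentiableM; first exact: differentiable_qcoord.
  exact: IH.
rewrite (_ : (fun _ => _) = fun v => qcoord (v * v ^+ n) i); last first.
  by apply/funext => v; rewrite exprS.
move: i i4 => [|[|[|[|//]]]] _.
- rewrite (_ : (fun _ => _) = (fun v => qcoord v 0 * qcoord (v ^+ n) 0 - qcoord v 1 * qcoord (v ^+ n) 1
    - qcoord v 2 * qcoord (v ^+ n) 2 - qcoord v 3 * qcoord (v ^+ n) 3)).
    by apply: differentiableB; [apply: differentiableB; [apply: differentiableB|]|]; exact: d.
  by apply/funext => v; have [] := qcoordM v (v ^+ n).
- rewrite (_ : (fun _ => _) = (fun v => qcoord v 0 * qcoord (v ^+ n) 1 + qcoord v 1 * qcoord (v ^+ n) 0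
    + qcoord v 2 * qcoord (v ^+ n) 3 - qcoord v 3 * qcoord (v ^+ n) 2)).
    by apply: differentiableB; [apply: differentiableD; [apply: differentiableD|]|]; exact: d.
  by apply/funext => v; have [] := qcoordM v (v ^+ n).
- rewrite (_ : (fun _ => _) = (fun v => qcoord v 0 * qcoord (v ^+ n) 2 - qcoord v 1 * qcoord (v ^+ n) 3
    + qcoord v 2 * qcoord (v ^+ n) 0 + qcoord v 3 * qcoord (v ^+ n) 1)).
    by apply: differentiableD; [apply: differentiableD; [apply: differentiableB|]|]; exact: d.
  by apply/funext => v; have [] := qcoordM v (v ^+ n).
- rewrite (_ : (fun _ => _) = (fun v => qcoord v 0 * qcoord (v ^+ n) 3 + qcoord v 1 * qcoord (v ^+ n) 2
    - qcoord v 2 * qcoord (v ^+ n) 1 + qcoord v 3 * qcoord (v ^+ n) 0)).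
    by apply: differentiableD; [apply: differentiableB; [apply: differentiableD|]|]; exact: d.
  by apply/funext => v; have [] := qcoordM v (v ^+ n).
Qed.

End RealFunctionals.

Section DirectionalDerivatives.
Context {R : realType}.

Lemma is_derive_linear (V W U : normedModType R) (L : W -> U) (F : V -> W) z v d :
  (forall (a : R) p q, L (a *: p + q) = a *: L p + L q) -> continuous L ->
  is_derive z v F d -> is_derive z v (L \o F) (L d).
Proof.
move=> hL cL [dF Fd].
have L0 : L 0 = 0.
  have := hL 1 0 0; rewrite !scale1r addr0 => h.
  by apply: (addrI (L 0)); rewrite addr0 -h.
have LB (a : R) p q : L (a *: (p - q)) = a *: (L p - L q).
  have LN u : L (- u) = - L u.
    by have := hL (-1) u 0; rewrite !addr0 !scaleN1r L0 addr0.
  have := hL a (p - q) 0; rewrite addr0 L0 addr0 => ->; congr (_ *: _).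
  by have := hL 1 p (- q); rewrite !scale1r LN.
have h : (fun h => h^-1 *: ((L \o F \o shift z) (h *: v) - (L \o F) z)) @ 0^' --> L d.
  rewrite (_ : (fun h => _) = L \o (fun h => h^-1 *: ((F \o shift z) (h *: v) - F z))).
    apply: (@continuous_cvg _ _ _ _ _ _ L); first exact: cL.
    by rewrite -Fd; exact: dF.
  by apply/funext => h /=; rewrite LB.
by apply: DeriveDef; [exact: cvgP h|exact: cvg_lim h].
Qed.

Lemma is_derive_curve (V W : normedModType R) (F : V -> W) z v d :
  is_derive (0 : R) 1 (fun t => F (t *: v + z)) d -> is_derive z v F d.
Proof.
move=> [dc cd].
have e : (fun h : R => h^-1 *: (((fun t => F (t *: v + z)) \o shift 0) (h *: (1 : R^o)) -
     F (0 *: v + z))) = (fun h => h^-1 *: ((F \o shift z) (h *: v) - F z)).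
  apply/funext => h; rewrite /= scale0r add0r addr0.
  by have -> : h *: (1 : R^o) = h by exact: mulr1.
by apply: DeriveDef; rewrite ?/derivable ?/derive -e.
Qed.

Variable I : quat R.

Lemma cder_emb (g : R -> R[i]) t d : cder g t d ->
  is_derive t 1 (fun t => emb I (g t)) (emb I d).
Proof.
move=> [g1 g2].
have h (u : R -> R) (e : quat R) du : is_derive t 1 u du ->
    is_derive t 1 (fun t => u t *: e) (du *: e).
  move=> ud; apply: (@is_derive_linear R^o R^o (quat R) (fun x => x *: e)) => //.
    by move=> a p q; rewrite scalerDl scalerA.
  exact: scalel_continuous.
rewrite (_ : (fun t => _) = (fun t => Re (g t) *: (1 : quat R)) + (fun t => Im (g t) *: I)).
  by rewrite embE; apply: is_deriveD; exact: h.
by apply/funext => x; rewrite embE.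
Qed.

Lemma continuous_emb (T : topologicalType) (g : T -> R[i]) x : ccont g x ->
  {for x, continuous (fun x => emb I (g x))}.
Proof.
move=> [g1 g2]; rewrite (_ : (fun x => _) = fun x => (Re \o g) x *: (1 : quat R) + (Im \o g) x *: I).
  by apply: cvgD; exact: cvgZr_tmp.
by apply/funext => y; rewrite embE.
Qed.

Lemma is_derive_emb_comp (f : quat R -> quat R) (g : R -> R[i]) t d :
  differentiable f (emb I (g t)) -> cder g t d ->
  is_derive t 1 (fun t => f (emb I (g t))) ('d f (emb I (g t)) (emb I d)).
Proof.
move=> df /cder_emb [dg gd].
have dg' : differentiable (fun t => emb I (g t)) t by apply/derivable1_diffP.
have dfg : differentiable (f \o (fun t => emb I (g t))) t by exact: differentiable_comp.
apply: DeriveDef; first exact: diff_derivable.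
by rewrite deriveE// diff_comp//= -gd deriveE.
Qed.

Lemma is_derive_fslice (f : quat R -> quat R) (z v : R^o * R^o) :
  differentiable f (emb I (plane z)) ->
  is_derive z v (fslice f I : R^o * R^o -> quat R) ('d f (emb I (plane z)) (emb I (plane v))).
Proof.
move=> df; apply: is_derive_curve.
have g := cder_line (plane z) (plane v).
have z0 : plane z + plane v * 0%:C = plane z by rewrite mulr0 addr0.
have := @is_derive_emb_comp f _ 0 _ _ g; rewrite z0 => /(_ df).
congr is_derive; apply/funext => t; congr (f _); rewrite qslice_emb; congr emb.
have sE (x : R^o) : t *: x = t * x by [].
by apply: complex_eqP; rewrite !reim/= /plane ?reim sE; ring.
Qed.

End DirectionalDerivatives.

Section SlicePartFunctional.
Context {R : realType}.
Variables (I : quat R) (SI : qsphere I).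
Implicit Types u q : quat R.

Lemma real_linear_Re_slice_part u : real_linear (fun q => Re (slice_part I (q * u))).
Proof.
move=> a p q; rewrite mulrDl -scalerAl slice_partD slice_partZ !reim; ring.
Qed.

Lemma real_linear_Im_slice_part u : real_linear (fun q => Im (slice_part I (q * u))).
Proof.
move=> a p q; rewrite mulrDl -scalerAl slice_partD slice_partZ !reim; ring.
Qed.

Lemma continuous_real_linear (L : quat R -> R) : real_linear L -> continuous L.
Proof.
move=> /real_linear_coords[c cE] q; rewrite (_ : L = fun q => c.1.1.1 * qcoord q 0 +
  c.1.1.2 * qcoord q 1 + c.1.2 * qcoord q 2 + c.2 * qcoord q 3); last exact/funext.
have h i (k : R) : {for q, continuous (fun q : quat R => k * qcoord q i)}.
  by apply: continuousM; [exact: cst_continuous|exact: continuous_qcoord].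
exact (cvgD (cvgD (cvgD (h 0%N _) (h 1%N _)) (h 2%N _)) (h 3%N _)).
Qed.

Lemma cder_slice_part (F : R -> quat R) u (t : R) d : is_derive t 1 F d ->
  cder (fun t => slice_part I (F t * u)) t (slice_part I (d * u)).
Proof.
move=> Fd; split.
  apply: (@is_derive_linear _ _ _ R^o (fun q => Re (slice_part I (q * u)))) Fd.
    exact: real_linear_Re_slice_part.
  by apply: continuous_real_linear; exact: real_linear_Re_slice_part.
apply: (@is_derive_linear _ _ _ R^o (fun q => Im (slice_part I (q * u)))) Fd.
  exact: real_linear_Im_slice_part.
by apply: continuous_real_linear; exact: real_linear_Im_slice_part.
Qed.

Lemma ccont_slice_part (T : topologicalType) (F : T -> quat R) u t :
  {for t, continuous F} -> ccont (fun t => slice_part I (F t * u)) t.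
Proof.
move=> cF; split.
  apply: (continuous_comp cF (g := fun q => Re (slice_part I (q * u)))).
  by apply: continuous_real_linear; exact: real_linear_Re_slice_part.
apply: (continuous_comp cF (g := fun q => Im (slice_part I (q * u)))).
by apply: continuous_real_linear; exact: real_linear_Im_slice_part.
Qed.

Variable (r : R).

Lemma qball_emb z : qball r (emb I z) <-> cmod z < r.
Proof. by rewrite /qball/= qmod_emb. Qed.

Lemma qslice_disc_cmod z : qslice_disc r I z <-> cmod (plane z) < r.
Proof. by rewrite -qball_emb -qslice_emb. Qed.

Section Holomorphic.
Variables (f : quat R -> quat R) (u : quat R).
Hypothesis hf : slice_regular r f.

Definition slice_function (z : R[i]) : R[i] := slice_part I (f (emb I z) * u).
Definition slice_function' (z : R[i]) : R[i] :=
  slice_part I ('D_((1, 0) : R^o * R^o) (fslice f I : R^o * R^o -> quat R) (Re z, Im z) * u).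

Lemma ccont_slice_function (z : R[i]) : cmod z < r -> ccontC slice_function z.
Proof.
move=> zr; rewrite ccontCE; apply: ccont_slice_part.
have cf : {for emb I z, continuous f}.
  by apply: differentiable_continuous; apply: (proj1 hf); apply/qball_emb.
have ce := @continuous_emb R I _ plane _ (ccont_plane (Re z, Im z)).
by apply: (continuous_comp ce); rewrite plane_ReIm.
Qed.

(** The Cauchy-Riemann equation says that the differential of [f] sends [I] to
    [I] times the image of [1], so along the slice it is left multiplication
    by elements of [C_I], which [slice_part] turns into complex
    multiplication. *)
Lemma holo_slice_function :
  holo (fun z => cmod z < r) slice_function slice_function'.
Proof.
have df z : cmod z < r -> differentiable f (emb I z).
  by move=> zr; apply: (proj1 hf); apply/qball_emb.
split=> [g t d gr gd|z zr].
  have h := is_derive_emb_comp (df _ gr) gd.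
  apply: cder_eq (cder_slice_part u h); rewrite /slice_function'.
  have gE := plane_ReIm (g t).
  have dg : differentiable f (emb I (plane (Re (g t), Im (g t)))) by rewrite gE; exact: df.
  have [_ ->] := is_derive_fslice (1, 0) dg.
  have gD : qslice_disc r I (Re (g t), Im (g t)) by apply/qslice_disc_cmod; rewrite gE.
  have [_ _ _] := proj2 hf _ SI _ gD.
  have [_ ->] := is_derive_fslice (1, 0) dg.
  have [_ ->] := is_derive_fslice (0, 1) dg.
  rewrite gE; have -> : plane (1, 0) = 1 :> R[i] by [].
  have -> : plane (0, 1) = 'i%C :> R[i] by [].
  rewrite emb1 emb_i; set X := 'd f _ 1; set Y := 'd f _ I => XY.
  have YE : Y = I * X.
    apply/esym/subr0_eq.
    by rewrite -[RHS](mulr0 I) -XY mulrDr mulrA (_ : I * I = -1)// mulN1r.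
  have -> : 'd f (emb I (g t)) (emb I d) = emb I d * X.
    by rewrite (embE I d) linearD !linearZ/= -/X -/Y YE mulrDl -!scalerAl mul1r.
  by rewrite -mulrA slice_partM// mulrC.
split; first exact: ccont_slice_function.
have zD : qslice_disc r I (Re z, Im z) by apply/qslice_disc_cmod; rewrite plane_ReIm.
have [_ c _ _] := proj2 hf _ SI _ zD.
rewrite ccontCE; apply: (@ccont_ext _ _ (fun p : R * R => slice_part I
  ('D_((1, 0) : R^o * R^o) (fslice f I : R^o * R^o -> quat R) p * u))).
  by move=> -[x y].
exact: ccont_slice_part.
Qed.

End Holomorphic.

End SlicePartFunctional.

(** * Members of the Bergman space *)

Section BergmanSections.
Context {R : realType}.
Local Notation mu := (@lebesgue_measure R).
Local Notation mu2 := (mu \x mu)%E.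
Variables (r alpha : R).
Hypotheses (r0 : 0 < r) (alpha0 : 0 < alpha).
Local Notation w := (weight r alpha).

Lemma slice_regular_qpow n : slice_regular r (fun q : quat R => q ^+ n).
Proof.
split=> [q _|I SI z zD]; first exact: differentiable_qpow.
pose fI : R^o * R^o -> quat R := fslice (fun q : quat R => q ^+ n) I.
have D (p v : R^o * R^o) : is_derive p v fI (emb I (n%:R * plane p ^+ n.-1 * plane v)).
  apply: is_derive_curve.
  have g := cder_line (plane p) (plane v).
  have := cder_emb I (cderX n g); rewrite mulr0 addr0.
  congr is_derive; apply/funext => t; rewrite embX// /fI /fslice qslice_emb; congr (emb _ _ ^+ _).
  have sE (x : R^o) : t *: x = t * x by [].
  by apply: complex_eqP; rewrite !reim/= /plane ?reim sE; ring.
have e v : 'D_v fI = fun p => emb I (n%:R * plane p ^+ n.-1 * plane v).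
  by apply/funext => p; apply: derive_val.
have c v : {for z, continuous ('D_v fI)}.
  rewrite e; apply: continuous_emb; apply: ccontM; last exact: ccont_cst.
  apply: ccontM; first exact: ccont_cst.
  by apply: ccontX; exact: ccont_plane.
split; [split; exact: ex_derive|exact: c|exact: c|].
rewrite -[LHS]/('D_((1, 0) : R^o * R^o) fI z + I * 'D_((0, 1) : R^o * R^o) fI z).
have [_ ->] := D z (1, 0); have [_ ->] := D z (0, 1).
have -> : plane (1, 0) = 1 :> R[i] by [].
have -> : plane (0, 1) = 'i%C :> R[i] by [].
rewrite -{2}(emb_i I) -embM// -embD; set m := n%:R * _.
have -> : m * 1 + 'i%C * (m * 'i%C) = 0.
  have ii : 'i%C * 'i%C = -1 :> R[i] by apply: complex_eqP; rewrite !reim; ring.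
  by rewrite mulrCA ii mulrN1 mulr1 subrr.
by rewrite embE !reim !scale0r addr0.
Qed.

Section OneSlice.
Variables (I : quat R) (SI : qsphere I).

Lemma qslice_disc_disc : qslice_disc r I = disc r.
Proof.
apply/seteqP; split => z.
  by move=> /(qslice_disc_cmod SI) zr; apply/disc_cmod => //; exact: ltW.
by move=> /(disc_cmod _ (ltW r0)) zr; apply/(qslice_disc_cmod SI).
Qed.

Lemma bergman_weightE z : bergman_weight r alpha I z = w z.
Proof. by rewrite /bergman_weight /weight qslice_emb qmod_emb// cmod_plane_sqr. Qed.

End OneSlice.

Lemma bergman_space_qpow n : bergman_space r alpha (fun q : quat R => q ^+ n).
Proof.
split=> [|I SI]; first exact: slice_regular_qpow.
rewrite qslice_disc_disc//.
have [h _] := sqnorm_moment r0 alpha0 n.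
have e z : disc r z -> sqnorm z ^+ n * w z =
    qmod (fslice (fun q : quat R => q ^+ n) I z) ^+ 2 * bergman_weight r alpha I z.
  move=> _; rewrite bergman_weightE// /fslice qslice_emb -embX// qmod_emb// cmodX.
  by rewrite exprAC cmod_plane_sqr.
exact (@integrable_ext _ _ R mu2 (disc r) _ _ (measurable_disc r) e h).
Qed.

Section SliceRestriction.
Variables (I : quat R) (SI : qsphere I) (f : quat R -> quat R).
Hypothesis hf : bergman_space r alpha f.

Lemma continuous_section (L : quat R -> R) z : real_linear L -> disc r z ->
  {for z, continuous (fun z => L (f (emb I (plane z))))}.
Proof.
move=> hL zD.
have ce := @continuous_emb R I _ plane _ (ccont_plane z).
have cf : {for emb I (plane z), continuous f}.
  apply: differentiable_continuous; apply: (proj1 (proj1 hf)).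
  by apply/(qslice_disc_cmod SI); apply/disc_cmod => //; exact: ltW.
have cfe := continuous_comp ce cf.
have cL : {for (f \o (fun z => emb I (plane z))) z, continuous L}.
  exact: continuous_real_linear.
exact (@continuous_comp _ _ _ _ L _ cfe cL).
Qed.

(** Square integrability suffices because the weighted measure is finite: a
    coordinate of [f] is at most [1 + |f|^2]. *)
Lemma integrable_section (L : quat R -> R) (h : R * R -> R) B : real_linear L ->
  (forall z, disc r z -> {for z, continuous h}) -> (forall z, disc r z -> `|h z| <= B) ->
  mu2.-integrable (disc r) (EFin \o (fun z => h z * (L (f (emb I (plane z))) * w z))).
Proof.
move=> hL ch hB; have mD := @measurable_disc R r.
have [c cE] := real_linear_coords hL.
pose C := `|c.1.1.1| + `|c.1.1.2| + `|c.1.2| + `|c.2|.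
have LC q : `|L q| <= C * (1 + qmod q ^+ 2).
  have q2 : qmod q ^+ 2 = qcoord q 0 ^+ 2 + qcoord q 1 ^+ 2 + qcoord q 2 ^+ 2 + qcoord q 3 ^+ 2.
    by rewrite /qmod sqr_sqrtr// !addr_ge0 ?sqr_ge0.
  have s i := sqr_ge0 (qcoord q i).
  have bd (k : R) i : (i < 4)%N -> `|k * qcoord q i| <= `|k| * (1 + qmod q ^+ 2).
    move=> i4; rewrite normrM; apply: ler_wpM2l => //.
    have h1 : `|qcoord q i| <= 1 + qcoord q i ^+ 2.
      by rewrite -real_normK ?num_real//; have := sqr_ge0 (`|qcoord q i| - 1); nra.
    apply: le_trans h1 _; rewrite lerD2l q2.
    by move: i i4 (s 0%N) (s 1%N) (s 2%N) (s 3%N) => [|[|[|[|//]]]] _ ? ? ? ?; lra.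
  rewrite cE /C !mulrDl.
  by repeat (apply: le_trans (ler_normD _ _) _; apply: lerD; last exact: bd); exact: bd.
have hf2 := proj2 hf I SI; rewrite (qslice_disc_disc SI) in hf2.
have i2 : mu2.-integrable (disc r) (EFin \o (fun z => qmod (f (emb I (plane z))) ^+ 2 * w z)).
  apply: (@integrable_ext _ _ R mu2 (disc r) _ _ mD _ hf2).
  by move=> z _; rewrite bergman_weightE.
have i1 := @integrable_weight R r alpha r0 alpha0.
have i3 := @rintegrableZ _ _ R mu2 (disc r) (`|B| * C) _ mD
  (@rintegrableD _ _ R mu2 (disc r) _ _ mD i1 i2).
apply: (@le_integrable _ _ R mu2 (disc r) mD _ _ _ _ i3).
  apply/measurable_EFinP; apply: (@continuous_at_measurable_prod R _ _ mD) => z zD.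
  apply: continuousM; first exact: ch.
  by apply: continuousM; [exact: continuous_section|exact: continuous_weight].
move=> z zD; rewrite /= lee_fin; have w0 := weight_gt0 r0 alpha0 zD.
rewrite (normrM (h z)) (normrM (L _)) (ger0_norm (ltW w0)).
have -> : w z + qmod (f (emb I (plane z))) ^+ 2 * w z =
  (1 + qmod (f (emb I (plane z))) ^+ 2) * w z by ring.
set Q := 1 + _; have Q0 : 0 <= Q by rewrite addr_ge0 ?sqr_ge0.
have C0 : 0 <= C by rewrite !addr_ge0.
have g0 : 0 <= `|B| * C * (Q * w z) by apply: mulr_ge0; [exact: mulr_ge0|exact: (mulr_ge0 Q0 (ltW w0))].
rewrite (ger0_norm g0) -[leRHS]mulrA; apply: ler_pM => //.
- by apply: mulr_ge0; [exact: normr_ge0|exact: ltW].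
- exact: le_trans (hB _ zD) (ler_norm _).
- by rewrite [leRHS]mulrA; apply: ler_wpM2r; [exact: ltW|exact: LC].
Qed.

End SliceRestriction.

End BergmanSections.

(** * The kernel on a slice *)

Section QuaternionIntegral.
Context d (T : measurableType d) {R : realType} (m : {measure set T -> \bar R}).
Implicit Types (D : set T) (F : T -> quat R).

Lemma real_linear_integral D F L : measurable D -> qintegrable m D F ->
  real_linear L -> \int[m]_(x in D) L (F x) = L (qintegral m D F).
Proof.
move=> mD iF /real_linear_coords[c cE].
have h i (k : R) : (i < 4)%N -> m.-integrable D (EFin \o (fun x => k * qcoord (F x) i)).
  by move=> i4; apply: rintegrableZ => //; exact: iF.
have h01 := rintegrableD mD (h 0%N c.1.1.1 isT) (h 1%N c.1.1.2 isT).
have h2 := rintegrableD mD h01 (h 2%N c.1.2 isT).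
rewrite cE /qintegral !qcoordE//=.
rewrite -!RintegralZl//; try by apply: iF.
rewrite -RintegralD//; try exact: (h 0%N); try exact: (h 1%N).
rewrite -RintegralD//; last exact: (h 2%N).
rewrite -RintegralD//; last exact: (h 3%N).
by apply: eq_Rintegral => x _; rewrite cE.
Qed.

Lemma qintegral_emb_comb I D (g1 g2 : T -> R[i]) (p1 p2 : quat R) : measurable D ->
  cintegrable m D g1 -> cintegrable m D g2 ->
  let F x := emb I (g1 x) * p1 + emb I (g2 x) * p2 in
  qintegrable m D F /\
  qintegral m D F = emb I (cint m D g1) * p1 + emb I (cint m D g2) * p2.
Proof.
move=> mD [r1 i1] [r2 i2] F.
have cE z1 z2 i : qcoord (emb I z1 * p1 + emb I z2 * p2) i =
    qcoord p1 i * Re z1 + qcoord (I * p1) i * Im z1 +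
    (qcoord p2 i * Re z2 + qcoord (I * p2) i * Im z2).
  by rewrite !embE !mulrDl -!scalerAl !mul1r !(qcoordD, qcoordZ); ring.
have h1 i := rintegrableD mD (rintegrableZ (qcoord p1 i) mD r1)
  (rintegrableZ (qcoord (I * p1) i) mD i1).
have h2 i := rintegrableD mD (rintegrableZ (qcoord p2 i) mD r2)
  (rintegrableZ (qcoord (I * p2) i) mD i2).
split=> [i i4|].
  apply: integrable_ext (rintegrableD mD (h1 i) (h2 i)) => // x _ /=.
  by rewrite cE.
have hi i : \int[m]_(x in D) qcoord (F x) i =
    qcoord (emb I (cint m D g1) * p1 + emb I (cint m D g2) * p2) i.
  rewrite cE /cint/= -!RintegralZl// -!RintegralD//; try exact: rintegrableZ;
    try exact: h1; try exact: h2.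
  by apply: eq_Rintegral => x _; rewrite cE.
by apply: quatP => -[|[|[|[|//]]]] _; rewrite /qintegral qcoordE//= hi.
Qed.

End QuaternionIntegral.

Section KernelFormula.
Context {R : realType}.
Local Notation mu := (@lebesgue_measure R).
Local Notation mu2 := (mu \x mu)%E.
Variables (r alpha : R) (K : quat R -> quat R -> quat R) (q' : quat R).
Hypotheses (r0 : 0 < r) (alpha0 : 0 < alpha) (hK : is_bergman_kernel r alpha K)
  (q'r : qball r q').
Local Notation w := (weight r alpha).
Local Notation f := (K ^~ q').

Let hf : bergman_space r alpha f.
Proof. by have [h _ _] := hK; exact: h. Qed.

Section OneSlice.
Variables (I : quat R) (SI : qsphere I) (u : quat R).
Local Notation phi := (slice_function I f u).

Lemma cintegrable_slice_function :
  cintegrable mu2 (disc r) (fun z => phi (plane z) * (w z)%:C).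
Proof.
have mD := @measurable_disc R r.
have c1 z : disc r z -> {for z, continuous (fun=> 1 : R)} by move=> _; exact: cst_continuous.
have b1 z : disc r z -> `|1 : R| <= 1 by rewrite normr1.
split.
  have h := integrable_section r0 alpha0 SI hf (real_linear_Re_slice_part I u) c1 b1.
  have e z : disc r z -> 1 * (Re (phi (plane z)) * w z) = Re (phi (plane z) * (w z)%:C).
    by move=> _; rewrite !reim mul1r mulr0 subr0.
  exact (@integrable_ext _ _ R mu2 (disc r) _ _ mD e h).
have h := integrable_section r0 alpha0 SI hf (real_linear_Im_slice_part I u) c1 b1.
have e z : disc r z -> 1 * (Im (phi (plane z)) * w z) = Im (phi (plane z) * (w z)%:C).
  by move=> _; rewrite !reim mul1r mulr0 add0r.
exact (@integrable_ext _ _ R mu2 (disc r) _ _ mD e h).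
Qed.

(** Apply the conjugate of the reproducing formula to the monomial of degree
    [n]: by hermitian symmetry the kernel moves from [K q' z] to [K z q'], and
    the conjugate of [z^n] comes out on the left, where [slice_part] is
    linear. *)
Lemma kernel_moment n : cint mu2 (disc r) (moment_integrand r alpha phi n) =
  slice_part I (qconj (q' ^+ n) * u).
Proof.
have mD := @measurable_disc R r.
have [_ herm rep] := hK.
have := rep _ (bergman_space_qpow r0 alpha0 n) _ q'r I SI.
rewrite (qslice_disc_disc r0 SI); set G := (fun z => _ : quat R) => qn.
have GE z : disc r z -> G z = w z *: (qconj (f (emb I (plane z))) * emb I (plane z ^+ n)).
  move=> zD; rewrite /G bergman_weightE// /fslice qslice_emb embX// herm//.
  by apply/(qslice_disc_cmod SI); apply/disc_cmod => //; exact: ltW.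
have conjL : forall L : quat R -> R, real_linear L -> real_linear (fun p => L (qconj p)).
  by move=> L hL a p1 p2; rewrite qconjD qconjZ hL.
have iG : qintegrable mu2 (disc r) G.
  move=> k k4.
  have l1 : real_linear (fun p : quat R => qcoord (qconj p) k).
    exact: (conjL _ (real_linear_coord k)).
  have l2 : real_linear (fun p : quat R => qcoord (qconj p * I) k).
    apply: (conjL (fun p => qcoord (p * I) k)) => a p1 p2.
    by rewrite mulrDl -scalerAl qcoordD qcoordZ.
  have cz z : ccont (fun z : R * R => plane z ^+ n) z by apply: ccontX; exact: ccont_plane.
  have bz z : disc r z -> cmod (plane z ^+ n) <= r ^+ n.
    move=> /(disc_cmod _ (ltW r0)) /ltW zr; rewrite cmodX.
    by rewrite lerXn2r ?nnegrE ?cmod_ge0 ?(ltW r0).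
  have h1 := @integrable_section R r alpha r0 alpha0 I SI f hf _ (fun z => Re (plane z ^+ n)) (r ^+ n) l1
     (fun z _ => proj1 (cz z)) (fun z zD => le_trans (Re_le_cmod _) (bz z zD)).
  have h2 := @integrable_section R r alpha r0 alpha0 I SI f hf _ (fun z => Im (plane z ^+ n)) (r ^+ n) l2
     (fun z _ => proj2 (cz z)) (fun z zD => le_trans (Im_le_cmod _) (bz z zD)).
  have e z : disc r z ->
      Re (plane z ^+ n) * (qcoord (qconj (f (emb I (plane z)))) k * w z) +
      Im (plane z ^+ n) * (qcoord (qconj (f (emb I (plane z))) * I) k * w z) = qcoord (G z) k.
    move=> zD; rewrite GE// (embE I (plane z ^+ n)) mulrDr -(scalerAr (Re (plane z ^+ n))) -(scalerAr (Im (plane z ^+ n))) mulr1.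
    by rewrite !(qcoordD, qcoordZ); ring.
  exact (@integrable_ext _ _ R mu2 (disc r) _ _ mD e
    (@rintegrableD _ _ R mu2 (disc r) _ _ mD h1 h2)).
have e z : disc r z -> slice_part I (qconj (G z) * u) = moment_integrand r alpha phi n z.
  move=> zD; rewrite GE// qconjZ qconjM qconj_emb// -scalerAl -mulrA.
  rewrite slice_partZ slice_partM// /moment_integrand /slice_function.
  have -> : qconj (qconj (f (emb I (plane z)))) = f (emb I (plane z)).
    by apply: quatP => -[|[|[|[|//]]]] _; rewrite /qconj !qcoordE//= opprK.
  rewrite (_ : conjc (plane z ^+ n) = conjc (plane z) ^+ n); last exact: rmorphXn.
  by move: (slice_part _ _) (conjc _ ^+ n) => a b; ring.
have hRe := @real_linear_integral _ _ R mu2 (disc r) G _ mD iG (conjL _ (real_linear_Re_slice_part I u)).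
have hIm := @real_linear_integral _ _ R mu2 (disc r) G _ mD iG (conjL _ (real_linear_Im_slice_part I u)).
rewrite -qn in hRe hIm.
apply: complex_eqP.
  rewrite -hRe; apply: eq_Rintegral => z; rewrite inE => zD; by rewrite -e.
rewrite -hIm; apply: eq_Rintegral => z; rewrite inE => zD; by rewrite -e.
Qed.

End OneSlice.

Local Notation z' := (slice_coord q').
Local Notation r2 := ((r ^+ 2)%:C : R[i]).

(** The conjugate of [q'^n] lies in the slice of [q']; brought to the slice of
    [q] by [emb_mul_emb], it shows that the moments of each component are a
    combination of the powers of [conj z'] and of [z']. *)
Lemma kernel_formula q : qball r q -> let I := qunit q in let z := slice_coord q in
  K q q' = emb I (binom_kernel alpha (conjc z' / r2) z) * half_minus I (qunit q')
         + emb I (binom_kernel alpha (z' / r2) z) * half_plus I (qunit q').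
Proof.
move=> qr I z; have SI : qsphere I by exact: qsphere_qunit.
have SJ : qsphere (qunit q') by exact: qsphere_qunit.
have zr : cmod z < r by rewrite /z qmod_slice_coord.
have z'r : cmod z' < r by rewrite qmod_slice_coord.
have r20 : 0 < r ^+ 2 by exact: exprn_gt0.
have r2n : r2 != 0 by apply: complex_neq0; rewrite gt_eqF.
have br b : cmod b < r -> cmod (b / r2) * r < 1.
  move=> bb; rewrite cmodM cmodV cmod_real gtr0_norm// expr2 invfM !mulrA.
  by rewrite divfK ?gt_eqF// ltr_pdivrMr// mul1r.
apply: (@slice_part_inj R I) => u.
have hm n : cint mu2 (disc r) (moment_integrand r alpha (slice_function I f u) n) =
    slice_part I (half_minus I (qunit q') * u) * (r2 * (conjc z' / r2)) ^+ n +
    slice_part I (half_plus I (qunit q') * u) * (r2 * (z' / r2)) ^+ n.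
  rewrite kernel_moment//.
  have e (b : R[i]) : r2 * (b / r2) = b by rewrite mulrC divfK.
  rewrite !e -{1}(emb_slice_coord q') -embX// qconj_emb//.
  rewrite -[X in slice_part I (X * u)]mul1r -(emb1 I) emb_mul_emb// !mul1r.
  rewrite mulrDl slice_partD -!mulrA !slice_partM//.
  have cX (b : R[i]) : conjc (b ^+ n) = conjc b ^+ n by exact: rmorphXn.
  have cK (b : R[i]) : conjc (conjc b) = b by case: b => x y /=; rewrite opprK.
  by rewrite !cX cK mulrC [X in _ + X]mulrC.
have h := determined_by_moments r0 alpha0 (holo_slice_function SI u (proj1 hf))
  (cintegrable_slice_function SI u) _ _ hm zr.
have := h _ _; rewrite {1}/slice_function emb_slice_coord => -> //.
- by rewrite mulrDl slice_partD -!mulrA !slice_partM// mulrC [X in _ + X]mulrC.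
- by apply: br; rewrite cmodJ.
- exact: br.
Qed.

End KernelFormula.

(** * The integral representation *)

Theorem theorem3p9 (R : realType) (r alpha : R)
    (K : quat R -> quat R -> quat R) (q q' : quat R) :
  0 < r -> 0 < alpha -> is_bergman_kernel r alpha K ->
  qball r q -> qball r q' ->
  let F := fun t : R =>
    (t `^ alpha * expR (- t) / Gamma (alpha + 1)) *:
    (A_slice r alpha t q * qconj (A_slice r alpha t q')) in
  qintegrable (@lebesgue_measure R) `]0, +oo[ F /\
  qintegral (@lebesgue_measure R) `]0, +oo[ F = K q q'.
Proof.
move=> r0 alpha0 hK qr q'r F.
pose I := qunit q; pose J := qunit q'.
pose z := slice_coord q; pose z' := slice_coord q'.
have SI : qsphere I by exact: qsphere_qunit.
have SJ : qsphere J by exact: qsphere_qunit.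
have zr : cmod z < r by rewrite qmod_slice_coord.
have z'r : cmod z' < r by rewrite qmod_slice_coord.
have cz'r : cmod (conjc z') < r by rewrite cmodJ.
pose g1 := generating_integrand r alpha z (conjc z').
pose g2 := generating_integrand r alpha z z'.
have conj_A t : conjc (A_hol r alpha t z') = A_hol r alpha t (conjc z').
  rewrite -conjc_A_hol//; apply: le_lt_trans (ler_norm _) _.
  exact: le_lt_trans (Re_le_cmod z') z'r.
have cK (b : R[i]) : conjc (conjc b) = b by case: b => x y /=; rewrite opprK.
have FE t : F t = emb I (g1 t) * half_minus I J + emb I (g2 t) * half_plus I J.
  rewrite /F !A_slice_emb// qconj_emb// emb_mul_emb// cK conj_A.
  by rewrite scalerDr !scalerAl -!embZ.
have mD : measurable (`]0, +oo[%classic : set R) by exact: measurable_itv.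
have i1 := cintegrable_generating r0 alpha0 zr cz'r.
have i2 := cintegrable_generating r0 alpha0 zr z'r.
have -> : F = fun t => emb I (g1 t) * half_minus I J + emb I (g2 t) * half_plus I J.
  exact/funext.
have [iF ->] := @qintegral_emb_comb _ _ R (@lebesgue_measure R) I _ g1 g2
  (half_minus I J) (half_plus I J) mD i1 i2.
split; first exact: iF.
rewrite (kernel_formula r0 alpha0 hK q'r qr).
by rewrite (cint_generating r0 alpha0 zr cz'r) (cint_generating r0 alpha0 zr z'r).
Qed.
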